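(* Let $0<\theta<2\pi$ and $0<q<1$. The measure $\nu^*=\nu^*_q\in\mathcal{P}(\mathbb{S}^1)$ with $\nu^*(A_\theta)=q$ such that $$I(\nu^* )=\inf\{I(\nu):\nu\in\mathcal{P}(\mathbb{S}^1),\ \nu(A_\theta)=q\}$$ is unique, and: (i) if $q\ge\frac{\theta}{2\pi}$, it is given by $$d\nu^*(e^{i\psi})=\frac{\sqrt{|\cos\psi-\alpha|}}{2\pi\sqrt{|\cos\psi-\cos(\theta/2)|}}\,d\psi,\qquad e^{i\psi}\in A_\theta\cup\{z\in\mathbb{S}^1:\arccos(\alpha)\le\arg z\le2\pi-\arccos(\alpha)\}$$ (and $\nu^*$ vanishes outside this set), where $\alpha\le\cos(\theta/2)$ is determined from the equation $$\int_{-1}^{\alpha}\frac{\sqrt{|x-\alpha|}}{\pi\sqrt{|(x+1)(x-\cos(\theta/2))(x-1)|}}\,dx=1-q;$$ (ii) if $q\le\frac{\theta}{2\pi}$, it is given by $$d\nu^*(e^{i\psi})=\frac{\sqrt{|\cos\psi-\alpha|}}{2\pi\sqrt{|\cos\psi-\cos(\theta/2)|}}\,d\psi,\qquad e^{i\psi}\in A^c_\theta\cup\{z\in\mathbb{S}^1:-\arccos(\alpha)\le\arg z\le\arccos(\alpha)\}$$ (and $\nu^*$ vanishes outside this set), where $\alpha\ge\cos(\theta/2)$ is a solution to the equation $$\int_{-1}^{\cos(\theta/2)}\frac{\sqrt{|x-\alpha|}}{\pi\sqrt{|(x+1)(x-\cos(\theta/2))(x-1)|}}\,dx=1-q.$$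
   Context: $\mathbb{S}^1=\{z\in\mathbb{C}:|z|=1\}$ and $\mathcal{P}(\mathbb{S}^1)$ is the set of Borel probability measures on $\mathbb{S}^1$. The logarithmic energy of $\nu\in\mathcal{P}(\mathbb{S}^1)$ is $I(\nu):=\iint\log\frac{1}{|z-\zeta|}\,d\nu(z)\,d\nu(\zeta)\in(-\infty,+\infty]$. The arcs are $A_\theta:=\{z\in\mathbb{S}^1:-\frac{\theta}{2}\le\arg z\le\frac{\theta}{2}\}$ and $A^c_\theta:=\{z\in\mathbb{S}^1:\frac{\theta}{2}\le\arg z\le2\pi-\frac{\theta}{2}\}$. The parameter $\alpha$ lies in $[-1,1]$. *)

(* Defs.v *)
From HB Require Import structures.
From mathcomp Require Import all_boot all_order all_algebra.
From mathcomp Require Import complex.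
From mathcomp Require Import all_classical all_reals all_analysis.

Set Implicit Arguments.
Unset Strict Implicit.
Unset Printing Implicit Defensive.

Import Order.TTheory GRing.Theory Num.Theory.
Import numFieldNormedType.Exports.

Local Open Scope classical_set_scope.
Local Open Scope ring_scope.
Local Open Scope complex_scope.

(* The analysis library equips the carrier of an abstract numFieldType with its
   norm topology; this makes that same topology available on the type R[i]. *)
HB.instance Definition _ (R : realType) :=
  PseudoPointedMetric.copy R[i] R[i]^o.

Definition unit_circle (R : realType) : set R[i] := [set z | `|z| = 1].

(* As a type, [unit_circle R] carries the library's subspace topology
   inherited from R[i]. *)
Notation circle R := (set_type (@unit_circle R)).

Lemma expi_subproof (R : realType) (psi : R) :
  (cos psi +i* sin psi) \in @unit_circle R.
Proof. by apply/mem_set; rewrite /unit_circle /= normc_def /= cos2Dsin2 sqrtr1. Qed.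

(* The point e^{i psi} of the circle. *)
Definition expi (R : realType) (psi : R) : circle R :=
  SigSub (expi_subproof psi).

HB.instance Definition _ (R : realType) :=
  isPointed.Build (circle R) (expi (0 : R)).

Notation circle_borel R := (g_sigma_algebraType (@open (circle R))).

(* P(S^1). *)
Notation circle_prob R := (probability (circle_borel R) R).

(* The points of the circle having an argument in [a, b]. *)
Definition circle_arc (R : realType) (a b : R) : set (circle_borel R) :=
  @expi R @` `[a, b].

Definition arcA (R : realType) (theta : R) : set (circle_borel R) :=
  circle_arc (- (theta / 2)) (theta / 2).

(* The complementary arc; both arcs are closed and share their endpoints. *)
Definition arcAc (R : realType) (theta : R) : set (circle_borel R) :=
  circle_arc (theta / 2) (2 * pi - theta / 2).

(* log (1 / |z - w|), written as - log |z - w| because [lne 0] is -oo, so that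
   the value at z = w is +oo. *)
Definition log_kernel (R : realType) (z w : circle_borel R) : \bar R :=
  (- lne (complex.Re `|set_val z - set_val w|)%:E)%E.

Definition log_energy (R : realType) (nu : circle_prob R) : \bar R :=
  (\int[nu]_w \int[nu]_z log_kernel z w)%E.

Definition constrained_minimizer (R : realType) (theta q : R)
    (nu : circle_prob R) : Prop :=
  nu (arcA theta) = q%:E /\
  log_energy nu =
    ereal_inf [set log_energy mu | mu in
                 [set mu : circle_prob R | mu (arcA theta) = q%:E]].

(* nu is carried by E and d nu(e^{i psi}) = f(psi) d psi for e^{i psi} in E. *)
Definition has_angular_density (R : realType) (nu : circle_prob R)
    (E : set (circle_borel R)) (f : R -> R) : Prop :=
  forall B : set (circle_borel R), measurable B ->
    nu B = (\int[lebesgue_measure]_(psi in `](- pi)%R, pi%R] `&`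
              (@expi R @^-1` (B `&` E))) (f psi)%:E)%E.

Definition density (R : realType) (theta alpha psi : R) : R :=
  Num.sqrt `|cos psi - alpha| /
  (2 * pi * Num.sqrt `|cos psi - cos (theta / 2)|).

Definition carrier_i (R : realType) (theta alpha : R) : set (circle_borel R) :=
  arcA theta `|` circle_arc (acos alpha) (2 * pi - acos alpha).

Definition carrier_ii (R : realType) (theta alpha : R) : set (circle_borel R) :=
  arcAc theta `|` circle_arc (- acos alpha) (acos alpha).

Definition mass_integral (R : realType) (theta alpha b : R) : \bar R :=
  (\int[lebesgue_measure]_(x in `[(-1)%R, b])
     (Num.sqrt `|x - alpha| /
      (pi * Num.sqrt `|(x + 1) * (x - cos (theta / 2)) * (x - 1)|))%:E)%E.

Definition alpha_i (R : realType) (theta q alpha : R) : Prop :=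
  [/\ -1 <= alpha <= 1, alpha <= cos (theta / 2) &
      mass_integral theta alpha alpha = (1 - q)%:E].

Definition alpha_ii (R : realType) (theta q alpha : R) : Prop :=
  [/\ -1 <= alpha <= 1, cos (theta / 2) <= alpha &
      mass_integral theta alpha (cos (theta / 2)) = (1 - q)%:E].

(* Main.v *)
(* Put c = cos (theta/2).  The principal square root H of
   (1 - 2 al z + z^2) / (1 - 2 c z + z^2) is holomorphic in the unit disc, H 0 = 1,
   and its square is real on the circle.  The candidate nu has density Re H / (2 pi),
   and the mass of the far arc {Re z < c} increases continuously from 0 to 1 with al,
   which fixes al.  The mean value property of H(z) log (1 - z e^(-i phi)) rewrites the
   logarithmic potential of nu in terms of Im H; the derivative of the potential is
   proportional to Im H, which vanishes on the support and has a known sign on the gap.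
   So the potential is constant on the part of the support in each arc and not smaller
   elsewhere in that arc.  Finally, - log |z - w| is the increasing limit of kernels
   whose Taylor coefficients in Re (z conj w) are positive, so the energy of mu minus
   that of nu dominates a positive multiple of each squared difference of moments. *)

Require Import Defs.
From HB Require Import structures.
From mathcomp Require Import all_boot all_order all_algebra.
From mathcomp Require Import complex.
From mathcomp Require Import all_classical all_reals all_analysis.
From mathcomp Require Import measurable_realfun ring lra.

Set Implicit Arguments.
Unset Strict Implicit.
Unset Printing Implicit Defensive.

Import Order.TTheory GRing.Theory Num.Theory.
Import numFieldNormedType.Exports.

Local Open Scope classical_set_scope.
Local Open Scope ring_scope.

(** The obstacle is the singularity of order -1/2 of H at the two points with [cos psi = c].
    Boundary statements are derived from interior circles of radius [rad n] under one majorant,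
    [dom c], whose integrability is read off from the extreme candidates [al = 1] and [al = -1] by
    Fatou. Passing from the modulus of 1 - r e^(ix) to its argument matters because the argument
    stays bounded as r tends to 1; its limit is, up to sign, the sawtooth (pi - x) / 2. Two shifted
    sawtooths differ by a constant and a jump of pi, so differences of the potential are exact
    integrals of Im H, and no singular integral is differentiated. A competitor may have infinite
    energy, so it is compared through bounded kernels only, with constants uniform in n. The
    constraint enters through a lower bound of the potential that is constant on each arc: its
    integral depends on the prescribed mass alone. One family, al in [-1, 1], contains both cases;
    al = c gives the uniform measure and separates them. *)

Section circle.
Context {R : realType}.

(** * Coordinates, argument and Borel sets of the circle *)

Definition cre (z : circle_borel R) : R := complex.Re (set_val z).
Definition cim (z : circle_borel R) : R := complex.Im (set_val z).

Lemma cre_expi (psi : R) : cre (expi psi) = cos psi. Proof. by []. Qed.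
Lemma cim_expi (psi : R) : cim (expi psi) = sin psi. Proof. by []. Qed.

Lemma cre2Dcim2 (z : circle_borel R) : cre z ^+ 2 + cim z ^+ 2 = 1.
Proof.
rewrite /cre /cim; case: z => z zC /=.
have := set_mem zC; rewrite /unit_circle /=.
rewrite normc_def => /(congr1 (@complex.Re R)) /= h.
have := sqr_sqrtr (addr_ge0 (sqr_ge0 (complex.Re z)) (sqr_ge0 (complex.Im z))).
by rewrite h expr1n.
Qed.

Lemma circle_eq (z w : circle_borel R) : cre z = cre w -> cim z = cim w -> z = w.
Proof.
move=> h1 h2; apply: val_inj => /=.
move: h1 h2; rewrite /cre /cim.
by case: z w => [[a b] za] [[c d] zc] /= -> ->.
Qed.

Lemma cre_itv (z : circle_borel R) : -1 <= cre z <= 1.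
Proof. by have h := cre2Dcim2 z; apply/andP; split; nra. Qed.

Lemma cim_itv (z : circle_borel R) : -1 <= cim z <= 1.
Proof. by have h := cre2Dcim2 z; apply/andP; split; nra. Qed.

(** The branch with values in ]-pi, pi]: the point -1 has [cim] equal to 0, falls into the second
    case and gets pi. *)
Definition carg (z : circle_borel R) : R :=
  if cim z < 0 then - acos (cre z) else acos (cre z).

Lemma cargK (z : circle_borel R) : expi (carg z) = z.
Proof.
have h := cre2Dcim2 z; have i := cre_itv z.
have e : 1 - cre z ^+ 2 = cim z ^+ 2 by lra.
apply: circle_eq; rewrite ?cre_expi ?cim_expi /carg; case: ltP => s.
- by rewrite cosN acosK.
- by rewrite acosK.
- by rewrite sinN sin_acos// e sqrtr_sqr ltr0_norm// opprK.
- by rewrite sin_acos// e sqrtr_sqr ger0_norm.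
Qed.

Lemma carg_itv (z : circle_borel R) : - pi < carg z <= pi.
Proof.
have h := cre2Dcim2 z; have i := cre_itv z; have p := @pi_gt0 R.
have := acos_ge0 i; have := acos_lepi i.
rewrite /carg; case: (ltP (cim z) 0) => s a1 a2; last by apply/andP; split; lra.
have : acos (cre z) < pi.
  rewrite acos_ltpi//; apply/andP; split; last by case/andP: i.
  have s2 : 0 < cim z * cim z by rewrite nmulr_rgt0.
  by case/andP: i => i1 _; rewrite lt_neqAle i1 andbT; apply/eqP => e1; nra.
by move=> a3; apply/andP; split; lra.
Qed.

Lemma continuous_cre_val : continuous (@complex.Re R : R[i] -> R).
Proof.
move=> z A /nbhs_ballP[e /= e0 eA]; exists e%:C%C; first by rewrite /= ltcR.
move=> w /= zw; apply: eA; rewrite /ball /= -ltcR; apply: le_lt_trans zw.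
by rewrite -raddfB /=; exact: normc_ge_Re.
Qed.

Lemma continuous_cim_val : continuous (@complex.Im R : R[i] -> R).
Proof.
move=> z A /nbhs_ballP[e /= e0 eA]; exists e%:C%C; first by rewrite /= ltcR.
move=> w /= zw; apply: eA; rewrite /ball /= -ltcR; apply: le_lt_trans zw.
rewrite -raddfB /= normc_def lecR -sqrtr_sqr ler_sqrt ?addr_ge0 ?sqr_ge0//.
by rewrite lerDr sqr_ge0.
Qed.

Lemma measurable_fun_circle (f : R[i] -> R) : continuous f ->
  measurable_fun setT (f \o set_val : circle_borel R -> R).
Proof.
move=> cf; apply: (measurability _ (RGenOpens.measurableE R)) => // _ [_ [x [y ->] <-]].
rewrite setTI; apply: sub_sigma_algebra.
have : continuous (f \o set_val : circle R -> R).
  move=> z; apply: (@continuous_comp (circle R) R[i] R); last exact: cf.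
  exact: (@initial_continuous (circle R) R[i] set_val).
by move=> /continuousP; apply; exact: interval_open.
Qed.

Lemma measurable_cre : measurable_fun setT cre.
Proof. exact: measurable_fun_circle continuous_cre_val. Qed.

Lemma measurable_cim : measurable_fun setT cim.
Proof. exact: measurable_fun_circle continuous_cim_val. Qed.

Lemma continuous_expi : continuous (@expi R).
Proof.
apply/continuousP => _ [B oB <-].
rewrite (_ : _ @^-1` _ = (fun psi : R => (cos psi +i* sin psi)%C : R[i]) @^-1` B); last by [].
have : continuous (fun psi : R => (cos psi +i* sin psi)%C : R[i]).
  move=> x A [e /= e0 eA].
  (* The radius of a ball in [R[i]] is a complex number; being positive for the partial order, it is
     real. *)
  have eR : e = (complex.Re e)%:C%C by rewrite RRe_real// gtr0_real.
  have e0' : 0 < complex.Re e / 2 by rewrite divr_gt0// -ltcR -eR.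
  suff : \forall y \near x, A ((cos y +i* sin y)%C : R[i]) by [].
  have nr (r : R) : `|r%:C%C| = (`|r|)%:C%C :> R[i].
    by rewrite normc_def /= expr0n /= addr0 sqrtr_sqr.
  near=> y; apply: eA => /=; rewrite eR.
  have -> : (cos x +i* sin x)%C - (cos y +i* sin y)%C =
    (cos x - cos y)%:C%C + 'i%C * (sin x - sin y)%:C%C :> R[i] by simpc.
  rewrite (le_lt_trans (ler_normD _ _))// normrM !nr.
  have -> : `|'i%C| = 1 :> R[i] by rewrite normc_def /= expr0n expr1n add0r sqrtr1.
  rewrite mul1r -rmorphD ltcR (splitr (complex.Re e)) ltrD//.
    by near: y; apply: cvgr_dist_lt => //; exact: continuous_cos.
  by near: y; apply: cvgr_dist_lt => //; exact: continuous_sin.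
by move=> /continuousP; apply.
Unshelve. all: by end_near. Qed.

Lemma measurable_expi : measurable_fun setT (@expi R : R -> circle_borel R).
Proof.
apply: (@measurability _ _ R (circle_borel R) setT _ (@open (circle R)) erefl) => // _ [B oB <-].
rewrite setTI; apply: open_measurable.
by have /continuousP := continuous_expi; exact.
Qed.

Lemma acos_gtE (x t : R) : -1 <= x <= 1 -> 0 <= t <= pi -> (t < acos x) = (x < cos t).
Proof.
move=> hx ht; rewrite -[in RHS](acosK (_ : x \in `[-1, 1])) ?in_itv//.
by rewrite ltr_cos ?in_itv//= ?acos_ge0 ?acos_lepi.
Qed.

Lemma measurable_acos_cre : measurable_fun setT (acos \o cre).
Proof.
apply: (measurability _ (RGenOInfty.measurableE R)) => // _ [_ [t ->] <-].
rewrite setTI; have [t0|t0] := ltP t 0.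
  rewrite (_ : _ @^-1` _ = setT)//; apply/seteqP; split => // z _ /=.
  by rewrite in_itv /= andbT (lt_le_trans t0)// acos_ge0// cre_itv.
have [tpi|tpi] := leP t pi; last first.
  rewrite (_ : _ @^-1` _ = set0)//; apply/seteqP; split => // z /=.
  rewrite in_itv /= andbT => h; have := acos_lepi (cre_itv z).
  by rewrite leNgt (lt_trans tpi h).
rewrite (_ : _ @^-1` _ = cre @^-1` `]-oo, cos t[); last first.
  apply/seteqP; split => z /=; rewrite !in_itv /= andbT acos_gtE ?cre_itv//;
  by apply/andP.
by rewrite -[X in measurable X]setTI; apply: measurable_cre.
Qed.

Lemma measurable_carg : measurable_fun setT carg.
Proof.
apply: measurable_fun_if => //.
- exact: measurable_fun_ltr measurable_cim (measurable_cst _).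
- apply: measurable_funTS.
  by apply: measurable_funN; exact: measurable_acos_cre.
- by apply: measurable_funTS; exact: measurable_acos_cre.
Qed.

HB.instance Definition _ := isMeasurableFun.Build _ _ _ _ carg measurable_carg.

Lemma measurable_cre_lt (a : R) : measurable [set z | cre z < a].
Proof.
rewrite (_ : [set _ | _] = cre @^-1` `]-oo, a[).
  by rewrite -[X in measurable X]setTI; apply: measurable_cre.
by apply/seteqP; split => z; rewrite /= in_itv.
Qed.

Lemma measurable_cre_gt (a : R) : measurable [set z | a < cre z].
Proof.
rewrite (_ : [set _ | _] = cre @^-1` `]a, +oo[).
  by rewrite -[X in measurable X]setTI; apply: measurable_cre.
by apply/seteqP; split => z; rewrite /= in_itv /= andbT.
Qed.

Lemma measurable_cim_lt (a : R) : measurable [set z | cim z < a].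
Proof.
rewrite (_ : [set _ | _] = cim @^-1` `]-oo, a[).
  by rewrite -[X in measurable X]setTI; apply: measurable_cim.
by apply/seteqP; split => z; rewrite /= in_itv.
Qed.

(** The law of [carg] determines the measure, and each set of arguments above t is a Boolean
    combination of sets from the three families. These families are chosen because their indicators
    are limits of polynomials in the coordinates. *)
Lemma circle_prob_eq (mu nu : circle_prob R) :
  (forall a, mu [set z | cre z < a] = nu [set z | cre z < a]) ->
  (forall a, mu ([set z | cre z < a] `&` [set z | cim z < 0]) =
             nu ([set z | cre z < a] `&` [set z | cim z < 0])) ->
  (forall a, mu ([set z | a < cre z] `&` [set z | cim z < 0]) =
             nu ([set z | a < cre z] `&` [set z | cim z < 0])) ->
  forall B, measurable B -> mu B = nu B.
Proof.
move=> H1 H2 H3 B mB.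
have mD (X Y : set (circle_borel R)) : measurable X -> measurable Y ->
    mu X = nu X -> mu (X `&` Y) = nu (X `&` Y) -> mu (X `\` Y) = nu (X `\` Y).
  have fin (P : circle_prob R) : measurable X -> (P X < +oo)%E.
    by move=> mX; rewrite (le_lt_trans (probability_le1 P mX))// ltry.
  move=> mX mY e1 e2.
  rewrite (measureD mX mY (fin mu mX)) (measureD mX mY (fin nu mX)); congr (_ - _)%E; [exact: e1|exact: e2].
have mI := measurable_cim_lt 0.
(* The value 2 exceeds every [cre], so the second family contains the whole open lower half
   circle. *)
have H0 : mu [set z | cim z < 0] = nu [set z | cim z < 0].
  have := H2 2; rewrite (_ : [set z | cre z < 2] `&` _ = [set z | cim z < 0])//.
  apply/seteqP; split => z; first by case.
  by move=> /= h; split => //=; have := cre_itv z; lra.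
have key (t : R) : mu [set z | t < carg z] = nu [set z | t < carg z].
  have p := @pi_gt0 R.
  have [tpi|tpi] := leP pi t.
    rewrite (_ : [set _ | _] = set0) ?measure0//.
    by apply/seteqP; split => z //=; have := carg_itv z; lra.
  have [t0|t0] := leP 0 t.
    rewrite (_ : [set _ | _] = [set z | cre z < cos t] `\` [set z | cim z < 0]).
      by apply: (mD _ _) => //; exact: measurable_cre_lt.
    apply/seteqP; split => z; rewrite /= /carg -acos_gtE ?cre_itv ?t0 ?ltW//;
      case: (ltP (cim z) 0) => // hz.
    - by have := acos_ge0 (cre_itv z); lra.
    - by case.
    - by case.
  have [tpi'|tpi'] := leP t (-pi).
    have -> : [set z | t < carg z] = setT; last by rewrite !probability_setT.
    by apply/seteqP; split => z //=; have := carg_itv z; lra.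
  (* For negative t the complement is simpler: the arguments at most t belong to the points of the
     lower half with [cre] at most [cos t]. *)
  have -> : [set z | t < carg z] = setT `\` ([set z | cim z < 0] `\`
      ([set z | cos t < cre z] `&` [set z | cim z < 0])); last first.
    apply: (mD _ _) => //.
    - apply: measurableD => //; apply: measurableI => //; exact: measurable_cre_gt.
    - by rewrite !probability_setT.
    - rewrite setTI; apply: (mD _ _) => //.
        apply: measurableI => //; exact: measurable_cre_gt.
      by rewrite setIC -setIA setIid.
  have e z : (cos t < cre z) = (acos (cre z) < - t).
    rewrite -cosN -[X in _ < X](acosK (_ : cre z \in `[-1, 1])) ?in_itv /= ?cre_itv//.
    rewrite ltr_cos ?in_itv /= ?acos_ge0 ?acos_lepi ?cre_itv//.
    by apply/andP; split; lra.
  apply/seteqP; split => z /=; rewrite /carg e; case: (ltP (cim z) 0) => hz.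
  - by move=> h; split => // -[_]; apply; split=> //; lra.
  - by move=> h; split => // -[].
  - by move=> [_ h]; rewrite ltNge; apply/negP => h'; apply: h; split => // -[]; lra.
  - by move=> _; have := acos_ge0 (cre_itv z); lra.
have e1 : forall A, measurable A -> distribution mu carg A = distribution nu carg A.
  apply: (@measure_unique _ R R (@RGenOInfty.G R) (fun k => `](- k%:R), +oo[%classic)).
  - exact: RGenOInfty.measurableE.
  - move=> _ _ [x ->] [y ->]; exists (Num.max x y).
    by apply/seteqP; split => z /=; rewrite !in_itv /= !andbT gt_max; move=> /andP.
  - by move=> k; exists (- k%:R).
  - apply/seteqP; split => // x _; exists (Num.truncn `|x|).+1 => //=.
    by rewrite in_itv /= andbT ltrNl (le_lt_trans (ler_norm _))// normrN truncnS_gt.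
  - move=> _ [t ->]; rewrite /distribution /pushforward.
    have -> : `]t, +oo[%classic = [set x | t < x] by apply/seteqP; split => z; rewrite /= in_itv /= andbT.
    exact: key.
  - by move=> k; rewrite (le_lt_trans (probability_le1 _ _)) ?ltry.
have := e1 _ (_ : measurable (@expi R @^-1` B)).
rewrite /distribution /pushforward /=.
(* By [cargK] every Borel set is a preimage under [carg], so equality of the laws on the line is
   enough. *)
have -> : carg @^-1` (@expi R @^-1` B) = B.
  by apply/seteqP; split => z /=; rewrite cargK.
by apply; rewrite -[X in measurable X]setTI; apply: measurable_expi.
Qed.
Lemma ler_cos : {in `[0, pi] &, {mono (@cos R) : x y /~ y <= x}}.
Proof. by move=> x y hx hy; rewrite !leNgt ltr_cos. Qed.

Lemma cos_carg (z : circle_borel R) : cos (carg z) = cre z.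
Proof. by rewrite -{2}(cargK z) cre_expi. Qed.

Lemma circle_arcE (g : R) : 0 <= g <= pi ->
  circle_arc (- g) g = [set z | cos g <= cre z].
Proof.
move=> hg; apply/seteqP; split => [_ [t /= ht <-]|z /= hz].
  move: ht; rewrite /= in_itv /= -ler_norml cre_expi -(cos_norm t) => ht.
  rewrite ler_cos ?in_itv//=; case/andP: hg => g0 gp.
  by rewrite normr_ge0 (le_trans ht).
exists (carg z); last exact: cargK.
have h := carg_itv z.
rewrite /= in_itv /= -ler_norml -ler_cos ?in_itv //= ?cos_norm ?cos_carg//.
by rewrite normr_ge0 ler_norml; lra.
Qed.

Lemma circle_arcCE (g : R) : 0 <= g <= pi ->
  circle_arc g (2 * pi - g) = [set z | cre z <= cos g].
Proof.
move=> hg; apply/seteqP; split => [_ [t /= ht <-]|z /= hz].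
  move: ht; rewrite /= in_itv /= cre_expi => ht.
  have [tpi|tpi] := leP t pi; first by rewrite ler_cos ?in_itv//=; lra.
  (* Beyond pi the angle t is replaced by 2 pi - t, which lies in [0, pi] and has the same
     cosine. *)
  rewrite -(cosN t) -[cos (- t)]cosD2pi ler_cos ?in_itv //= mulr2n; lra.
have h := carg_itv z.
have g1 : g <= `|carg z|.
  rewrite -ler_cos ?in_itv //= ?cos_norm ?cos_carg//.
  by rewrite normr_ge0 ler_norml; lra.
have [s|s] := leP 0 (carg z).
  exists (carg z); last exact: cargK.
  by move: g1; rewrite ger0_norm//= in_itv /=; lra.
exists (carg z + 2 * pi).
  by move: g1; rewrite ltr0_norm//= in_itv /=; lra.
rewrite -[RHS]cargK; apply: circle_eq.
  by rewrite !cre_expi mulr_natl cosD2pi.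
by rewrite !cim_expi mulr_natl sinD2pi.
Qed.

End circle.

(** * Derivative rules for real functions *)

Section real_derivatives.
Context {R : realType}.
Implicit Types a b : R -> R.

Lemma derD a b (t da db : R) : is_derive t 1 a da -> is_derive t 1 b db ->
  is_derive t 1 (fun x => a x + b x) (da + db).
Proof. by move=> ha hb; exact: (is_deriveD ha hb). Qed.

Lemma derN a (t da : R) : is_derive t 1 a da ->
  is_derive t 1 (fun x => - a x) (- da).
Proof. by move=> ha; exact: (is_deriveN ha). Qed.

Lemma derM a b (t da db : R) : is_derive t 1 a da -> is_derive t 1 b db ->
  is_derive t 1 (fun x => a x * b x) (a t * db + da * b t).
Proof.
move=> ha hb; apply: is_derive_eq (is_deriveM ha hb) _.
by rewrite /GRing.scale /= [b t * _]mulrC.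
Qed.

Lemma derV a (t da : R) : is_derive t 1 a da -> a t != 0 ->
  is_derive t 1 (fun x => (a x)^-1) (- da / a t ^+ 2).
Proof.
move=> ha a0; apply: is_derive_eq (is_deriveV a0 ha) _.
by rewrite /GRing.scale /= mulNr mulrC mulNr.
Qed.

Lemma der_comp (f : R -> R) a (t da df : R) : is_derive t 1 a da ->
  is_derive (a t) 1 f df -> is_derive t 1 (fun x => f (a x)) (df * da).
Proof. by move=> ha hf; exact: (is_derive1_comp hf ha). Qed.

Lemma der_cont a (t da : R) : is_derive t 1 a da -> {for t, continuous a}.
Proof. by move=> [ha _]; exact/differentiable_continuous/derivable1_diffP. Qed.

End real_derivatives.

(** * Complex calculus in the unit disc *)

Section complex_calculus.
Context {R : realType}.
Local Notation C := R[i].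
Local Notation re := (@complex.Re R).
Local Notation im := (@complex.Im R).
Implicit Types (z w : C) (F G : R -> C) (Phi Psi : C -> C).

(** The norm of [R[i]] takes its values in [R[i]]; this is the same modulus as a real number. *)
Definition cn z : R := Num.sqrt (re z ^+ 2 + im z ^+ 2).

Lemma normcE z : `|z| = (cn z)%:C%C.
Proof. by case: z => a b; rewrite normc_def. Qed.

Lemma cnM z w : cn (z * w) = cn z * cn w.
Proof. by apply: (@complexI R); rewrite -normcE normrM !normcE rmorphM. Qed.

Lemma cnD z w : cn (z + w) <= cn z + cn w.
Proof. by rewrite -lecR (_ : (_ + _)%:C%C = `|z| + `|w|) -?normcE ?ler_normD// rmorphD /= !normcE. Qed.

Lemma cnN z : cn (- z) = cn z.
Proof. by apply: (@complexI R); rewrite -!normcE normrN. Qed.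

Lemma cnB z w : cn (z - w) <= cn z + cn w.
Proof. by rewrite -(cnN w) cnD. Qed.

Lemma cn_ge0 z : 0 <= cn z. Proof. exact: sqrtr_ge0. Qed.

Lemma cnV z : cn z^-1 = (cn z)^-1.
Proof.
have cn1 : cn 1 = 1 by rewrite /cn /= expr0n expr1n addr0 sqrtr1.
have [->|z0] := eqVneq z 0; first by rewrite invr0 /cn /= !expr0n addr0 sqrtr0 invr0.
have e : cn z * cn z^-1 = 1 by rewrite -cnM divff.
have cz : cn z != 0 by apply: contra_eq_neq e => ->; rewrite mul0r eq_sym oner_neq0.
by apply: (mulfI cz); rewrite e divff.
Qed.

Lemma reM z w : re (z * w) = re z * re w - im z * im w.
Proof. by case: z w => a b [c d]. Qed.

Lemma imM z w : im (z * w) = re z * im w + im z * re w.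
Proof. by case: z w => a b [c d]. Qed.

Lemma reD z w : re (z + w) = re z + re w.
Proof. by case: z w => a b [c d]. Qed.

Lemma imD z w : im (z + w) = im z + im w.
Proof. by case: z w => a b [c d]. Qed.

Lemma reN z : re (- z) = - re z. Proof. by case: z. Qed.

Lemma imN z : im (- z) = - im z. Proof. by case: z. Qed.

Lemma reV z : re z^-1 = re z / (re z ^+ 2 + im z ^+ 2).
Proof. by case: z. Qed.

Lemma imV z : im z^-1 = - im z / (re z ^+ 2 + im z ^+ 2).
Proof. by case: z => a b /=; rewrite mulNr. Qed.

Lemma complex_neq0 z : (z != 0) = (re z ^+ 2 + im z ^+ 2 != 0).
Proof.
case: z => a b /=; rewrite paddr_eq0 ?sqr_ge0// !sqrf_eq0 eq_complex /=.
by [].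
Qed.

Definition der F (t : R) (D : C) : Prop :=
  is_derive t 1 (fun x => re (F x)) (re D) /\
  is_derive t 1 (fun x => im (F x)) (im D).

Lemma cderM F G (t : R) D E : der F t D -> der G t E ->
  der (fun x => F x * G x) t (D * G t + F t * E).
Proof.
move=> [f1 f2] [g1 g2]; split.
- under eq_fun do rewrite reM.
  apply: is_derive_eq (derD (derM f1 g1) (derN (derM f2 g2))) _.
  by rewrite reD !reM; ring.
- under eq_fun do rewrite imM.
  apply: is_derive_eq (derD (derM f1 g2) (derM f2 g1)) _.
  by rewrite imD !imM; ring.
Qed.

Lemma cderD F G (t : R) D E : der F t D -> der G t E ->
  der (fun x => F x + G x) t (D + E).
Proof.
move=> [f1 f2] [g1 g2]; split.
- by under eq_fun do rewrite reD; rewrite reD; exact: derD.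
- by under eq_fun do rewrite imD; rewrite imD; exact: derD.
Qed.

Lemma cder_cst (c : C) (t : R) : der (fun=> c) t 0.
Proof. by split; exact: is_derive_cst. Qed.

Lemma cderV F (t : R) D : F t != 0 -> der F t D ->
  der (fun x => (F x)^-1) t (- D / F t ^+ 2).
Proof.
move=> F0 [f1 f2].
have n0 : re (F t) ^+ 2 + im (F t) ^+ 2 != 0 by rewrite -complex_neq0.
have n1 := derD (derM f1 f1) (derM f2 f2).
have n0' : re (F t) * re (F t) + im (F t) * im (F t) != 0 by rewrite -!expr2.
have n2 := derV n1 n0'.
have n3 : (re (F t) * re (F t) - im (F t) * im (F t)) ^+ 2 +
    (re (F t) * im (F t) + im (F t) * re (F t)) ^+ 2 != 0.
  rewrite (_ : _ + _ = (re (F t) * re (F t) + im (F t) * im (F t)) ^+ 2); last by ring.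
  by rewrite expf_neq0.
split.
- under eq_fun do rewrite reV !expr2.
  apply: is_derive_eq (derM f1 n2) _.
  by rewrite (expr2 (F t)) reM reN imN reV imV !reM !imM; field; rewrite n0' n3.
- under eq_fun do rewrite imV !expr2.
  apply: is_derive_eq (derM (derN f2) n2) _.
  by rewrite (expr2 (F t)) imM reN imN reV imV !reM !imM; field; rewrite n0' n3.
Qed.

(* [hder Phi z d]: [Phi] has complex derivative [d] at [z], tested along curves. *)
Definition hder Phi z (d : C) : Prop :=
  forall F t D, F t = z -> der F t D -> der (fun x => Phi (F x)) t (d * D).

Lemma hder_id z : hder id z 1.
Proof. by move=> F t D _; rewrite mul1r. Qed.

Lemma hder_cst (c z : C) : hder (fun=> c) z 0.
Proof. by move=> F t D _ _; rewrite mul0r; exact: cder_cst. Qed.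

Lemma hderD Phi Psi z d e : hder Phi z d -> hder Psi z e ->
  hder (fun w => Phi w + Psi w) z (d + e).
Proof.
move=> h k F t D Fz FD; rewrite mulrDl.
by apply: cderD; [exact: h|exact: k].
Qed.

Lemma hderM Phi Psi z d e : hder Phi z d -> hder Psi z e ->
  hder (fun w => Phi w * Psi w) z (d * Psi z + Phi z * e).
Proof.
move=> h k F t D Fz FD.
have := cderM (h _ _ _ Fz FD) (k _ _ _ Fz FD); rewrite Fz.
by congr der; ring.
Qed.

Lemma hderV Phi z d : Phi z != 0 -> hder Phi z d ->
  hder (fun w => (Phi w)^-1) z (- d / Phi z ^+ 2).
Proof.
move=> n0 h F t D Fz FD.
have := cderV (_ : Phi (F t) != 0) (h _ _ _ Fz FD); rewrite Fz => /(_ n0).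
by congr der; rewrite !mulNr mulrAC.
Qed.

Lemma hder_comp Phi Psi z d e : hder Psi (Phi z) e -> hder Phi z d ->
  hder (fun w => Psi (Phi w)) z (e * d).
Proof.
move=> h k F t D Fz FD; rewrite -mulrA.
by apply: (h (fun x => Phi (F x))); rewrite ?Fz//; exact: k.
Qed.

(** The principal square root in Cartesian form, from the half-angle formula. On the slit plane u is
    positive and the imaginary part has the sign of [im z]. *)
Definition csq z : C :=
  let u := Num.sqrt ((cn z + re z) / 2) in (u +i* (im z / (2 * u)))%C.

Definition slit z := (im z != 0) || (0 < re z).

Lemma slit_gt0 z : slit z -> 0 < cn z + re z.
Proof.
move=> /orP h; have hs : cn z ^+ 2 = re z ^+ 2 + im z ^+ 2.
  by rewrite sqr_sqrtr// addr_ge0 ?sqr_ge0.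
have c0 := cn_ge0 z.
case: h => h; last by rewrite ltr_wpDl.
have i0 : 0 < im z ^+ 2 by rewrite exprn_even_gt0.
by rewrite ltNge; apply/negP => h'; nra.
Qed.

Lemma cn_sq z : cn z ^+ 2 = re z ^+ 2 + im z ^+ 2.
Proof. by rewrite sqr_sqrtr// addr_ge0 ?sqr_ge0. Qed.

Lemma csq_sq z : slit z -> csq z ^+ 2 = z.
Proof.
move=> sz; have h := slit_gt0 sz.
have u0 : 0 < Num.sqrt ((cn z + re z) / 2) by rewrite sqrtr_gt0 divr_gt0.
have u2 : Num.sqrt ((cn z + re z) / 2) ^+ 2 = (cn z + re z) / 2.
  by rewrite sqr_sqrtr// ltW// divr_gt0.
have hs := cn_sq z.
rewrite /csq; set u := Num.sqrt _ in u0 u2 *.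
have un : u != 0 by rewrite gt_eqF.
rewrite expr2; apply/eqP; rewrite eq_complex /=; apply/andP; split; apply/eqP.
  apply: (mulIf (_ : 4 * u ^+ 2 != 0)); first by rewrite mulf_neq0 ?expf_neq0// pnatr_eq0.
  have -> : (u * u - im z / (2 * u) * (im z / (2 * u))) * (4 * u ^+ 2) =
    4 * (u ^+ 2) ^+ 2 - im z ^+ 2 by field.
  rewrite u2; nra.
by field.
Qed.

Lemma csq_re_gt0 z : slit z -> 0 < re (csq z).
Proof. by move=> /slit_gt0 h; rewrite /= sqrtr_gt0 divr_gt0. Qed.

Lemma csq_neq0 z : slit z -> csq z != 0.
Proof.
by move=> sz; apply: contraTneq (csq_re_gt0 sz) => ->; rewrite ltxx.
Qed.

Lemma cn_gt0 z : z != 0 -> 0 < cn z.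
Proof.
rewrite complex_neq0 => h; rewrite sqrtr_gt0 lt_neqAle eq_sym h /=.
by rewrite addr_ge0 ?sqr_ge0.
Qed.

Lemma slit_neq0 z : slit z -> z != 0.
Proof.
by apply: contraTneq => ->; rewrite /slit /= eqxx ltxx.
Qed.

Lemma cder_cn F (t : R) D : F t != 0 -> der F t D ->
  is_derive t 1 (fun x => cn (F x))
    ((re (F t) * re D + im (F t) * im D) / cn (F t)).
Proof.
move=> F0 [f1 f2]; have c0 := cn_gt0 F0.
rewrite /cn; under eq_fun do rewrite !expr2.
have := derD (derM f1 f1) (derM f2 f2).
have p0 : 0 < re (F t) * re (F t) + im (F t) * im (F t).
  by rewrite -!expr2 -sqrtr_gt0.
move=> /der_comp /(_ (is_derive1_sqrt p0)) h; apply: is_derive_eq h _.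
rewrite -!expr2 -/(cn (F t)); field; by rewrite gt_eqF.
Qed.

Lemma inv2E z : z != 0 ->
  re (2 * z)^-1 = re z / (2 * (re z ^+ 2 + im z ^+ 2)) /\
  im (2 * z)^-1 = - im z / (2 * (re z ^+ 2 + im z ^+ 2)).
Proof.
rewrite complex_neq0 reV imV reM imM => n1.
have [-> ->] : re (2 : C) = 2 /\ im (2 : C) = 0.
  by rewrite (_ : (2 : C) = (2 : R)%:C%C) // rmorph_nat.
rewrite !mul0r subr0 addr0 !exprMn -mulrDr.
by split; field; rewrite n1.
Qed.

Lemma hder_csq z : slit z -> hder csq z (2 * csq z)^-1.
Proof.
move=> sz F t D Fz FD.
have h := slit_gt0 sz; have z0 := slit_neq0 sz; have c0 := cn_gt0 z0.
have hs := cn_sq z.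
have u0 : 0 < Num.sqrt ((cn z + re z) / 2) by rewrite sqrtr_gt0 divr_gt0.
have u2 : Num.sqrt ((cn z + re z) / 2) ^+ 2 = (cn z + re z) / 2.
  by rewrite sqr_sqrtr// ltW// divr_gt0.
have [f1 f2] := FD; have F0 : F t != 0 by rewrite Fz.
have d1 := derM (derD (cder_cn F0 FD) f1) (is_derive_cst (2^-1 : R) t 1).
have p0 : 0 < (cn (F t) + re (F t)) * 2^-1 by rewrite Fz divr_gt0.
have d2 := der_comp d1 (is_derive1_sqrt p0).
have un : Num.sqrt ((cn (F t) + re (F t)) * 2^-1) != 0 by rewrite Fz gt_eqF.
have n2 : 2 != 0 :> R by rewrite pnatr_eq0.
have d3 := derV (derM (is_derive_cst (2 : R) t 1) d2) (mulf_neq0 n2 un).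
have d4 := derM f2 d3.
have cn0 : cn z != 0 by rewrite gt_eqF.
rewrite Fz in d2 d4 un.
have rv := inv2E (csq_neq0 sz).
case: rv; rewrite [re (csq z)]/= [im (csq z)]/=.
(* With u + iv the root, z has parts u^2 - v^2 and 2uv and modulus u^2 + v^2; everything becomes
   rational in u and v, and the two derivatives can be compared by [field]. *)
set u := Num.sqrt _ in u0 u2 d2 d4 un *; set v := im z / _ => r1 r2.
have eb : im z = 2 * u * v by rewrite /v; field.
have em : cn z = u ^+ 2 + v ^+ 2.
  apply: (mulfI (_ : 4 * u ^+ 2 != 0)); first by rewrite mulf_neq0 ?expf_neq0// pnatr_eq0.
  have -> : 4 * u ^+ 2 * (u ^+ 2 + v ^+ 2) = 4 * (u ^+ 2) ^+ 2 + (2 * u * v) ^+ 2 by ring.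
  by rewrite -eb u2; nra.
have ea : re z = u ^+ 2 - v ^+ 2.
  have : re z = 2 * u ^+ 2 - cn z by rewrite u2; field.
  by rewrite em => ->; ring.
have un' : u != 0 by [].
have n4 : u ^+ 2 + v ^+ 2 != 0 by rewrite -em.
rewrite /csq; split => /=.
  apply: is_derive_eq d2 _.
  rewrite reM r1 r2 em ea eb /cst /=; field.
  by rewrite n4 un'.
apply: is_derive_eq d4 _.
rewrite imM r1 r2 em ea eb /cst /=; field.
by rewrite n4 un'.
Qed.

(** The principal logarithm on the right half-plane, the domain on which the argument is
    [atan (im z / re z)]. *)
Definition clog z : C :=
  (ln (re z ^+ 2 + im z ^+ 2) / 2 +i* atan (im z / re z))%C.

Lemma hder_clog z : 0 < re z -> hder clog z z^-1.
Proof.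
move=> z0 F t D Fz [f1 f2].
have p0 : 0 < re (F t) * re (F t) + im (F t) * im (F t).
  by rewrite Fz ltr_pwDl// ?mulr_gt0// -expr2 sqr_ge0.
have r0 : re (F t) != 0 by rewrite Fz gt_eqF.
have d1 := derM (der_comp (derD (derM f1 f1) (derM f2 f2)) (is_derive1_ln p0))
  (is_derive_cst (2^-1 : R) t 1).
have d2 := der_comp (derM f2 (derV f1 r0)) (is_derive1_atan _).
have p1 : re z * re z + im z * im z != 0 by rewrite -Fz gt_eqF.
rewrite Fz in d1 d2 r0 p0.
split.
- rewrite /clog /=; under eq_fun do rewrite !expr2.
  apply: is_derive_eq d1 _.
  by rewrite reM reV imV /cst /=; field; rewrite p1.
- rewrite /clog /=.
  apply: is_derive_eq d2 _.
  rewrite imM reV imV; field.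
  by apply/andP; split; [rewrite !expr2; exact: p1|exact: r0].
Qed.

Definition polar (r psi : R) : C := (r * cos psi +i* (r * sin psi))%C.

Lemma cn_polar (r psi : R) : cn (polar r psi) = `|r|.
Proof.
by rewrite /cn /= !exprMn -mulrDr cos2Dsin2 mulr1 sqrtr_sqr.
Qed.

Lemma der_polar_r (r psi : R) : der (polar ^~ psi) r (polar 1 psi).
Proof.
split => /=.
- apply: is_derive_eq (derM (is_derive_id r 1) (is_derive_cst (cos psi) r 1)) _.
  by rewrite /cst /= mulr0 add0r.
- apply: is_derive_eq (derM (is_derive_id r 1) (is_derive_cst (sin psi) r 1)) _.
  by rewrite /cst /= mulr0 add0r.
Qed.

Lemma der_polar_psi (r psi : R) : der (polar r) psi ('i%C * polar r psi).
Proof.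
split => /=.
- apply: is_derive_eq (derM (is_derive_cst r psi 1) (is_derive_cos psi)) _.
  by rewrite /cst /=; ring.
- apply: is_derive_eq (derM (is_derive_cst r psi 1) (is_derive_sin psi)) _.
  by rewrite /cst /=; ring.
Qed.

Lemma polarE (r psi : R) : polar r psi = r%:C%C * polar 1 psi.
Proof. by rewrite /polar; apply/eqP; rewrite eq_complex /=; apply/andP; split; apply/eqP; ring. Qed.

Lemma polar_pi (r : R) : polar r (- pi) = polar r pi.
Proof. by rewrite /polar cosN sinN sinpi oppr0. Qed.

Lemma le_re_cn z : `|re z| <= cn z.
Proof. by rewrite -sqrtr_sqr ler_sqrt ?addr_ge0 ?sqr_ge0// lerDl sqr_ge0. Qed.

Definition holo Phi Phi' := forall z, cn z < 1 -> hder Phi z (Phi' z).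

(** Boundedness on each smaller closed disc provides the constant majorant for differentiating
    circle means under the integral. *)
Definition locb Phi := forall r, r < 1 ->
  exists K, forall z, cn z <= r -> cn (Phi z) <= K.

Local Notation mu := (@lebesgue_measure R).

Lemma ftc_cst (f F : R -> R) : (forall x : R, is_derive x 1 F (f x)) ->
  continuous f -> F pi = F (- pi) -> \int[mu]_(x in `[(- pi)%R, pi%R]) f x = 0.
Proof.
move=> dF cf e; have p := @pi_gt0 R.
have cF : continuous F by move=> x; exact: der_cont (dF x).
rewrite /Rintegral (continuous_FTC2 (F := F)) ?e ?subee//.
- by rewrite gtrN.
- by apply: continuous_subspaceT.
- split; first by move=> x _; case: (dF x).
  + by apply: cvg_at_right_filter; exact: cF.
  + by apply: cvg_at_left_filter; exact: cF.
- by move=> x _; rewrite derive1E; case: (dF x).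
Qed.

Lemma integrable_cont (f : R -> R) (a b : R) : continuous f ->
  mu.-integrable `[a, b] (EFin \o f).
Proof.
move=> cf; apply: continuous_compact_integrable => //; first exact: segment_compact.
exact: continuous_subspaceT.
Qed.

(** The radial derivative of Phi at x e^(i psi) is 1/(ix) times its angular derivative, and the
    latter integrates to 0 by periodicity. Hence the circle mean has derivative 0 in the radius and
    keeps its value at radius 0. The second derivative [Phi2] makes the integrand continuous, as the
    fundamental theorem of calculus requires. *)
Lemma mean_value Phi Phi1 Phi2 (r : R) : holo Phi Phi1 -> holo Phi1 Phi2 ->
  locb Phi1 -> 0 <= r < 1 ->
  \int[mu]_(psi in `[(- pi)%R, pi%R]) re (Phi (polar r psi)) = 2 * pi * re (Phi 0).
Proof.
move=> h1 h2 hb r01; have p := @pi_gt0 R.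
pose f (x psi : R) := re (Phi (polar x psi)).
pose M x := \int[mu]_(psi in `[(- pi)%R, pi%R]) f x psi.
have d1 (x psi : R) : `|x| < 1 -> is_derive x 1 (f ^~ psi) (re (Phi1 (polar x psi) * polar 1 psi)).
  move=> x1; have hz : cn (polar x psi) < 1 by rewrite cn_polar.
  by have [] := h1 _ hz (polar ^~ psi) _ _ erefl (der_polar_r x psi).
have d2 (x psi : R) : `|x| < 1 -> der (fun t => Phi (polar x t)) psi
    (Phi1 (polar x psi) * ('i%C * polar x psi)).
  move=> x1; apply: (h1 _ _ (polar x)) => //; first by rewrite cn_polar.
  exact: der_polar_psi.
have d3 (x psi : R) : `|x| < 1 -> der (fun t => Phi1 (polar x t) * polar 1 t) psi
    (Phi2 (polar x psi) * ('i%C * polar x psi) * polar 1 psi +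
     Phi1 (polar x psi) * ('i%C * polar 1 psi)).
  move=> x1; apply: cderM; last exact: der_polar_psi.
  by apply: (h2 _ _ (polar x)) => //; rewrite ?cn_polar//; exact: der_polar_psi.
have c2 (x : R) : `|x| < 1 -> continuous (fun psi => re (Phi1 (polar x psi) * polar 1 psi)).
  by move=> x1 psi; have [h _] := d3 x psi x1; exact: der_cont h.
have cf (x : R) : `|x| < 1 -> continuous (f x).
  by move=> x1 psi; have [h _] := d2 x psi x1; exact: der_cont h.
have I0 (x : R) : `|x| < 1 ->
    \int[mu]_(psi in `[(- pi)%R, pi%R]) re (Phi1 (polar x psi) * polar 1 psi) = 0.
  (* At the centre the division by x is impossible; there the integrand is
     [re (Phi1 0 * e^(i psi))], which has an explicit periodic primitive. *)
  move=> x1; have [->|x0] := eqVneq x 0.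
    apply: (ftc_cst (F := fun psi => im (Phi1 0 * polar 1 psi))).
    - move=> psi.
      have [_ h] := cderM (cder_cst (Phi1 0) psi) (der_polar_psi 1 psi).
      apply: is_derive_eq h _.
      have -> : polar 0 psi = 0 by rewrite /polar !mul0r.
      rewrite mul0r add0r mulrCA !imM !reM /=; ring.
    - by apply: c2; rewrite normr0.
    - by rewrite polar_pi.
  apply: (ftc_cst (F := fun psi => im (Phi (polar x psi)) * x^-1)).
  - move=> psi; have [_ h] := d2 x psi x1.
    apply: is_derive_eq (derM h (is_derive_cst x^-1 psi 1)) _.
    rewrite mulr0 add0r /cst /= (polarE x) !imM !reM /=.
    by field.
  - exact: c2.
  - by rewrite polar_pi.
have dM (x : R) : `|x| < 1 -> is_derive x 1 M 0.
  (* Any s strictly between |x| and 1 works: [locb] then bounds [Phi1] for all radii in a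
     neighbourhood of x. *)
  move=> x1; pose s := (`|x| + 1) / 2.
  have s1 : s < 1 by rewrite /s; lra.
  have xs : x \in `]- s, s[ by rewrite in_itv /= -ltr_norml /s; lra.
  have [K hK] := hb _ s1.
  have Is y : y \in `]- s, s[ -> `|y| < s by rewrite in_itv /= -ltr_norml.
  have Ky y : y \in `]- s, s[ -> `|y| < 1 by move=> /Is; lra.
  have K0 : 0 <= K by rewrite (le_trans (cn_ge0 _) (hK 0 _))// /cn /= !expr0n addr0 sqrtr0 /s; have := normr_ge0 x; lra.
  have A1 : forall y, `]- s, s[%classic y -> mu.-integrable `[(- pi)%R, pi%R] (EFin \o f y).
    by move=> y /= /Ky y1; apply: integrable_cont; exact: cf.
  have A2 : forall y psi, `]- s, s[%classic y -> `[(- pi)%R, pi%R]%classic psi ->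
      derivable (f ^~ psi) y 1.
    by move=> y psi /= /Ky y1 _; case: (d1 y psi y1).
  have A3 : forall y psi, `]- s, s[%classic y -> `[(- pi)%R, pi%R]%classic psi ->
      `|partial1of2 f y psi| <= cst K psi.
    move=> y psi /= ys _; rewrite partial1of2E; have [_ ->] := d1 y psi (Ky _ ys).
    rewrite (le_trans (le_re_cn _))// cnM cn_polar normr1 mulr1 hK//.
    by rewrite cn_polar ltW// Is.
  have iK : mu.-integrable `[(- pi)%R, pi%R] (EFin \o cst K).
    by apply: integrable_cont; exact: cst_continuous.
  apply: DeriveDef.
    by apply: (@derivable_under_integral R _ _ mu f _ _ x _ _ xs A1 A2 (cst K) (fun=> K0) iK A3).
  rewrite -derive1E (@differentiation_under_integral R _ _ mu f _ _ x _ _ xs A1 A2 (cst K) (fun=> K0) iK A3)//.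
  rewrite -(I0 x x1); apply: eq_Rintegral => psi _.
  by rewrite partial1of2E; case: (d1 x psi x1).
have M0 : M 0 = 2 * pi * re (Phi 0).
  rewrite /M (_ : (fun _ => _) = cst (re (Phi 0))); last first.
    by apply/funext => psi; rewrite /f /polar !mul0r.
  rewrite Rintegral_cst//= lebesgue_measure_itv /= lte_fin gtrN//=.
  by rewrite opprK; ring.
rewrite -[LHS]/(M r) -M0.
have [->//|rn] := eqVneq r 0.
have r0 : 0 < r by rewrite lt_neqAle eq_sym rn; case/andP: r01.
have [||x _] := @MVT _ M (fun=> 0) 0 r r0.
- move=> x; rewrite in_itv /= => /andP[x0 xr]; apply: dM.
  by rewrite ger0_norm ?(ltW x0)// (lt_trans xr)//; case/andP: r01.
- apply: derivable_within_continuous => x; rewrite in_itv /= => /andP[x0 xr].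
  have [] := dM x => //.
  by rewrite ger0_norm// (le_lt_trans xr)//; case/andP: r01.
- by rewrite mul0r => /eqP; rewrite subr_eq0 => /eqP.
Qed.

End complex_calculus.

(** * A class of functions on the disc with the mean value property *)

Section good_functions.
Context {R : realType}.
Local Notation C := R[i].
Local Notation re := (@complex.Re R).
Local Notation im := (@complex.Im R).
Implicit Types (z w : C) (Phi Psi : C -> C).

Definition hol Phi := exists Phi1, holo Phi Phi1.

(** The hypotheses of [mean_value], together with a local bound on Phi itself, which makes the class
    stable under products: the derivative of a product involves the undifferentiated factors. *)
Definition good Phi := exists Phi1,
  [/\ holo Phi Phi1, hol Phi1, locb Phi & locb Phi1].

Lemma hol_cst (c : C) : hol (fun=> c).
Proof. by exists (fun=> 0) => z _; exact: hder_cst. Qed.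

Lemma holD Phi Psi : hol Phi -> hol Psi -> hol (fun z => Phi z + Psi z).
Proof.
by move=> [P1 h] [Q1 k]; eexists => z z1; apply: hderD; [exact: h|exact: k].
Qed.

Lemma holM Phi Psi : hol Phi -> hol Psi -> hol (fun z => Phi z * Psi z).
Proof.
by move=> [P1 h] [Q1 k]; eexists => z z1; apply: hderM; [exact: h|exact: k].
Qed.

Lemma holV Phi : (forall z, cn z < 1 -> Phi z != 0) -> hol Phi ->
  hol (fun z => (Phi z)^-1).
Proof.
by move=> n0 [P1 h]; eexists => z z1; apply: hderV; [exact: n0|exact: h].
Qed.

Lemma locb_cst (c : C) : locb (fun=> c).
Proof. by move=> r _; exists (cn c). Qed.

Lemma locb_id : locb (@id C).
Proof. by move=> r _; exists r. Qed.

Lemma locbD Phi Psi : locb Phi -> locb Psi -> locb (fun z => Phi z + Psi z).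
Proof.
move=> h k r r1; have [K hK] := h r r1; have [J hJ] := k r r1.
by exists (K + J) => z zr; rewrite (le_trans (cnD _ _))// lerD ?hK ?hJ.
Qed.

Lemma locbM Phi Psi : locb Phi -> locb Psi -> locb (fun z => Phi z * Psi z).
Proof.
move=> h k r r1; have [K hK] := h r r1; have [J hJ] := k r r1.
by exists (K * J) => z zr; rewrite cnM ler_pM ?cn_ge0 ?hK ?hJ.
Qed.

(** If t^2 <= K then t <= K + 1. It serves for [csq], whose square is the only explicit
    expression. *)
Lemma locb_sq Phi : locb (fun z => Phi z * Phi z) -> locb Phi.
Proof.
move=> h r r1; have [K hK] := h r r1; exists (K + 1) => z zr.
have := hK z zr; rewrite cnM; have := cn_ge0 (Phi z) => a b.
by rewrite leNgt; apply/negP => c; nra.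
Qed.

Lemma locb_eq Phi Psi : (forall z, cn z < 1 -> Phi z = Psi z) -> locb Phi -> locb Psi.
Proof.
move=> e h r r1; have [K hK] := h r r1; exists K => z zr.
by rewrite -e ?hK// (le_lt_trans zr).
Qed.

Lemma good_cst (c : C) : good (fun=> c).
Proof.
exists (fun=> 0); split; [|exact: hol_cst|exact: locb_cst|exact: locb_cst].
by move=> z _; exact: hder_cst.
Qed.

Lemma good_id : good id.
Proof.
exists (fun=> 1); split; [|exact: hol_cst|exact: locb_id|exact: locb_cst].
by move=> z _; exact: hder_id.
Qed.

Lemma good_hol Phi : good Phi -> hol Phi.
Proof. by move=> [P1 []]; exists P1. Qed.

Lemma goodD Phi Psi : good Phi -> good Psi -> good (fun z => Phi z + Psi z).
Proof.
move=> [P1 [h1 h2 h3 h4]] [Q1 [k1 k2 k3 k4]].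
exists (fun z => P1 z + Q1 z); split.
- by move=> z z1; apply: hderD; [exact: h1|exact: k1].
- exact: holD.
- exact: locbD.
- exact: locbD.
Qed.

Lemma goodM Phi Psi : good Phi -> good Psi -> good (fun z => Phi z * Psi z).
Proof.
move=> gP gQ; have := (good_hol gP, good_hol gQ).
case: gP gQ => [P1 [h1 h2 h3 h4]] [Q1 [k1 k2 k3 k4]] [hP hQ].
exists (fun z => P1 z * Psi z + Phi z * Q1 z); split.
- by move=> z z1; apply: hderM; [exact: h1|exact: k1].
- by apply: holD; apply: holM.
- exact: locbM.
- by apply: locbD; apply: locbM.
Qed.

Lemma goodV Phi : (forall z, cn z < 1 -> Phi z != 0) ->
  locb (fun z => (Phi z)^-1) -> good Phi -> good (fun z => (Phi z)^-1).
Proof.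
move=> n0 lV gP; have hP := good_hol gP; case: gP => [P1 [h1 h2 h3 h4]].
exists (fun z => -1 * P1 z * ((Phi z)^-1 * (Phi z)^-1)); split.
- move=> z z1; have := hderV (n0 _ z1) (h1 _ z1).
  by congr hder; rewrite mulN1r -invfM -expr2.
- apply: holM; first by apply: holM; [exact: hol_cst|].
  by apply: holM; exact: holV.
- exact: lV.
- apply: locbM; first by apply: locbM; [exact: locb_cst|].
  exact: locbM.
Qed.

Lemma good_csq Phi : (forall z, cn z < 1 -> slit (Phi z)) ->
  locb (fun z => (Phi z)^-1) -> good Phi -> good (fun z => csq (Phi z)).
Proof.
move=> sl lV gP; have hP := good_hol gP; case: gP => [P1 [h1 h2 h3 h4]].
have n0 z : cn z < 1 -> 2 * csq (Phi z) != 0.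
  by move=> z1; rewrite mulf_neq0 ?csq_neq0 ?pnatr_eq0//; exact: sl.
have h5 : holo (fun z => csq (Phi z)) (fun z => (2 * csq (Phi z))^-1 * P1 z).
  by move=> z z1; apply: hder_comp; [apply: hder_csq; exact: sl|exact: h1].
exists (fun z => (2 * csq (Phi z))^-1 * P1 z); split => //.
- apply: holM => //; apply: holV => //.
  by apply: holM; [exact: hol_cst|eexists; exact: h5].
- apply: locb_sq; apply: (locb_eq _ h3) => z z1.
  by rewrite -expr2 csq_sq//; exact: sl.
(* The square of [(2 * csq (Phi z))^-1] is [4^-1 * (Phi z)^-1], which [lV] controls. *)
- apply: locbM => //; apply: locb_sq.
  apply: (@locb_eq (fun z => 4^-1 * (Phi z)^-1)); last first.
    by apply: locbM => //; exact: locb_cst.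
  move=> z z1; rewrite -[LHS]invfM -[RHS]invfM; congr (_^-1).
  rewrite -{1}(csq_sq (sl _ z1)); ring.
Qed.

Lemma cn_le_sum z : cn z <= `|re z| + `|im z|.
Proof.
rewrite -(ger0_norm (addr_ge0 (normr_ge0 (re z)) (normr_ge0 (im z)))) -sqrtr_sqr.
rewrite ler_sqrt ?sqr_ge0// sqrrD !real_normK ?num_real//.
have := normr_ge0 (re z); have := normr_ge0 (im z); nra.
Qed.

Lemma le_ln_id (x : R) : 0 < x -> ln x <= x.
Proof. by move=> x0; have := ln_sublinear x0; exact: ltW. Qed.

(** The inequality ln x <= x, used at |z|^2 and at |z|^-2, bounds the real part from both sides; the
    argument contributes pi / 2. The bound is crude but only involves quantities already known to be
    locally bounded. *)
Lemma cn_clog z : 0 < re z -> cn (clog z) <= cn z ^+ 2 + cn z^-1 ^+ 2 + pi / 2.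
Proof.
move=> z0; have zn : z != 0 by apply: contraTneq z0 => ->; rewrite ltxx.
have c0 := cn_gt0 zn.
have e : re z ^+ 2 + im z ^+ 2 = cn z ^+ 2 by rewrite cn_sq.
rewrite (le_trans (cn_le_sum _))// lerD//=; last first.
  rewrite ler_norml; have := atan_gtNpi2 (im z / re z).
  have := atan_ltpi2 (im z / re z); lra.
rewrite e; have p0 : 0 < cn z ^+ 2 by rewrite exprn_gt0.
have := le_ln_id p0.
have p1 : 0 < cn z^-1 ^+ 2 by rewrite cnV exprVn invr_gt0.
have := le_ln_id p1; rewrite {1}cnV exprVn lnV ?posrE//.
by rewrite ler_norml; move=> a b; apply/andP; split; lra.
Qed.

Lemma good_clog Phi : (forall z, cn z < 1 -> 0 < re (Phi z)) ->
  locb (fun z => (Phi z)^-1) -> good Phi -> good (fun z => clog (Phi z)).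
Proof.
move=> sl lV gP; have hP := good_hol gP; case: gP => [P1 [h1 h2 h3 h4]].
have n0 z : cn z < 1 -> Phi z != 0.
  by move=> /sl z1; apply: contraTneq z1 => ->; rewrite ltxx.
exists (fun z => (Phi z)^-1 * P1 z); split => //.
- by move=> z z1; apply: hder_comp; [apply: hder_clog; exact: sl|exact: h1].
- by apply: holM => //; apply: holV.
- move=> r r1; have [K hK] := h3 r r1; have [J hJ] := lV r r1.
  exists (K ^+ 2 + J ^+ 2 + pi / 2) => z zr.
  rewrite (le_trans (cn_clog (sl _ (le_lt_trans zr r1))))// lerD2r lerD//.
    by have := hK z zr; have := cn_ge0 (Phi z); nra.
  by have := hJ z zr; have := cn_ge0 (Phi z)^-1; nra.
- exact: locbM.
Qed.

Lemma good_mean_value Phi (r : R) : good Phi -> 0 <= r < 1 ->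
  \int[lebesgue_measure]_(psi in `[(- pi)%R, pi%R]) re (Phi (polar r psi)) =
  2 * pi * re (Phi 0).
Proof.
by move=> [P1 [h1 [P2 h2] _ h4]] r01; exact: (mean_value h1 h2 h4).
Qed.

Lemma good_continuous Phi (r : R) : good Phi -> 0 <= r < 1 ->
  continuous (fun psi => re (Phi (polar r psi))).
Proof.
move=> [P1 [h1 _ _ _]] /andP[r0 r1] psi.
have c1 : cn (polar r psi) < 1 by rewrite cn_polar ger0_norm.
have [h _] := h1 _ c1 (polar r) _ _ erefl (der_polar_psi r psi).
exact: der_cont h.
Qed.

End good_functions.

(** * The function H and the logarithm of 1 - wz in the disc *)

Section herglotz.
Context {R : realType}.
Local Notation C := R[i].
Local Notation re := (@complex.Re R).
Local Notation im := (@complex.Im R).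
Implicit Types (z w : C) (a al c : R).

(** For a = cos t this is (z - e^(it)) (z - e^(-it)), so both zeros lie on the unit circle. *)
Definition quad a z : C := z * z + (- (2 * a))%:C%C * z + 1.

Definition herglotz al c z : C := csq (quad al z / quad c z).

Lemma polar1D (r psi : R) : polar r psi = r%:C%C * polar 1 psi.
Proof. exact: polarE. Qed.

Lemma quad_fact a z (s : R) : a ^+ 2 + s ^+ 2 = 1 ->
  quad a z = (z - (a +i* s)%C) * (z - (a +i* (- s))%C).
Proof.
move=> h; case: z => x y; apply/eqP; rewrite eq_complex /=.
by apply/andP; split; apply/eqP; nra.
Qed.

Lemma cnB_ge z w : cn w - cn z <= cn (z - w).
Proof.
have := cnD (z - w) (- z); rewrite cnN addrAC subrr sub0r cnN; lra.
Qed.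

Lemma cn_unit a (s : R) : a ^+ 2 + s ^+ 2 = 1 -> cn (a +i* s)%C = 1.
Proof. by rewrite /cn /= => ->; rewrite sqrtr1. Qed.

Lemma unit_pair a : -1 <= a <= 1 -> exists s : R, a ^+ 2 + s ^+ 2 = 1.
Proof.
move=> h; exists (Num.sqrt (1 - a ^+ 2)).
by rewrite sqr_sqrtr; [ring|nra].
Qed.

Lemma cn_quad_ge a z : -1 <= a <= 1 -> cn z <= 1 -> (1 - cn z) ^+ 2 <= cn (quad a z).
Proof.
move=> /unit_pair[s h] z1; rewrite (quad_fact _ h) cnM.
have h' : a ^+ 2 + (- s) ^+ 2 = 1 by rewrite sqrrN.
have := cnB_ge z (a +i* s)%C; have := cnB_ge z (a +i* (- s))%C.
rewrite !cn_unit// => k1 k2.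
by rewrite expr2 ler_pM// subr_ge0.
Qed.

Lemma quad_neq0 a z : -1 <= a <= 1 -> cn z < 1 -> quad a z != 0.
Proof.
move=> ha z1; have := cn_quad_ge ha (ltW z1).
apply: contraTneq => ->; rewrite -ltNge {1}/cn /= !expr0n addr0 sqrtr0.
by rewrite exprn_gt0// subr_gt0.
Qed.

Lemma cn_quad_le a z : -1 <= a <= 1 -> cn z <= 1 -> cn (quad a z) <= 4.
Proof.
move=> /unit_pair[s h] z1; rewrite (quad_fact _ h) cnM.
have h' : a ^+ 2 + (- s) ^+ 2 = 1 by rewrite sqrrN.
have := cnB z (a +i* s)%C; have := cnB z (a +i* (- s))%C.
rewrite !cn_unit// => k1 k2.
rewrite (_ : 4 = 2 * 2); last by rewrite -natrM.
by rewrite ler_pM ?cn_ge0//; lra.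
Qed.

(** The factor e^(i psi) does not depend on a. It cancels in a quotient of two such quadratics,
    which is therefore real on the circle; so H has real or purely imaginary boundary values. *)
Lemma quad_circle a (psi : R) :
  quad a (polar 1 psi) = (2 * (cos psi - a))%:C%C * polar 1 psi.
Proof.
have h := cos2Dsin2 psi.
apply/eqP; rewrite eq_complex /=; apply/andP; split; apply/eqP; nra.
Qed.

Lemma cn_real (x : R) : cn x%:C%C = `|x|.
Proof. by rewrite /cn /= expr0n addr0 sqrtr_sqr. Qed.

Lemma cn_quad_circle a (psi : R) : cn (quad a (polar 1 psi)) = 2 * `|cos psi - a|.
Proof.
by rewrite quad_circle cnM cn_polar normr1 mulr1 cn_real normrM ger0_norm.
Qed.

(* [|e - w| <= 2 |r e - w|] for unit [e], [w] and [0 <= r <= 1]. *)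
Lemma cn_quad_radial a (r psi : R) : -1 <= a <= 1 -> 0 <= r <= 1 ->
  `|cos psi - a| <= 2 * cn (quad a (polar r psi)).
Proof.
move=> /unit_pair[s h] r01.
have key (s' : R) : a ^+ 2 + s' ^+ 2 = 1 ->
    cn (polar 1 psi - (a +i* s')%C) <= 2 * cn (polar r psi - (a +i* s')%C).
  move=> h'; have k1 := cnB_ge (polar r psi) (a +i* s')%C.
  have := cnD (polar 1 psi - polar r psi) (polar r psi - (a +i* s')%C).
  rewrite addrA subrK (_ : cn (polar 1 psi - polar r psi) = 1 - r).
    by move: k1; rewrite cn_unit// cn_polar ger0_norm; lra.
  rewrite (polar1D r) -{1}(mul1r (polar 1 psi)) -mulrBl cnM cn_polar normr1 mulr1.
  rewrite (_ : 1 - r%:C%C = (1 - r)%:C%C); last by rewrite rmorphB.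
  by rewrite cn_real ger0_norm// subr_ge0; lra.
have h' : a ^+ 2 + (- s) ^+ 2 = 1 by rewrite sqrrN.
have k1 := key _ h; have k2 := key _ h'.
have : cn (quad a (polar 1 psi)) <= 4 * cn (quad a (polar r psi)).
  rewrite !(quad_fact _ h) !cnM (_ : 4 = 2 * 2); last by rewrite -natrM.
  by rewrite mulrACA ler_pM ?cn_ge0.
by rewrite cn_quad_circle; lra.
Qed.

(** If the quotient were -t with t >= 0, then [quad al z + t * quad c z] would vanish. This sum is 1
    + t times [quad b z], with b the convex combination (al + t c) / (1 + t) in [-1, 1], and such a
    quadratic has no zero in the open disc. *)
Lemma herglotz_slit al c z : -1 <= al <= 1 -> -1 <= c <= 1 -> cn z < 1 ->
  slit (quad al z / quad c z).
Proof.
move=> hal hc z1; apply/negPn/negP; rewrite /slit negb_or negbK -leNgt => /andP[/eqP i0 r0].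
have c0 := quad_neq0 hc z1.
set S := _ / _ in i0 r0.
have SE : S = (re S)%:C%C by move: i0; case: (S) => x y /= ->.
have e : quad al z = S * quad c z by rewrite /S divfK.
pose t := - re S; have t0 : 0 <= t by rewrite oppr_ge0.
have t1 : 1 + t != 0 by lra.
pose b := (al + t * c) / (1 + t).
have hb : -1 <= b <= 1.
  by rewrite /b ler_pdivrMr ?ler_pdivlMr; nra.
have /eqP := quad_neq0 hb z1; apply.
apply: (mulfI (_ : (1 + t)%:C%C != 0 :> C)).
  by apply: contra_neq t1; move/(congr1 re).
rewrite mulr0.
have eb : (1 + t) * b = al + t * c by rewrite /b; field.
have : quad al z + t%:C%C * quad c z = 0 by rewrite e SE /t rmorphN; ring.
move=> <-; have -> : al = (1 + t) * b - t * c by rewrite eb; ring.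
clearbody b t; clear; case: z => x y.
by apply/eqP; rewrite eq_complex /=; apply/andP; split; apply/eqP; ring.
Qed.

Lemma good_quad a : good (quad a).
Proof.
apply: goodD; last exact: good_cst.
apply: goodD; first by apply: goodM; exact: good_id.
by apply: goodM; [exact: good_cst|exact: good_id].
Qed.

Lemma locb_quadV a : -1 <= a <= 1 -> locb (fun z => (quad a z)^-1).
Proof.
move=> ha r r1; exists (((1 - r) ^+ 2)^-1) => z zr.
have p : 0 < (1 - r) ^+ 2 by rewrite exprn_gt0// subr_gt0.
have h : (1 - r) ^+ 2 <= cn (quad a z).
  rewrite (le_trans _ (cn_quad_ge ha _))//; last by lra.
  by rewrite ler_sqr ?nnegrE; lra.
by rewrite cnV lef_pV2 ?posrE// (lt_le_trans p).
Qed.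

Lemma good_herglotz al c : -1 <= al <= 1 -> -1 <= c <= 1 -> good (herglotz al c).
Proof.
move=> hal hc; apply: good_csq.
- by move=> z z1; exact: herglotz_slit.
- apply: (@locb_eq _ (fun z => quad c z * (quad al z)^-1)).
    by move=> z z1; rewrite invfM invrK mulrC.
  apply: locbM; last exact: locb_quadV.
  by have [? []] := good_quad c.
- apply: goodM; first exact: good_quad.
  apply: goodV; [|exact: locb_quadV|exact: good_quad].
  by move=> z; exact: quad_neq0.
Qed.

Lemma herglotz0 al c : herglotz al c 0 = 1.
Proof.
rewrite /herglotz /quad !mulr0 !add0r divr1 /csq.
have -> : cn (1 : C) = 1 by rewrite /cn /= expr0n expr1n addr0 sqrtr1.
rewrite /= (_ : (1 + 1) / 2 = 1); last by field.
by rewrite sqrtr1 mul0r.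
Qed.

Definition logker w z : C := clog (1 - w * z).

Lemma logker_re w z : cn w < 1 -> cn z <= 1 -> 0 < re (1 - w * z).
Proof.
move=> w1 z1; rewrite reD reN /= subr_gt0 (le_lt_trans (ler_norm _))//.
rewrite (le_lt_trans (le_re_cn _))// cnM.
have := cn_ge0 w; have := cn_ge0 z; nra.
Qed.

Lemma good_logker w : cn w < 1 -> good (logker w).
Proof.
move=> w1; apply: good_clog.
- by move=> z z1; rewrite logker_re// ltW.
- move=> r r1; exists (1 - cn w)^-1 => z zr.
  have z1 : cn z <= 1 by lra.
  have := logker_re w1 z1; have c0 := cn_ge0 w; have c1 := cn_ge0 z.
  have h : 1 - cn w <= cn (1 - w * z).
    have := cnB_ge (w * z) 1; rewrite cnM.
    have -> : cn (1 : C) = 1 by rewrite /cn /= expr0n expr1n addr0 sqrtr1.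
    by rewrite -[cn (1 - _)]cnN opprB; nra.
  have p : 0 < 1 - cn w by lra.
  by move=> _; rewrite cnV lef_pV2 ?posrE// (lt_le_trans p).
- apply: goodD; first exact: good_cst.
  have -> : (fun z => - (w * z)) = (fun z => (- w) * z) by apply/funext => z; rewrite mulNr.
  by apply: goodM; [exact: good_cst|exact: good_id].
Qed.

Lemma logker0 w : logker w 0 = 0.
Proof.
rewrite /logker mulr0 subr0 /clog /= expr1n expr0n addr0 ln1 !mul0r atan0.
by [].
Qed.

Lemma herglotz_mean al c (r : R) : -1 <= al <= 1 -> -1 <= c <= 1 -> 0 <= r < 1 ->
  \int[lebesgue_measure]_(psi in `[(- pi)%R, pi%R]) re (herglotz al c (polar r psi)) =
  2 * pi.
Proof.
move=> hal hc r01; rewrite (good_mean_value (good_herglotz hal hc) r01).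
by rewrite herglotz0 mulr1.
Qed.

End herglotz.

Lemma cvg_cont {R : realType} (h : R -> R) (u : nat -> R) (a : R) :
  {for a, continuous h} -> u @ \oo --> a -> (fun n => h (u n)) @ \oo --> h a.
Proof. by move=> ch ua; exact: (continuous_cvg _ ch ua). Qed.

(** * Limits of complex sequences and of the square root at its cut *)

Section complex_limits.
Context {R : realType}.
Local Notation C := R[i].
Local Notation re := (@complex.Re R).
Local Notation im := (@complex.Im R).
Implicit Types (u v : nat -> C) (l m : C).

Definition ccvg u l : Prop :=
  (fun n => re (u n)) @ \oo --> re l /\ (fun n => im (u n)) @ \oo --> im l.

Lemma ccvg_cst l : ccvg (fun=> l) l.
Proof. by split; exact: cvg_cst. Qed.

Lemma ccvgD u v l m : ccvg u l -> ccvg v m -> ccvg (fun n => u n + v n) (l + m).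
Proof.
move=> [u1 u2] [v1 v2]; split.
- by under eq_fun do rewrite reD; rewrite reD; exact: cvgD.
- by under eq_fun do rewrite imD; rewrite imD; exact: cvgD.
Qed.

Lemma ccvgN u l : ccvg u l -> ccvg (fun n => - u n) (- l).
Proof.
move=> [u1 u2]; split.
- by under eq_fun do rewrite reN; rewrite reN; exact: cvgN.
- by under eq_fun do rewrite imN; rewrite imN; exact: cvgN.
Qed.

Lemma ccvgM u v l m : ccvg u l -> ccvg v m -> ccvg (fun n => u n * v n) (l * m).
Proof.
move=> [u1 u2] [v1 v2]; split.
- by under eq_fun do rewrite reM; rewrite reM; apply: cvgB; exact: cvgM.
- by under eq_fun do rewrite imM; rewrite imM; apply: cvgD; exact: cvgM.
Qed.

Lemma ccvgV u l : l != 0 -> ccvg u l -> ccvg (fun n => (u n)^-1) l^-1.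
Proof.
rewrite complex_neq0 => l0 [u1 u2].
have h : (fun n => (re (u n) ^+ 2 + im (u n) ^+ 2)^-1) @ \oo -->
    (re l ^+ 2 + im l ^+ 2)^-1.
  apply: cvgV => //; rewrite !expr2; under eq_fun do rewrite !expr2.
  by apply: cvgD; exact: cvgM.
split.
- by under eq_fun do rewrite reV; rewrite reV; exact: cvgM.
- by under eq_fun do rewrite imV; rewrite imV; apply: cvgM => //; exact: cvgN.
Qed.

Lemma cvg_cn u l : ccvg u l -> (fun n => cn (u n)) @ \oo --> cn l.
Proof.
move=> [u1 u2]; rewrite /cn; apply: (@cvg_cont _ Num.sqrt).
  exact: sqrt_continuous.
rewrite !expr2; under eq_fun do rewrite !expr2.
by apply: cvgD; exact: cvgM.
Qed.

Lemma ccvg_clog u l : 0 < re l -> ccvg u l -> ccvg (fun n => clog (u n)) (clog l).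
Proof.
move=> l0 [u1 u2]; split => /=.
- apply: cvgM; last exact: cvg_cst.
  apply: (@cvg_cont R (@ln R) (fun n => re (u n) ^+ 2 + im (u n) ^+ 2) (re l ^+ 2 + im l ^+ 2)).
    by apply: continuous_ln; rewrite ltr_pwDl ?exprn_gt0 ?sqr_ge0.
  rewrite !expr2; under eq_fun do rewrite !expr2.
  by apply: cvgD; exact: cvgM.
- apply: (@cvg_cont _ atan); first exact: continuous_atan.
  by apply: cvgM => //; apply: cvgV => //; rewrite gt_eqF.
Qed.

(** Unlike the quotient in the definition of [csq], where u tends to 0 at the cut, this form has a
    limit at the cut as soon as the sign of [im z] is fixed. *)
Lemma im_csq (z : C) : slit z ->
  im (csq z) = Num.sg (im z) * Num.sqrt ((cn z - re z) / 2).
Proof.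
move=> sz; have u0 := csq_re_gt0 sz; have hz := csq_sq sz.
have e2 : (cn z - re z) / 2 = im (csq z) ^+ 2.
  have : cn z = re (csq z) ^+ 2 + im (csq z) ^+ 2.
    have -> : cn z = cn (csq z ^+ 2) by rewrite hz.
    by rewrite expr2 cnM -expr2 cn_sq.
  have : re z = re (csq z) ^+ 2 - im (csq z) ^+ 2.
    have -> : re z = re (csq z ^+ 2) by rewrite hz.
    by rewrite expr2 reM -!expr2.
  by move=> -> ->; field.
have e3 : im z = 2 * re (csq z) * im (csq z).
  have -> : im z = im (csq z ^+ 2) by rewrite hz.
  by rewrite expr2 imM; ring.
rewrite e2 e3 sqrtr_sqr sgrM gtr0_sg; last by rewrite mulr_gt0.
by rewrite mul1r -numEsg.
Qed.

(** The limit s may lie on the cut; the sequence approaches it from one side, recorded by e. As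
    [Num.sqrt] is 0 on negative numbers, one of the two parts of the limit always vanishes. *)
Lemma ccvg_csq u (s : R) (e : R) :
  (forall n, slit (u n)) -> (forall n, Num.sg (im (u n)) = e) ->
  ccvg u s%:C%C -> ccvg (fun n => csq (u n))
    (Num.sqrt s +i* (e * Num.sqrt (- s)))%C.
Proof.
move=> su eu uc; have hc := cvg_cn uc; case: uc => /= u1 u2.
have cs : cn s%:C%C = `|s| by rewrite cn_real.
have e1 : (`|s| + s) / 2 = Num.max s 0.
  by have [h|h] := leP 0 s; [rewrite ger0_norm//|rewrite ltr0_norm//]; lra.
have e2 : (`|s| - s) / 2 = Num.max (- s) 0.
  have [h|h] := leP 0 s.
    by rewrite ger0_norm// max_r ?oppr_le0// subrr mul0r.
  by rewrite ltr0_norm// max_l; lra.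
have mx (x : R) : Num.sqrt (Num.max x 0) = Num.sqrt x.
  by have [h|h] := leP 0 x; rewrite ?sqrtr0// ler0_sqrtr// ltW.
split => /=.
- rewrite -mx -e1 -cs; apply: (@cvg_cont _ Num.sqrt); first exact: sqrt_continuous.
  by apply: cvgM; [exact: cvgD|exact: cvg_cst].
- rewrite (_ : (fun n => _) = (fun n => e * Num.sqrt ((cn (u n) - re (u n)) / 2))).
    apply: cvgM; first exact: cvg_cst.
    rewrite -mx -e2 -cs; apply: (@cvg_cont _ Num.sqrt); first exact: sqrt_continuous.
    by apply: cvgM; [exact: cvgB|exact: cvg_cst].
  by apply/funext => n; rewrite -(eu n) -im_csq.
Qed.

End complex_limits.

(** * Radial boundary values of H *)

Section boundary.
Context {R : realType}.
Local Notation C := R[i].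
Local Notation re := (@complex.Re R).
Local Notation im := (@complex.Im R).
Variables (al c : R).
Hypotheses (hal : -1 <= al <= 1) (hc : -1 < c < 1).

(** The offset 2 makes the first radius 1/2, so that all radii are positive and can be inverted in
    [srad]. *)
Definition rad (n : nat) : R := 1 - (n.+2%:R)^-1.

Lemma rad_itv n : 0 < rad n < 1.
Proof.
have h : 0 < (n.+2%:R : R)^-1 by rewrite invr_gt0 ltr0n.
have h2 : (n.+2%:R : R)^-1 < 1 by rewrite invf_lt1 ?ltr0n// ltr1n.
rewrite /rad subr_gt0 h2 /=.
by rewrite gtrBl.
Qed.

Lemma rad_ge0 n : 0 <= rad n < 1.
Proof. by have /andP[/ltW -> ->] := rad_itv n. Qed.

Lemma cvg_rad : rad @ \oo --> (1 : R).
Proof.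
rewrite -[X in _ --> X]subr0; apply: cvgB; first exact: cvg_cst.
rewrite (_ : (fun _ => _) = (fun n => (n + 1)%N.+1%:R^-1)); last first.
  by apply/funext => n; rewrite addn1.
rewrite (cvg_shiftn 1 (fun n : nat => (n.+1%:R : R)^-1)).
exact: cvg_harmonic.
Qed.

Lemma ccvg_polar (psi : R) : ccvg (fun n => polar (rad n) psi) (polar 1 psi).
Proof.
by split => /=; apply: cvgM; (exact: cvg_rad || exact: cvg_cst).
Qed.

(* [hre + i him] is the boundary value of [herglotz al c] on the unit circle. *)
Definition ratio (psi : R) : R := (cos psi - al) / (cos psi - c).
Definition hre (psi : R) : R := Num.sqrt (ratio psi).
Definition him (psi : R) : R :=
  Num.sg ((c - al) * sin psi) * Num.sqrt (- ratio psi).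

Let hc' : -1 <= c <= 1.
Proof. by case/andP: hc => a b; rewrite !ltW. Qed.

Lemma im_div (z w : C) : im (z / w) = (im z * re w - re z * im w) / (cn w ^+ 2).
Proof. by rewrite imM reV imV cn_sq; ring. Qed.

(** The imaginary part of the quotient is 2 r (1 - r^2) (c - al) sin psi over a positive square. Its
    sign is constant along the radius, so the square root tends to a definite side of its cut. *)
Lemma sg_im_quad n (psi : R) :
  Num.sg (im (quad al (polar (rad n) psi) / quad c (polar (rad n) psi))) =
  Num.sg ((c - al) * sin psi).
Proof.
have /andP[r0 r1] := rad_itv n.
have c1 : cn (polar (rad n) psi) < 1 by rewrite cn_polar gtr0_norm.
have q0 := cn_gt0 (quad_neq0 hc' c1).
rewrite im_div sgrM [Num.sg (_ ^- 2)]gtr0_sg ?invr_gt0 ?exprn_gt0// mulr1.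
have -> : im (quad al (polar (rad n) psi)) * re (quad c (polar (rad n) psi)) -
   re (quad al (polar (rad n) psi)) * im (quad c (polar (rad n) psi)) =
   (2 * rad n * (1 - rad n ^+ 2)) * ((c - al) * sin psi).
  rewrite (_ : rad n ^+ 2 = rad n ^+ 2 * (cos psi ^+ 2 + sin psi ^+ 2)).
    by rewrite /quad /=; ring.
  by rewrite cos2Dsin2 mulr1.
rewrite sgrM gtr0_sg ?mul1r//.
by rewrite !mulr_gt0// subr_gt0 expr_lt1// ltW.
Qed.

Lemma cvg_herglotz (psi : R) : cos psi != c ->
  ccvg (fun n => herglotz al c (polar (rad n) psi)) (hre psi +i* him psi)%C.
Proof.
move=> nc; apply: ccvg_csq.
- move=> n; apply: herglotz_slit => //; have /andP[r0 r1] := rad_itv n.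
  by rewrite cn_polar gtr0_norm.
- by move=> n; exact: sg_im_quad.
have p0 : polar 1 psi != 0 :> C.
  by have := cn_polar 1 psi; apply: contra_eq_neq => ->; rewrite /cn /= !expr0n addr0 sqrtr0 normr1 eq_sym oner_neq0.
have -> : (ratio psi)%:C%C = quad al (polar 1 psi) / quad c (polar 1 psi).
  have cc : cos psi - c != 0 by rewrite subr_eq0.
  have cc' : (cos psi - c)%:C%C != 0 :> C by apply: contra_neq cc; move/(congr1 re).
  rewrite !quad_circle invfM mulrACA divff// mulr1 /ratio !rmorphM /=.
  have n2 : 2%:C%C != 0 :> C by apply/negP => /eqP /(congr1 re) /eqP; rewrite pnatr_eq0.
  by rewrite invfM mulrACA divff// mul1r fmorphV.
have cq a : ccvg (fun n => quad a (polar (rad n) psi)) (quad a (polar 1 psi)).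
  apply: ccvgD; last exact: ccvg_cst.
  by apply: ccvgD; apply: ccvgM; (exact: ccvg_polar || exact: ccvg_cst).
apply: ccvgM; first exact: cq.
apply: ccvgV; last exact: cq.
rewrite quad_circle mulf_neq0//.
by apply/negP => /eqP /(congr1 re) /= /eqP; rewrite mulf_eq0 pnatr_eq0 subr_eq0 (negbTE nc).
Qed.

(** The numerator of H^2 is at most 4 and its denominator at least half of |cos psi - c|, whence 8.
    The bound is uniform in r and serves for dominated convergence. *)
Lemma cn_herglotz_le (r psi : R) : 0 <= r < 1 -> cos psi != c ->
  cn (herglotz al c (polar r psi)) <= Num.sqrt (8 / `|cos psi - c|).
Proof.
move=> r01 nc; have /andP[r0 r1] := r01.
have c1 : cn (polar r psi) < 1 by rewrite cn_polar ger0_norm.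
have sl := herglotz_slit hal hc' c1.
have q0 := cn_gt0 (quad_neq0 hc' c1).
rewrite -(ger0_norm (cn_ge0 (herglotz _ _ _))) -sqrtr_sqr ler_wsqrtr//.
rewrite expr2 -cnM -expr2 csq_sq// cnM cnV.
have a0 : 0 < `|cos psi - c| by rewrite normr_gt0 subr_eq0.
rewrite ler_pdivlMr// mulrAC ler_pdivrMr//.
have := cn_quad_le hal (ltW c1).
have r01' : 0 <= r <= 1 by rewrite r0 ltW.
have := cn_quad_radial psi hc' r01'.
have := cn_ge0 (quad al (polar r psi)); nra.
Qed.

End boundary.

(** * Measurability of the boundary functions *)

Section measurability.
Context {R : realType}.

Lemma measurable_invr : measurable_fun setT (@GRing.inv R).
Proof.
rewrite -(setvU [set 0%R]); apply/measurable_funU => //; first exact: measurableC.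
split; last exact: measurable_fun_set1.
apply: open_continuous_measurable_fun.
  by apply: closed_openC; exact: closed_eq.
move=> x; rewrite inE /= => /eqP x0; exact: inv_continuous.
Qed.

Lemma measurable_sqrt : measurable_fun setT (@Num.sqrt R).
Proof. by apply: continuous_measurable_fun; exact: sqrt_continuous. Qed.

Lemma measurable_funV d (T : measurableType d) (D : set T) (f : T -> R) :
  measurable_fun D f -> measurable_fun D (fun x => (f x)^-1).
Proof. by move=> mf; exact: (measurableT_comp measurable_invr mf). Qed.

Lemma measurable_funsqrt d (T : measurableType d) (D : set T) (f : T -> R) :
  measurable_fun D f -> measurable_fun D (fun x => Num.sqrt (f x)).
Proof. by move=> mf; exact: (measurableT_comp measurable_sqrt mf). Qed.

Lemma sg_div (x : R) : Num.sg x = x * (`|x|)^-1.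
Proof.
have [->|x0] := eqVneq x 0; first by rewrite sgr0 mul0r.
by rewrite {2}[x]numEsg mulfK// normr_eq0.
Qed.

Lemma measurable_funsg d (T : measurableType d) (D : set T) (f : T -> R) :
  measurable_fun D f -> measurable_fun D (fun x => Num.sg (f x)).
Proof.
move=> mf; under eq_fun do rewrite sg_div.
apply: measurable_funM => //; apply: measurable_funV.
exact: measurableT_comp mf.
Qed.

Lemma measurable_funcos d (T : measurableType d) (D : set T) (f : T -> R) :
  measurable_fun D f -> measurable_fun D (fun x => cos (f x)).
Proof.
move=> mf; apply: (measurableT_comp _ mf).
by apply: continuous_measurable_fun; exact: continuous_cos.
Qed.

Lemma measurable_funsin d (T : measurableType d) (D : set T) (f : T -> R) :
  measurable_fun D f -> measurable_fun D (fun x => sin (f x)).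
Proof.
move=> mf; apply: (measurableT_comp _ mf).
by apply: continuous_measurable_fun; exact: continuous_sin.
Qed.

Lemma measurable_funatan d (T : measurableType d) (D : set T) (f : T -> R) :
  measurable_fun D f -> measurable_fun D (fun x => atan (f x)).
Proof.
move=> mf; apply: (measurableT_comp _ mf).
by apply: continuous_measurable_fun; exact: continuous_atan.
Qed.

Lemma measurable_ratio (al c : R) (D : set R) : measurable_fun D (ratio al c).
Proof.
apply: measurable_funM.
  by apply: measurable_funB => //; exact: measurable_funcos.
by apply: measurable_funV; apply: measurable_funB => //; exact: measurable_funcos.
Qed.

Lemma measurable_hre (al c : R) (D : set R) : measurable_fun D (hre al c).
Proof. by apply: measurable_funsqrt; exact: measurable_ratio. Qed.

Lemma measurable_him (al c : R) (D : set R) : measurable_fun D (him al c).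
Proof.
apply: measurable_funM; first apply: measurable_funsg.
  by apply: measurable_funM => //; exact: measurable_funsin.
by apply: measurable_funsqrt; apply: measurable_funN; exact: measurable_ratio.
Qed.

End measurability.

(** * Integrability at the boundary and the mean value property on the circle *)

Section boundary_integrals.
Context {R : realType}.
Local Notation C := R[i].
Local Notation re := (@complex.Re R).
Local Notation im := (@complex.Im R).
Local Notation mu := (@lebesgue_measure R).
Local Notation I := (`[(- pi)%R, pi%R]%classic).
Variable (c : R).
Hypothesis hc : -1 < c < 1.
Implicit Types al : R.

Let hc' : -1 <= c <= 1.
Proof. by case/andP: hc => a b; rewrite !ltW. Qed.

(** Re H is nonnegative with mean 1 on every interior circle, so Fatou gives integrability before
    any majorant is known. *)
Lemma integrable_hre al : -1 <= al <= 1 -> mu.-integrable I (EFin \o hre al c).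
Proof.
move=> hal; pose f n psi := (re (herglotz al c (polar (rad n) psi)))%:E.
have f0 n psi : I psi -> (0 <= f n psi)%E.
  by move=> _; rewrite lee_fin sqrtr_ge0.
have cf n : continuous (fun psi => re (herglotz al c (polar (rad n) psi))).
  exact: (good_continuous (good_herglotz hal hc') (rad_ge0 n)).
have mf n : measurable_fun I (f n).
  by apply/measurable_EFinP; apply: measurable_funTS; exact: continuous_measurable_fun.
have If n : (\int[mu]_(psi in I) f n psi = (2 * pi)%:E)%E.
  rewrite -(herglotz_mean hal hc' (rad_ge0 n)) /Rintegral fineK//.
  by apply: integrable_fin_num => //; exact: integrable_cont.
have := fatou mu (measurable_itv _) mf f0.
have -> : limn_einf (fun n => \int[mu]_(psi in I) f n psi)%E = (2 * pi)%:E.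
  under eq_fun do rewrite If.
  have h : (fun _ : nat => (2 * pi)%:E) @ \oo --> ((2 * pi)%:E : \bar R) by exact: cvg_cst.
  by have [-> _] := cvg_limn_einf_sup h.
move=> h; apply/integrableP; split.
  by apply: (measurableT_comp (@EFin_measurable R setT)); exact: measurable_hre.
rewrite (@le_lt_trans _ _ (2 * pi)%:E) ?ltry//; apply: le_trans h.
apply: ge0_le_integral => //.
- by apply: measurableT_comp => //; apply/measurable_EFinP; exact: measurable_hre.
- rewrite /limn_einf; apply: measurableT_comp => //.
  apply: measurable_fun_limn_esup => n; apply: (measurableT_comp _ (mf n)) => //.
move=> psi Ipsi /=; rewrite ger0_norm ?sqrtr_ge0//.
(* At the singular points the inverse of 0 is 0, so [hre] is 0 there and nonnegativity of the
   sequence suffices. *)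
have [e|ne] := eqVneq (cos psi) c.
  rewrite /hre /ratio e subrr invr0 mulr0 sqrtr0.
  rewrite limn_einf_lim; apply: lime_ge; first exact: is_cvg_einfs.
  by apply: nearW => n; apply: le_ereal_inf_tmp => _ [m _ <-]; exact: f0.
have [h1 _] := cvg_herglotz hal hc ne.
have h2 : (fun n => f n psi) @ \oo --> (hre al c psi)%:E.
  by apply: cvg_EFin; [exact: nearW|exact: h1].
by have [-> _] := cvg_limn_einf_sup h2.
Qed.

Definition dom (psi : R) : R := (Num.sqrt `|cos psi - c|)^-1.

Lemma dom_ge0 psi : 0 <= dom psi.
Proof. by rewrite invr_ge0 sqrtr_ge0. Qed.

Lemma measurable_dom (D : set R) : measurable_fun D dom.
Proof.
apply: measurable_funV; apply: measurable_funsqrt; apply: measurableT_comp => //.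
by apply: measurable_funB => //; exact: measurable_funcos.
Qed.

(** Where cos psi < c, [hre 1 c] is at least sqrt (1 - c) times [dom]; where cos psi > c,
    [hre (-1) c] is at least sqrt (1 + c) times [dom]. Both are integrable by Fatou, so the
    singularity needs no explicit estimate. *)
Lemma integrable_dom : mu.-integrable I (EFin \o dom).
Proof.
have h1 : mu.-integrable I (EFin \o hre 1 c) by apply: integrable_hre; lra.
have h2 : mu.-integrable I (EFin \o hre (-1) c) by apply: integrable_hre; lra.
pose A := (Num.sqrt (1 - c))^-1; pose B := (Num.sqrt (1 + c))^-1.
have h3 : mu.-integrable I ((fun psi => A%:E * (EFin \o hre 1 c) psi) \+
    (fun psi => B%:E * (EFin \o hre (-1) c) psi))%E.
  by apply: integrableD => //; apply: integrableZl.
apply: le_integrable h3 => //.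
  by apply/measurable_EFinP; exact: measurable_dom.
move=> psi Ipsi /=; rewrite lee_fin ger0_norm ?dom_ge0//.
have A0 : 0 < A by rewrite invr_gt0 sqrtr_gt0 subr_gt0; case/andP: hc.
have B0 : 0 < B by rewrite invr_gt0 sqrtr_gt0; case/andP: hc; lra.
have p1 : 0 <= A * hre 1 c psi by rewrite mulr_ge0 ?sqrtr_ge0// ltW.
have p2 : 0 <= B * hre (-1) c psi by rewrite mulr_ge0 ?sqrtr_ge0// ltW.
rewrite ger0_norm ?addr_ge0//.
have cb := cos_geN1 psi; have ca := cos_le1 psi.
have [ltc|gtc|e] := ltrgtP (cos psi) c; last first.
- by rewrite /dom e subrr normr0 sqrtr0 invr0 addr_ge0.
- rewrite (@le_trans _ _ (B * hre (-1) c psi)) ?lerDr// /hre /ratio opprK /dom.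
  have d0 : 0 < cos psi - c by lra.
  rewrite gtr0_norm// sqrtrM; last by lra.
  rewrite sqrtrV ?(ltW d0)// mulrA ler_peMl ?invr_ge0 ?sqrtr_ge0//.
  rewrite /B mulrC ler_pdivlMr ?sqrtr_gt0; last by case/andP: hc; lra.
  by rewrite mul1r ler_wsqrtr//; lra.
- rewrite (@le_trans _ _ (A * hre 1 c psi)) ?lerDl// /hre /ratio /dom.
  have d0 : 0 < c - cos psi by lra.
  rewrite ltr0_norm; last by lra.
  rewrite -[X in _ <= A * Num.sqrt X]mulrNN -invrN !opprB sqrtrM; last by lra.
  rewrite sqrtrV ?(ltW d0)// mulrA ler_peMl ?invr_ge0 ?sqrtr_ge0//.
  rewrite /A mulrC ler_pdivlMr ?sqrtr_gt0; last by case/andP: hc; lra.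
  by rewrite mul1r ler_wsqrtr//; lra.
Qed.

Lemma ae_cos_neq : {ae mu, forall psi, I psi -> cos psi != c}.
Proof.
exists [set acos c; - acos c]; split.
- exact: measurableU.
- apply: countable_lebesgue_measure0; apply: finite_set_countable.
  by rewrite finite_setU; split; exact: finite_set1.
- move=> psi /= /not_implyP[]; rewrite in_itv /= => Ipsi /negP; rewrite negbK => /eqP <-.
  have [p|p] := leP 0 psi; [left|right].
    by rewrite cosK// in_itv /= p; case/andP: Ipsi.
  by rewrite cosKN ?opprK//; case/andP: Ipsi => -> _; rewrite ltW.
Qed.

Lemma ae_cos_imp (P : R -> Prop) :
  (forall psi, (I psi -> cos psi != c) -> P psi) -> {ae mu, forall psi, P psi}.
Proof.
move=> h; have [N [mN N0 sub]] := ae_cos_neq; exists N; split => // psi /= nP.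
by apply: sub => /= k; apply: nP; exact: h.
Qed.

Lemma him_le al psi : -1 <= al <= 1 -> `|him al c psi| <= Num.sqrt 8 * dom psi.
Proof.
move=> hal; rewrite /him /dom /ratio normrM (ger0_norm (sqrtr_ge0 _)).
rewrite (@le_trans _ _ (Num.sqrt (- ((cos psi - al) / (cos psi - c)))))//.
  rewrite ler_piMl ?sqrtr_ge0// normr_sg; by case: eqP.
have cb := cos_geN1 psi; have ca := cos_le1 psi.
rewrite -sqrtrV// -sqrtrM//.
apply: ler_wsqrtr; rewrite (le_trans (ler_norm _))// normrN normrM normfV.
by rewrite ler_wpM2r ?invr_ge0// ler_norml; lra.
Qed.

(** The mean value property of Psi H on the circles of radius [rad n], with H 0 = 1, passes to the
    unit circle by dominated convergence; the majorant is K sqrt 8 times [dom]. *)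
Lemma boundary_mean al (Psi : C -> C) (K : R) : -1 <= al <= 1 -> good Psi ->
  (forall z, cn z <= 1 -> cn (Psi z) <= K) ->
  (forall psi, ccvg (fun n => Psi (polar (rad n) psi)) (Psi (polar 1 psi))) ->
  measurable_fun I (fun psi => re (Psi (polar 1 psi))) ->
  measurable_fun I (fun psi => im (Psi (polar 1 psi))) ->
  \int[mu]_(psi in I) (re (Psi (polar 1 psi)) * hre al c psi -
                       im (Psi (polar 1 psi)) * him al c psi) = 2 * pi * re (Psi 0).
Proof.
move=> hal gP bP cP m1 m2.
have gH := good_herglotz hal hc'.
pose f n psi := re (Psi (polar (rad n) psi) * herglotz al c (polar (rad n) psi)).
pose f' psi := re (Psi (polar 1 psi)) * hre al c psi -
  im (Psi (polar 1 psi)) * him al c psi.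
have cf n : continuous (f n).
  exact: (good_continuous (goodM gP gH) (rad_ge0 n)).
have If n : \int[mu]_(psi in I) f n psi = 2 * pi * re (Psi 0).
  by rewrite (good_mean_value (goodM gP gH) (rad_ge0 n)) herglotz0 mulr1.
have K0 : 0 <= K by rewrite (le_trans (cn_ge0 _) (bP 0 _))// /cn /= !expr0n addr0 sqrtr0.
have mf n : measurable_fun I (EFin \o f n).
  by apply/measurable_EFinP; apply: measurable_funTS; exact: continuous_measurable_fun.
have mf' : measurable_fun I (EFin \o f').
  apply/measurable_EFinP; apply: measurable_funB; apply: measurable_funM => //.
    exact: measurable_hre.
  exact: measurable_him.
have ff' : {ae mu, forall psi, I psi -> (EFin \o f n) psi @[n --> \oo] --> (EFin \o f') psi}.
  apply: ae_cos_imp => psi h Ipsi.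
  apply: cvg_EFin; first exact: nearW.
  have [h1 _] := ccvgM (cP psi) (cvg_herglotz hal hc (h Ipsi)).
  by rewrite /f' -[X in _ --> X](reM (Psi _) (hre al c psi +i* him al c psi)%C).
have iG : mu.-integrable I (fun psi => (K * Num.sqrt 8)%:E * (EFin \o dom) psi)%E.
  by apply: integrableZl => //; exact: integrable_dom.
have fG : {ae mu, forall psi n, I psi ->
    (`|(EFin \o f n) psi| <= (K * Num.sqrt 8)%:E * (EFin \o dom) psi)%E}.
  apply: ae_cos_imp => psi h n Ipsi.
  rewrite /= lee_fin (le_trans (le_re_cn _))// cnM -mulrA.
  have /andP[r0 r1] := rad_ge0 (R := R) n.
  rewrite ler_pM ?cn_ge0 ?bP ?cn_polar ?ger0_norm ?(ltW r1)//.
  rewrite (le_trans (cn_herglotz_le hal hc (rad_ge0 n) (h Ipsi)))//.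
  by rewrite sqrtrM// sqrtrV.
have [_ _ h] := @dominated_convergence _ _ _ mu I (measurable_itv _) _ _ _ mf mf' ff' iG fG.
have e : (\int[mu]_(psi in I) (EFin \o f') psi = (2 * pi * re (Psi 0))%:E)%E.
  apply: (cvg_unique _ h) => //.
  rewrite (_ : (fun _ => _) = cst (2 * pi * re (Psi 0))%:E); first exact: cvg_cst.
  apply/funext => n; rewrite /= -(If n) /Rintegral fineK//.
  by apply: integrable_fin_num => //; exact: integrable_cont.
by rewrite /Rintegral e.
Qed.

End boundary_integrals.

Lemma cvg_Rintegral d (T : measurableType d) (R : realType)
    (mu : {measure set T -> \bar R}) (D : set T) (f : nat -> T -> R) (g G : T -> R) :
  measurable D -> (forall n, measurable_fun D (f n)) -> measurable_fun D g ->
  (forall x, D x -> f n x @[n --> \oo] --> g x) ->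
  mu.-integrable D (EFin \o G) -> (forall n x, D x -> `|f n x| <= G x) ->
  \int[mu]_(x in D) f n x @[n --> \oo] --> \int[mu]_(x in D) g x.
Proof.
move=> mD mf mg fg iG fG.
have [] := @dominated_convergence _ _ _ mu D mD (fun n => EFin \o f n) (EFin \o g)
  (EFin \o G) _ _ _ iG _.
- by move=> n; exact/measurable_EFinP.
- exact/measurable_EFinP.
- by apply: aeW => x Dx; apply: cvg_EFin; [exact: nearW|exact: fg].
- by apply: aeW => x n Dx /=; rewrite lee_fin fG.
move=> ig _ h; apply: fine_cvg; rewrite fineK; first exact: h.
exact: integrable_fin_num.
Qed.

Lemma measurable_funln {R : realType} d (T : measurableType d) (D : set T) (f : T -> R) :
  measurable_fun D f -> measurable_fun D (fun x => ln (f x)).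
Proof. by move=> mf; exact: (measurableT_comp (@measurable_ln R) mf). Qed.

(** * The logarithmic potential through the conjugate kernel *)

Section potential.
Context {R : realType}.
Local Notation C := R[i].
Local Notation re := (@complex.Re R).
Local Notation im := (@complex.Im R).
Local Notation mu := (@lebesgue_measure R).
Local Notation I := (`[(- pi)%R, pi%R]%classic).
Variables (al c : R).
Hypotheses (hal : -1 <= al <= 1) (hc : -1 < c < 1).

Let hc' : -1 <= c <= 1.
Proof. by case/andP: hc => a b; rewrite !ltW. Qed.

(* [kap r x - i saw r x] is the principal logarithm of [1 - r e^(ix)]. *)
Definition kap (r x : R) : R := ln (1 - 2 * r * cos x + r ^+ 2) / 2.
Definition saw (r x : R) : R := atan (r * sin x / (1 - r * cos x)).

Lemma integrable_him : mu.-integrable I (EFin \o him al c).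
Proof.
have h : mu.-integrable I (fun psi => (Num.sqrt 8)%:E * (EFin \o dom c) psi)%E.
  by apply: integrableZl => //; exact: integrable_dom.
apply: le_integrable h => //.
  by apply: (measurableT_comp (@EFin_measurable R setT)); exact: measurable_him.
move=> psi _ /=; rewrite lee_fin (le_trans (him_le c psi hal))//.
by rewrite ger0_norm ?mulr_ge0 ?sqrtr_ge0 ?dom_ge0.
Qed.

Lemma integral_hre : \int[mu]_(psi in I) hre al c psi = 2 * pi.
Proof.
have := @boundary_mean R c hc al (fun=> 1) (cn 1) hal (good_cst 1)
  (fun _ _ => lexx _) (fun=> ccvg_cst 1) (measurable_cst _) (measurable_cst _).
by under eq_Rintegral do rewrite mul1r mul0r subr0; rewrite /= mulr1.
Qed.

(** For Psi = -i the integrand of [boundary_mean] is exactly [him], and the real part of -i is 0. *)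
Lemma integral_him : \int[mu]_(psi in I) him al c psi = 0.
Proof.
have := @boundary_mean R c hc al (fun=> - 'i%C) (cn (- 'i%C)) hal (good_cst _)
  (fun _ _ => lexx _) (fun=> ccvg_cst _) (measurable_cst _) (measurable_cst _).
by under eq_Rintegral do rewrite /= oppr0 mul0r sub0r mulN1r opprK; rewrite /= oppr0 mulr0.
Qed.

Lemma re_logarg (r phi psi : R) :
  re (1 - polar r (- phi) * polar 1 psi) = 1 - r * cos (psi - phi).
Proof. by rewrite reD reN reM /= cosN sinN cosB; ring. Qed.

Lemma im_logarg (r phi psi : R) :
  im (1 - polar r (- phi) * polar 1 psi) = - (r * sin (psi - phi)).
Proof. by rewrite imD imN imM /= cosN sinN sinB; ring. Qed.

Lemma re_clog z : re (clog z) = ln (re z ^+ 2 + im z ^+ 2) / 2. Proof. by []. Qed.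

Lemma im_clog z : im (clog z) = atan (im z / re z). Proof. by []. Qed.

Lemma re_logker (r phi psi : R) :
  re (logker (polar r (- phi)) (polar 1 psi)) = kap r (psi - phi).
Proof.
rewrite /logker re_clog re_logarg im_logarg /kap.
congr (ln _ / 2); have := cos2Dsin2 (psi - phi) => h; nra.
Qed.

Lemma im_logker (r phi psi : R) :
  im (logker (polar r (- phi)) (polar 1 psi)) = - saw r (psi - phi).
Proof.
by rewrite /logker im_clog re_logarg im_logarg /saw mulNr atanN.
Qed.

Lemma measurable_kap (r phi : R) (D : set R) :
  measurable_fun D (fun psi => kap r (psi - phi)).
Proof.
apply: measurable_funM => //; apply: measurable_funln.
apply: measurable_funD => //; apply: measurable_funB => //.
by apply: measurable_funM => //; apply: measurable_funcos; exact: measurable_funB.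
Qed.

Lemma measurable_saw (r phi : R) (D : set R) :
  measurable_fun D (fun psi => saw r (psi - phi)).
Proof.
have m : measurable_fun D (fun psi => psi - phi) by exact: measurable_funB.
apply: measurable_funatan; apply: measurable_funM.
  by apply: measurable_funM => //; exact: measurable_funsin.
apply: measurable_funV; apply: measurable_funB => //.
by apply: measurable_funM => //; exact: measurable_funcos.
Qed.

Lemma saw_le (r x : R) : `|saw r x| <= pi / 2.
Proof.
rewrite ler_norml; have := atan_gtNpi2 (r * sin x / (1 - r * cos x)).
have := atan_ltpi2 (r * sin x / (1 - r * cos x)); rewrite /saw; lra.
Qed.

Lemma integrable_saw_him (r phi : R) :
  mu.-integrable I (EFin \o (fun psi => saw r (psi - phi) * him al c psi)).
Proof.
have h : mu.-integrable I (fun psi => (pi / 2)%:E * (EFin \o him al c) psi)%E.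
  by apply: integrableZl => //; exact: integrable_him.
apply: le_integrable h => //.
  apply: (measurableT_comp (@EFin_measurable R setT)).
  by apply: measurable_funM; [exact: measurable_saw|exact: measurable_him].
move=> psi _ /=; rewrite lee_fin !normrM ler_wpM2r//.
by rewrite (le_trans (saw_le _ _))// -normrM ler_norm.
Qed.

Lemma logker_bound (w z : C) : cn w < 1 -> cn z <= 1 ->
  cn (logker w z) <= 4 + ((1 - cn w)^-1) ^+ 2 + pi / 2.
Proof.
move=> w1 z1; rewrite /logker.
have h1 : cn (1 : C) = 1 by rewrite /cn /= expr0n expr1n addr0 sqrtr1.
have c0 := cn_ge0 w; have c1 := cn_ge0 z.
apply: le_trans (cn_clog (logker_re w1 z1)) _; rewrite lerD2r lerD//.
  have := cnB 1 (w * z); rewrite h1 cnM; have := cn_ge0 (1 - w * z) => a b.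
  have : cn w * cn z <= 1 by nra.
  by nra.
have h : 1 - cn w <= cn (1 - w * z).
  by have := cnB_ge (w * z) 1; rewrite cnM h1 -[cn (1 - _)]cnN opprB; nra.
have p : 0 < 1 - cn w by lra.
rewrite ler_sqr ?nnegrE ?cn_ge0 ?invr_ge0 ?(ltW p)//.
by rewrite cnV lef_pV2 ?posrE// (lt_le_trans p).
Qed.

Lemma kap_le (r phi : R) : 0 <= r < 1 ->
  exists K, forall psi, `|kap r (psi - phi)| <= K.
Proof.
move=> /andP[r0 r1]; have w1 : cn (polar r (- phi)) < 1 by rewrite cn_polar ger0_norm.
exists (4 + ((1 - cn (polar r (- phi)))^-1) ^+ 2 + pi / 2) => psi.
rewrite -re_logker (le_trans (le_re_cn _))// logker_bound//.
by rewrite cn_polar normr1.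
Qed.

Lemma integrable_kap_hre (r phi : R) : 0 <= r < 1 ->
  mu.-integrable I (EFin \o (fun psi => kap r (psi - phi) * hre al c psi)).
Proof.
move=> /kap_le -/(_ phi)[K hK].
have h : mu.-integrable I (fun psi => K%:E * (EFin \o hre al c) psi)%E.
  by apply: integrableZl => //; exact: integrable_hre.
apply: le_integrable h => //.
  apply: (measurableT_comp (@EFin_measurable R setT)).
  by apply: measurable_funM; [exact: measurable_kap|exact: measurable_hre].
move=> psi _ /=; rewrite lee_fin (normrM (kap _ _)) (normrM K) ler_wpM2r//.
by rewrite (le_trans (hK _))// ler_norm.
Qed.

(** This is [boundary_mean] for log (1 - r e^(-i phi) z), which vanishes at 0. It exchanges [kap],
    which is not bounded uniformly in r, for [saw], which is bounded by pi / 2. *)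
Lemma kap_saw (r phi : R) : 0 <= r < 1 ->
  \int[mu]_(psi in I) (kap r (psi - phi) * hre al c psi) =
  - \int[mu]_(psi in I) (saw r (psi - phi) * him al c psi).
Proof.
move=> r01; have /andP[r0 r1] := r01.
have w1 : cn (polar r (- phi)) < 1 by rewrite cn_polar ger0_norm.
have := @boundary_mean R c hc al (logker (polar r (- phi))) _ hal (good_logker w1)
  (fun z => logker_bound w1).
rewrite logker0 mulr0 => h; apply/eqP; rewrite -addr_eq0 -RintegralD//=.
- rewrite -h.
  + apply/eqP; apply: eq_Rintegral => psi _.
    by rewrite re_logker im_logker mulNr opprK.
  + move=> psi; apply: ccvg_clog; first by rewrite logker_re// cn_polar normr1.
    apply: ccvgD; first exact: ccvg_cst.
    by apply: ccvgN; apply: ccvgM; [exact: ccvg_cst|exact: ccvg_polar].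
  + rewrite (_ : (fun psi => _) = (fun psi => kap r (psi - phi))).
      exact: measurable_kap.
    by apply/funext => psi; exact: re_logker.
  + rewrite (_ : (fun psi => _) = (fun psi => - saw r (psi - phi))).
      by apply: measurable_funN; exact: measurable_saw.
    by apply/funext => psi; exact: im_logker.
- exact: integrable_kap_hre.
- exact: integrable_saw_him.
Qed.

(** The potential of the candidate at e^(i phi), obtained by letting r tend to 1 in [kap_saw]. In
    this form it is finite at every point, the endpoints of the arcs included. *)
Definition pot (phi : R) : R :=
  (\int[mu]_(psi in I) (saw 1 (psi - phi) * him al c psi)) / (2 * pi).

Lemma cvg_saw (x : R) : saw (rad n) x @[n --> \oo] --> saw 1 x.
Proof.
rewrite /saw; have [e|ne] := eqVneq (1 * cos x) 1.
  have s0 : sin x = 0.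
    have := cos2Dsin2 x; move: e; rewrite mul1r => ->.
    rewrite expr1n => h; have : sin x ^+ 2 = 0 by lra.
    by move=> /eqP; rewrite sqrf_eq0 => /eqP.
  by under eq_fun do rewrite s0 mulr0 mul0r; rewrite s0 mulr0 mul0r; exact: cvg_cst.
apply: (@cvg_cont R (@atan R) (fun n => rad n * sin x / (1 - rad n * cos x))).
  exact: continuous_atan.
apply: cvgM; first by apply: cvgM; [exact: cvg_rad|exact: cvg_cst].
apply: cvgV; first by rewrite subr_eq0 eq_sym.
apply: cvgB; first exact: cvg_cst.
by apply: cvgM; [exact: cvg_rad|exact: cvg_cst].
Qed.

Lemma cvg_pot (phi : R) :
  (- (\int[mu]_(psi in I) (kap (rad n) (psi - phi) * hre al c psi)) / (2 * pi))
    @[n --> \oo] --> pot phi.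
Proof.
rewrite /pot; apply: cvgM; last exact: cvg_cst.
have iG : mu.-integrable I (EFin \o (fun psi => pi / 2 * `|him al c psi|)).
  have h : mu.-integrable I (fun psi => (pi / 2)%:E * (abse \o (EFin \o him al c)) psi)%E.
    by apply: integrableZl => //; apply: integrable_abse => //; exact: integrable_him.
  by apply: eq_integrable h.
under eq_fun do rewrite kap_saw ?rad_ge0// opprK.
apply: (@cvg_Rintegral _ _ R mu I (fun n psi => saw (rad n) (psi - phi) * him al c psi)
  (fun psi => saw 1 (psi - phi) * him al c psi)
  (fun psi => pi / 2 * `|him al c psi|)) => //.
- by move=> n; apply: measurable_funM; [exact: measurable_saw|exact: measurable_him].
- by apply: measurable_funM; [exact: measurable_saw|exact: measurable_him].
- by move=> psi _; apply: cvgM; [exact: cvg_saw|exact: cvg_cst].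
- by move=> n psi _; rewrite normrM ler_wpM2r//; exact: saw_le.
Qed.

(** Since sin x / (1 - cos x) is the cotangent of x / 2, it is the tangent of (pi - x) / 2, an angle
    on which [atan] inverts [tan]. *)
Lemma saw1E (x : R) : 0 < x < 2 * pi -> saw 1 x = (pi - x) / 2.
Proof.
move=> h; have p := @pi_gt0 R.
have hx : 0 < x / 2 < pi by lra.
have s0 := sin_gt0_pi hx.
have e1 : x = x / 2 *+ 2 by rewrite -mulr_natr divfK// pnatr_eq0.
rewrite /saw !mul1r.
have -> : sin x / (1 - cos x) = tan ((pi - x) / 2).
  rewrite /tan (_ : (pi - x) / 2 = pi / 2 - x / 2); last by field.
  rewrite sinB cosB sin_pihalf cos_pihalf !mul0r !mul1r add0r subr0.
  rewrite {1 2}e1 sin_mulr2n cos_mulr2n cos2sin2.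
  have -> : 1 - ((1 - sin (x / 2) ^+ 2) *+ 2 - 1) = sin (x / 2) ^+ 2 * 2 by ring.
  by field; rewrite gt_eqF.
by rewrite tanK// in_itv /=; apply/andP; split; lra.
Qed.

Lemma sawN (r x : R) : saw r (- x) = - saw r x.
Proof. by rewrite /saw sinN cosN mulrN mulNr atanN. Qed.

(** The difference of the two sawtooths is (phi - phi') / 2 everywhere, plus pi between phi and
    phi'. The constant integrates to 0 against [him] by [integral_him], so only the arc in between
    contributes. *)
Lemma pot_diff (phi phi' : R) : - pi <= phi -> phi < phi' -> phi' <= pi ->
  pot phi - pot phi' = 2^-1 * \int[mu]_(psi in `]phi, phi'[) him al c psi.
Proof.
move=> h1 h2 h3; have p := @pi_gt0 R.
have sub : `]phi, phi'[ `<=` I.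
  by move=> x /=; rewrite !in_itv /=; lra.
rewrite /pot -mulrBl -RintegralB//=; [|exact: integrable_saw_him..].
pose f psi := (phi - phi') / 2 * him al c psi + pi * (him al c \_ `]phi, phi'[) psi.
have ir : mu.-integrable I (EFin \o (him al c \_ `]phi, phi'[)).
  rewrite -restrict_EFin; apply/integrable_restrict => //.
  by apply: integrableS integrable_him => //; (exact: measurableI || exact: subIsetl).
have -> : \int[mu]_(psi in I) (saw 1 (psi - phi) * him al c psi -
    saw 1 (psi - phi') * him al c psi) = \int[mu]_(psi in I) f psi.
  have mf1 : measurable_fun I (EFin \o (fun psi => saw 1 (psi - phi) * him al c psi -
      saw 1 (psi - phi') * him al c psi)).
    apply: (measurableT_comp (@EFin_measurable R setT)).
    by apply: measurable_funB; apply: measurable_funM;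
      (exact: measurable_saw || exact: measurable_him).
  have mf2 : measurable_fun I (EFin \o f).
    apply: (measurableT_comp (@EFin_measurable R setT)).
    apply: measurable_funD; apply: measurable_funM => //; first exact: measurable_him.
    by have := measurable_int _ ir => /measurable_EFinP.
  have sB (x y : R) : saw 1 (x - y) = - saw 1 (y - x) by rewrite -sawN opprB.
  rewrite /Rintegral; congr fine; apply: ae_eq_integral => //.
  (* Besides the two jumps, the ends -pi and pi are excluded: there a difference of angles could
     equal 2 pi, outside the range of [saw1E]. *)
  exists ([set phi; phi'] `|` [set (- pi)%R; pi]); split.
  - by apply: measurableU; exact: measurableU.
  - apply: countable_lebesgue_measure0; apply: finite_set_countable.
    by rewrite !finite_setU; do !split; exact: finite_set1.
  - move=> psi /= h; apply: contrapT.
    move=> /not_orP[/not_orP[/eqP n1 /eqP n2] /not_orP[/eqP n3 /eqP n4]].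
    apply: h => Ipsi; congr EFin; rewrite -mulrBl /f patchE.
    move: Ipsi; rewrite in_itv /= => /andP[].
    rewrite le_eqVlt eq_sym (negbTE n3) /= => i1.
    rewrite le_eqVlt (negbTE n4) /= => i2.
    have [l1|l1] := ltP psi phi.
      rewrite memNset /= ?mulr0 ?addr0; last by rewrite in_itv /=; lra.
      by rewrite (sB psi phi) (sB psi phi') !saw1E; [congr (_ * _); field|lra|lra].
    have l2 : phi < psi by rewrite lt_neqAle eq_sym n1.
    have [l3|l3] := ltP phi' psi.
      rewrite memNset /= ?mulr0 ?addr0; last by rewrite in_itv /=; lra.
      by rewrite !saw1E; [congr (_ * _); field|lra|lra].
    have l4 : psi < phi' by rewrite lt_neqAle n2.
    rewrite mem_set /=; last by rewrite in_itv /= l2 l4.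
    rewrite (sB psi phi') !saw1E; [|lra|lra].
    by rewrite -mulrDl; congr (_ * _); field.
rewrite /f RintegralD//=; first last.
- exact: (integrableZl _ pi ir).
- exact: (integrableZl _ _ integrable_him).
rewrite !RintegralZl//; last exact: integrable_him.
rewrite integral_him mulr0 add0r.
rewrite -Rintegral_mkcondr setIidr//.
have e (P J : R) : 0 < P -> P * J / (2 * P) = 2^-1 * J.
  by move=> P0; field; rewrite gt_eqF.
exact: e.
Qed.

Lemma pot_pi : pot (- pi) = pot pi.
Proof.
rewrite /pot; congr (_ / _); apply: eq_Rintegral => psi _; congr (_ * _).
rewrite /saw (_ : psi - - pi = psi - pi + pi *+ 2); last by ring.
by rewrite sinD2pi cosD2pi.
Qed.

Lemma ratio_ge0_him (psi : R) : 0 <= ratio al c psi -> him al c psi = 0.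
Proof. by move=> h; rewrite /him ler0_sqrtr ?mulr0// oppr_le0. Qed.

End potential.

(** * Where the potential is constant and where it is larger *)

Section potential_cases.
Context {R : realType}.
Local Notation mu := (@lebesgue_measure R).
Local Notation I := (`[(- pi)%R, pi%R]%classic).
Variables (al c : R).
Hypotheses (hal : -1 <= al <= 1) (hc : -1 < c < 1).

Local Notation h := (him al c).

Lemma integral_him_ge0 (x y : R) : {in `]x, y[, forall psi, 0 <= (c - al) * sin psi} ->
  0 <= \int[mu]_(psi in `]x, y[) h psi.
Proof.
move=> H; apply: Rintegral_ge0 => psi /H s; rewrite /him mulr_ge0 ?sqrtr_ge0//.
by rewrite sgr_ge0.
Qed.

Lemma integral_him_le0 (x y : R) : {in `]x, y[, forall psi, (c - al) * sin psi <= 0} ->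
  \int[mu]_(psi in `]x, y[) h psi <= 0.
Proof.
move=> H; pose g psi := - h psi.
have g0 psi : psi \in `]x, y[ -> 0 <= g psi.
  move=> /H s; rewrite /g /him -mulNr mulr_ge0 ?sqrtr_ge0// oppr_ge0.
  by rewrite sgr_le0.
have -> : \int[mu]_(psi in `]x, y[) h psi = - (\int[mu]_(psi in `]x, y[) g psi).
  rewrite /Rintegral -fineN -integral_ge0N; last by move=> psi hp; rewrite lee_fin g0.
  by congr fine; apply: eq_integral => psi _; rewrite /g -EFinN opprK.
by rewrite oppr_le0; apply: Rintegral_ge0 => psi; exact: g0.
Qed.

Lemma integral_him_eq0 (x y : R) : {in `]x, y[, forall psi, 0 <= ratio al c psi} ->
  \int[mu]_(psi in `]x, y[) h psi = 0.
Proof.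
move=> H; rewrite (@eq_Rintegral _ _ _ mu _ (cst 0)); first by rewrite Rintegral_cst//= mul0r.
by move=> psi; rewrite inE /= => /H; exact: ratio_ge0_him.
Qed.

Lemma ratio_ge0_near0 (phi psi : R) : c <= cos phi -> al <= cos phi ->
  cos phi <= cos psi -> 0 <= ratio al c psi.
Proof. by move=> *; rewrite /ratio divr_ge0// subr_ge0; lra. Qed.

Lemma ratio_ge0_nearpi (phi psi : R) : cos phi <= c -> cos phi <= al ->
  cos psi <= cos phi -> 0 <= ratio al c psi.
Proof.
move=> *; rewrite /ratio -mulrNN -invrN divr_ge0// oppr_ge0 subr_le0; lra.
Qed.

Let hc' : -1 <= c <= 1.
Proof. by case/andP: hc => a b; rewrite !ltW. Qed.

Lemma sin_lt0 (x : R) : - pi < x < 0 -> sin x < 0.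
Proof. by move=> hx; rewrite -oppr_gt0 -sinN sin_gt0_pi//; lra. Qed.

Local Notation pot := (pot al c).

(** All angles between 0 and phi have cosine at least [cos phi], hence a nonnegative [ratio], and
    [him] vanishes along the whole path. *)
Lemma pot_near0 (phi : R) : I phi -> c <= cos phi -> al <= cos phi -> pot phi = pot 0.
Proof.
rewrite /= in_itv /= => Iphi cphi aphi; have p := @pi_gt0 R.
have [l|l|->//] := ltrgtP phi 0.
- have := pot_diff hal hc (_ : - pi <= phi) l (_ : 0 <= pi).
  rewrite integral_him_eq0; first by rewrite mulr0 => h; apply/eqP; rewrite -subr_eq0 h//; lra.
  move=> psi; rewrite in_itv /= => hp; apply: (ratio_ge0_near0 cphi aphi).
  by rewrite -(cosN phi) -(cosN psi) ler_cos ?in_itv//=; lra.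
- have := pot_diff hal hc (_ : - pi <= 0) l (_ : phi <= pi).
  rewrite integral_him_eq0; first by rewrite mulr0 => h; apply/eqP; rewrite eq_sym -subr_eq0 h//; lra.
  move=> psi; rewrite in_itv /= => hp; apply: (ratio_ge0_near0 cphi aphi).
  by rewrite ler_cos ?in_itv//=; lra.
Qed.

Lemma pot_nearpi (phi : R) : I phi -> cos phi <= c -> cos phi <= al -> pot phi = pot pi.
Proof.
rewrite /= in_itv /= => Iphi cphi aphi; have p := @pi_gt0 R.
have [l|l] := leP 0 phi.
- have [->//|ne] := eqVneq phi pi.
  have l' : phi < pi by rewrite lt_neqAle ne; lra.
  have := pot_diff hal hc (_ : - pi <= phi) l' (lexx _).
  rewrite integral_him_eq0; first by rewrite mulr0 => h; apply/eqP; rewrite -subr_eq0 h//; lra.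
  move=> psi; rewrite in_itv /= => hp; apply: (ratio_ge0_nearpi cphi aphi).
  by rewrite ler_cos ?in_itv//=; lra.
- rewrite -pot_pi; have [->//|ne] := eqVneq phi (- pi).
  have l' : - pi < phi by rewrite lt_neqAle eq_sym ne; lra.
  have := pot_diff hal hc (lexx _) l' (_ : phi <= pi).
  rewrite integral_him_eq0; first by rewrite mulr0 => h; apply/eqP; rewrite eq_sym -subr_eq0 h//; lra.
  move=> psi; rewrite in_itv /= => hp; apply: (ratio_ge0_nearpi cphi aphi).
  by rewrite -(cosN phi) -(cosN psi) ler_cos ?in_itv//=; lra.
Qed.

(** A gap inside the near arc occurs only for c < al. Then [him] is nonpositive for positive angles
    and nonnegative for negative ones, so by [pot_diff] the potential does not decrease away from 0
    on either side. *)
Lemma pot_ge0 (phi : R) : I phi -> c <= cos phi -> pot 0 <= pot phi.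
Proof.
move=> Iphi cphi; have [ac|ac] := leP al c.
  by rewrite pot_near0// (le_trans ac).
move: Iphi; rewrite /= in_itv /= => Iphi; have p := @pi_gt0 R.
have [l|l|->//] := ltrgtP phi 0.
- have := pot_diff hal hc (_ : - pi <= phi) l (_ : 0 <= pi).
  have : 0 <= \int[mu]_(psi in `]phi, 0[) h psi.
    apply: integral_him_ge0 => psi; rewrite in_itv /= => hp.
    by rewrite -mulrNN mulr_ge0 ?oppr_ge0 ?subr_le0 ?ltW// sin_lt0//; lra.
  by move=> h1 h2; have := h2 (_ : _) (_ : _); lra.
- have := pot_diff hal hc (_ : - pi <= 0) l (_ : phi <= pi).
  have : \int[mu]_(psi in `]0, phi[) h psi <= 0.
    apply: integral_him_le0 => psi; rewrite in_itv /= => hp.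
    by rewrite mulr_le0_ge0 ?subr_le0 ?(ltW ac)// ltW// sin_gt0_pi//; lra.
  by move=> h1 h2; have := h2 (_ : _) (_ : _); lra.
Qed.

Lemma pot_gepi (phi : R) : I phi -> cos phi <= c -> pot pi <= pot phi.
Proof.
move=> Iphi cphi; have [ac|ac] := leP c al.
  by rewrite pot_nearpi// (le_trans cphi).
move: Iphi; rewrite /= in_itv /= => Iphi; have p := @pi_gt0 R.
have [l|l] := leP 0 phi.
- have [->//|ne] := eqVneq phi pi.
  have l' : phi < pi by rewrite lt_neqAle ne; lra.
  have := pot_diff hal hc (_ : - pi <= phi) l' (lexx _).
  have : 0 <= \int[mu]_(psi in `]phi, pi[) h psi.
    apply: integral_him_ge0 => psi; rewrite in_itv /= => hp.
    by rewrite mulr_ge0 ?subr_ge0 ?(ltW ac)// ltW// sin_gt0_pi//; lra.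
  by move=> h1 h2; have := h2 (_ : _); lra.
- rewrite -pot_pi; have [->//|ne] := eqVneq phi (- pi).
  have l' : - pi < phi by rewrite lt_neqAle eq_sym ne; lra.
  have := pot_diff hal hc (lexx _) l' (_ : phi <= pi).
  have : \int[mu]_(psi in `](- pi), phi[) h psi <= 0.
    apply: integral_him_le0 => psi; rewrite in_itv /= => hp.
    by rewrite mulr_ge0_le0 ?subr_ge0 ?(ltW ac)// ltW// sin_lt0//; lra.
  by move=> h1 h2; have := h2 (_ : _); lra.
Qed.

End potential_cases.

(** * The substitution x = cos psi for integrands singular at the ends *)

Section cosine_substitution.
Context {R : realType}.
Local Notation mu := (@lebesgue_measure R).

(** G may blow up at both ends, so the substitution is made on compact subintervals; nonnegativity
    lets the integrals over the increasing subintervals converge on both sides. *)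
Lemma integral_cos_substitution (G : R -> R) (g : R) : 0 <= g < pi ->
  (forall x, -1 < x < cos g -> {for x, continuous G}) ->
  (forall x, -1 < x < cos g -> 0 <= G x) ->
  (\int[mu]_(x in `](-1)%R, (cos g)%R[) (G x)%:E =
   \int[mu]_(psi in `]g, pi[) (G (cos psi) * sin psi)%R%:E)%E.
Proof.
move=> hg cG G0; have /andP[g0 gp] := hg.
(* With n + 2 in the denominator, 2 [d n] is at most pi - g, so the subinterval is not reversed even
   for n = 0. *)
pose d n := (pi - g) / n.+2%:R.
have n2 n : 0 < n.+2%:R :> R by rewrite ltr0n.
have n2' n : 2 <= n.+2%:R :> R by rewrite ler_nat.
have d0 n : 0 < d n by rewrite divr_gt0// subr_gt0.
have dle n : d n <= (pi - g) / 2.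
  by rewrite ler_pM2l ?subr_gt0// lef_pV2 ?posrE.
have dmono m n : (m <= n)%N -> d n <= d m.
  by move=> mn; rewrite ler_pM2l ?subr_gt0// lef_pV2 ?posrE// ler_nat.
have dsmall e : 0 < e -> exists n, d n < e.
  move=> e0; exists (Num.truncn ((pi - g) / e)).
  rewrite ltr_pdivrMr// mulrC -ltr_pdivrMr//.
  by rewrite (lt_trans (truncnS_gt _))// ltr_nat.
pose E n : set R := `[g + d n, pi - d n]%classic.
pose F n : set R := `[cos (pi - d n), cos (g + d n)]%classic.
have bE n : 0 <= g + d n /\ pi - d n <= pi /\ g + d n <= pi - d n.
  by have := d0 n; have := dle n; lra.
have FE n x : -1 <= x <= 1 -> F n x <-> E n (acos x).
  move=> hx; have [b1 [b2 b3]] := bE n; have := d0 n => dn.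
  rewrite /F /E /= !in_itv /= -{1 2}(acosK (_ : x \in `[-1, 1])) ?in_itv//.
  have a0 := acos_ge0 hx; have a1 := acos_lepi hx.
  by rewrite !ler_cos ?in_itv/=; lra.
have UE : \bigcup_n E n = `]g, pi[%classic.
  apply/seteqP; split => x; rewrite /E /=.
    by move=> [n _]; rewrite /= !in_itv /=; have := d0 n; lra.
  rewrite in_itv /= => hx.
  have e0 : 0 < Num.min (x - g) (pi - x) by rewrite lt_min; lra.
  have [n hn] := dsmall _ e0.
  exists n => //; move: hn; rewrite lt_min /= in_itv /=; lra.
have FI n x : F n x -> -1 <= x <= 1.
  rewrite /F /= in_itv /=; have := cos_geN1 (pi - d n); have := cos_le1 (g + d n); lra.
have UF : \bigcup_n F n = `](-1)%R, (cos g)%R[%classic.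
  apply/seteqP; split => x.
    move=> [n _ Fx]; have hx := FI _ _ Fx.
    have : (\bigcup_n E n) (acos x) by exists n => //; apply/FE.
    rewrite UE /= !in_itv /= => hp.
    rewrite -(acosK (_ : x \in `[-1, 1])) ?in_itv// -cospi.
    by rewrite !ltr_cos ?in_itv/=; lra.
  rewrite /= in_itv /= => hx; have := cos_le1 g => c1.
  have hx' : -1 <= x <= 1 by lra.
  have : (\bigcup_n E n) (acos x).
    rewrite UE /= in_itv /= acos_gtE//; last by lra.
    by rewrite acos_ltpi; lra.
  by move=> [n _ h]; exists n => //; apply/FE.
have mG : measurable_fun `](-1)%R, (cos g)%R[ G.
  apply: open_continuous_measurable_fun; first exact: interval_open.
  by move=> x; rewrite inE /= in_itv /=; exact: cG.
have mGc : measurable_fun `]g, pi[ (fun psi => G (cos psi) * sin psi).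
  apply: open_continuous_measurable_fun; first exact: interval_open.
  move=> x; rewrite inE /= in_itv /= => hx; apply: cvgM; last exact: continuous_sin.
  apply: continuous_comp; first exact: continuous_cos.
  apply: cG; rewrite -cospi !ltr_cos ?in_itv/=; lra.
have SF n : F n `<=` `](-1)%R, (cos g)%R[ by rewrite -UF; exact: bigcup_sup.
have SE n : E n `<=` `]g, pi[ by rewrite -UE; exact: bigcup_sup.
have key n : (\int[mu]_(x in F n) (G x)%:E =
    \int[mu]_(psi in E n) (G (cos psi) * sin psi)%R%:E)%E.
  have [b1 [b2 b3]] := bE n.
  have dc : derive1 (@cos R : R -> R^o) = (fun x : R => - sin x).
    by apply/funext => y; rewrite derive1E derive_val.
  rewrite /F (@integration_by_substitution_decreasing R (@cos R) G) //.
  - apply: eq_integral => psi _; congr EFin.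
    by rewrite dc; exact: (congr1 (fun y => G (cos psi) * y) (opprK (sin psi))).
  - by move=> x y; rewrite !in_itv /= => hx hy xy; rewrite ltr_cos ?in_itv/=; lra.
  - by move=> x _; rewrite dc; apply: cvgN; exact: continuous_sin.
  - rewrite dc.
    apply/cvg_ex; eexists; apply: cvgN; apply: cvg_at_right_filter; exact: continuous_sin.
  - rewrite dc.
    apply/cvg_ex; eexists; apply: cvgN; apply: cvg_at_left_filter; exact: continuous_sin.
  - split; first by move=> x _; exact: derivable_cos.
    + apply: cvg_at_right_filter; exact: continuous_cos.
    + apply: cvg_at_left_filter; exact: continuous_cos.
  - apply: (continuous_subspaceW (SF n)).
    apply: continuous_in_subspaceT => x; rewrite inE /= in_itv /=; exact: cG.
have h1 : (\int[mu]_(x in F n) (G x)%:E @[n --> \oo] -->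
    \int[mu]_(x in \bigcup_n F n) (G x)%:E)%E.
  apply: ge0_nondecreasing_set_cvg_integral.
  - apply/nondecreasing_seqP => n; rewrite subsetEset => x Fx.
    have hx := FI _ _ Fx; apply/FE => //; move/FE : Fx => /(_ hx).
    by have := dmono n n.+1 (leqnSn n); rewrite /E /= !in_itv /=; lra.
  - by move=> n; exact: measurable_itv.
  - by move=> n; apply/measurable_EFinP; exact: (measurable_funS _ (SF n) mG).
  - move=> n x /SF /=; rewrite in_itv /= lee_fin; exact: G0.
have h2 : (\int[mu]_(psi in E n) (G (cos psi) * sin psi)%R%:E @[n --> \oo] -->
    \int[mu]_(psi in \bigcup_n E n) (G (cos psi) * sin psi)%R%:E)%E.
  apply: ge0_nondecreasing_set_cvg_integral.
  - apply/nondecreasing_seqP => n; rewrite subsetEset => x.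
    by have := dmono n n.+1 (leqnSn n); rewrite /E /= !in_itv /=; lra.
  - by move=> n; exact: measurable_itv.
  - by move=> n; apply/measurable_EFinP; exact: (measurable_funS _ (SE n) mGc).
  - move=> n x /SE /=; rewrite in_itv /= => hx; rewrite lee_fin mulr_ge0//.
      by apply: G0; rewrite -cospi !ltr_cos ?in_itv/=; lra.
    by rewrite sin_ge0_pi//; lra.
rewrite -UE -UF; apply: (cvg_unique _ h1) => //.
by rewrite (funext key).
Qed.

End cosine_substitution.

(** * The mass of the far arc *)

Section far_mass.
Context {R : realType}.
Local Notation mu := (@lebesgue_measure R).
Local Notation I := (`[(- pi)%R, pi%R]%classic).
Variable c : R.
Hypothesis hc : -1 < c < 1.

Let hc' : -1 <= c <= 1.
Proof. by case/andP: hc => a b; rewrite !ltW. Qed.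

Definition hfar (al psi : R) : R := hre al c psi * (cos psi < c)%R%:R.

Definition far_mass (al : R) : R := (\int[mu]_(psi in I) hfar al psi) / (2 * pi).

Lemma hfar_ge0 (al psi : R) : 0 <= hfar al psi.
Proof. by rewrite mulr_ge0 ?sqrtr_ge0. Qed.

Lemma hfarN (al psi : R) : hfar al (- psi) = hfar al psi.
Proof. by rewrite /hfar /hre /ratio cosN. Qed.

Lemma measurable_hfar (al : R) (D : set R) : measurable_fun D (hfar al).
Proof.
apply: measurable_funM; first exact: measurable_hre.
rewrite (_ : (fun _ => _) = \1_[set psi : R | (cos psi < c)%R]); last first.
  apply/funext => psi; rewrite indicE; congr ((nat_of_bool _)%:R).
  by apply/idP/idP => [h|/set_mem//]; exact/mem_set.
apply: measurable_funTS; apply: measurable_indic.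
rewrite (_ : [set psi : R | _] = cos @^-1` `]-oo, c[).
  by rewrite -[X in measurable X]setTI; apply: continuous_measurable_fun => //; exact: continuous_cos.
by apply/seteqP; split => x; rewrite /= in_itv.
Qed.

Lemma hfar_le_hre (al psi : R) : hfar al psi <= hre al c psi.
Proof. by rewrite /hfar; case: (_ < _); rewrite ?mulr1 ?mulr0 ?sqrtr_ge0. Qed.

(** Continuity under the integral is applied on an open parameter interval containing [-1, 1]; ]-3,
    3[ is taken, where |cos psi - al| is still at most 4. *)
Lemma hfar_le (al psi : R) : -3 <= al <= 3 -> hfar al psi <= Num.sqrt 4 * dom c psi.
Proof.
move=> hal; apply: le_trans (hfar_le_hre _ _) _.
rewrite /hre /dom /ratio -sqrtrV// -sqrtrM//.
have cb := cos_geN1 psi; have ca := cos_le1 psi.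
apply: ler_wsqrtr; rewrite (le_trans (ler_norm _))// normrM normfV.
by rewrite ler_wpM2r ?invr_ge0// ler_norml; lra.
Qed.

Lemma integrable_hfar (al : R) : -3 <= al <= 3 -> mu.-integrable I (EFin \o hfar al).
Proof.
move=> hal.
have h : mu.-integrable I (fun psi => (Num.sqrt 4)%:E * (EFin \o dom c) psi)%E.
  by apply: integrableZl => //; exact: integrable_dom.
apply: le_integrable h => //.
  by apply: (measurableT_comp (@EFin_measurable R setT)); exact: measurable_hfar.
move=> psi _ /=; rewrite lee_fin ger0_norm ?hfar_ge0// (le_trans (hfar_le _ hal))//.
by rewrite ler_norm.
Qed.

Lemma hfar_itv (al psi : R) : 0 <= psi -> I psi ->
  hfar al psi = (hre al c \_ `]acos c, pi]) psi.
Proof.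
move=> p0; rewrite /= in_itv /= => /andP[_ ppi].
rewrite /hfar patchE.
have -> : (psi \in `]acos c, pi]%classic) = (cos psi < c).
  rewrite -[in RHS](acosK (_ : c \in `[-1, 1])) ?in_itv// ltr_cos ?in_itv/= ?acos_ge0 ?acos_lepi ?p0//.
  by apply/idP/idP => [/set_mem|h]; [|apply/mem_set]; rewrite /= in_itv /= ?ppi ?andbT.
by case: (_ < _); rewrite ?mulr1 ?mulr0.
Qed.

(** The integrand is even, so the full integral is twice the one over the upper half, where the far
    arc is ]acos c, pi]. *)
Lemma far_massE (al : R) : -1 <= al <= 1 ->
  (\int[mu]_(psi in `]acos c, pi[) (hre al c psi)%:E = (pi * far_mass al)%:E)%E.
Proof.
move=> hal; have p := @pi_gt0 R.
pose g := (EFin \o hfar al) \_ I.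
have g0 psi : (0 <= g psi)%E by apply: erestrict_ge0 => x _; rewrite lee_fin hfar_ge0.
have mg : measurable_fun setT g.
  by apply/(measurable_restrictT _ _).1 => //;
  apply: (measurableT_comp (@EFin_measurable R setT)); exact: measurable_hfar.
have gN psi : g (- psi) = g psi.
  rewrite /g !patchE /= hfarN; congr (if _ then _ else _).
  by apply/idP/idP => /set_mem; rewrite /= in_itv /= => h; apply/mem_set; rewrite /= in_itv /=; lra.
have e1 : (\int[mu]_(psi in I) (hfar al psi)%:E = \int[mu]_psi g psi)%E.
  by rewrite integral_mkcond.
have e2 : (\int[mu]_psi g psi = \int[mu]_(psi in `[0%R, +oo[) g psi + \int[mu]_(psi in `[0%R, +oo[) g psi)%E.
  rewrite {2}(ge0_integration_by_substitution0 mg g0).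
  under [X in (_ + X)%E]eq_integral do rewrite gN.
  rewrite -(integral_itv_bndo_bndc); last exact: measurable_funTS.
  rewrite -ge0_integral_setU//=.
  - congr integral; rewrite -setCitvl setUC.
    by rewrite setUC -setCitvr setvU.
  - exact: measurable_funTS.
  - by apply/disj_setPS => x [] /=; rewrite !in_itv /= => h1 h2; lra.
have e3 : (\int[mu]_(psi in `[0%R, +oo[) g psi = \int[mu]_(psi in `]acos c, pi[) (hre al c psi)%:E)%E.
  have a0 := acos_ge0 hc'; have a1 := acos_lepi hc'.
  rewrite -(@integral_itv_bndoo _ _ _ _ false false); last first.
    by apply: (measurableT_comp (@EFin_measurable R setT)); exact: measurable_hre.
  rewrite integral_mkcond [RHS]integral_mkcond; apply: eq_integral => psi _.
  rewrite patchE [RHS]patchE; case: ifPn => [/set_mem|].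
    rewrite /= in_itv /= andbT => p0; rewrite /g patchE.
    case: ifPn => [/set_mem Ip|]; last first.
      move=> /negP nI; rewrite memNset// => /=; rewrite in_itv /= => h.
      by apply: nI; apply/mem_set; rewrite /= in_itv /=; lra.
    by rewrite /= hfar_itv// patchE; case: ifP.
  move=> /negP n0; rewrite memNset// => /=; rewrite in_itv /= => h.
  by apply: n0; apply/mem_set; rewrite /= in_itv /=; lra.
have : (\int[mu]_(psi in I) (hfar al psi)%:E = (2 * pi * far_mass al)%:E)%E.
  rewrite /far_mass mulrC divfK ?mulf_neq0 ?pnatr_eq0 ?gt_eqF// /Rintegral fineK//.
  by apply: integrable_fin_num => //; apply: integrable_hfar; lra.
rewrite e1 e2 e3; set X := (\int[_]_(_ in _) _)%E.
have : (0 <= X)%E by apply: integral_ge0 => x _; rewrite lee_fin sqrtr_ge0.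
(* X is an extended real known only through X + X; the sum being finite, X is finite and can be
   halved. *)
by case: X => [x||]//= _ [h]; congr EFin; lra.
Qed.


Lemma far_mass_N1 : far_mass (-1) = 0.
Proof.
rewrite /far_mass (_ : \int[mu]_(psi in I) hfar (-1) psi = 0) ?mul0r//.
rewrite (@eq_Rintegral _ _ _ mu _ (cst 0)); first by rewrite Rintegral_cst//= mul0r.
move=> psi _; rewrite /hfar /hre /ratio /cst; case: ltP => [l|]; last by rewrite mulr0.
rewrite mulr1 ler0_sqrtr// opprK nmulr_lle0 ?invr_lt0 ?subr_lt0//; have := cos_geN1 psi; lra.
Qed.

Lemma far_mass_1 : far_mass 1 = 1.
Proof.
have p := @pi_gt0 R.
have h1 : -1 <= (1 : R) <= 1 by lra.
rewrite /far_mass (_ : \int[mu]_(psi in I) hfar 1 psi = 2 * pi).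
  by rewrite divff// mulf_neq0 ?pnatr_eq0 ?gt_eqF.
rewrite -(integral_hre h1 hc); apply: eq_Rintegral => psi _.
rewrite /hfar; case: ltP => [l|l]; first by rewrite mulr1.
rewrite mulr0 /hre /ratio ler0_sqrtr// mulr_le0_ge0 ?invr_ge0 ?subr_ge0//; have := cos_le1 psi; lra.
Qed.

Lemma continuous_far_mass : {within `[-1, 1], continuous far_mass}.
Proof.
apply: continuous_in_subspaceT => a; rewrite inE /= in_itv /= => ha.
apply: cvgM; last exact: cvg_cst.
apply: (@continuity_under_integral R _ _ mu hfar I _ (-3) 3 _ _
  (fun psi => Num.sqrt 4 * dom c psi)) => //.
- by move=> x; rewrite /= in_itv /= => hx; apply: integrable_hfar; lra.
- apply: aeW => psi _ x _; apply: cvgM; last exact: cvg_cst.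
  apply: (@continuous_comp _ _ _ (ratio ^~ c ^~ psi) Num.sqrt); last exact: sqrt_continuous.
  by apply: cvgM; [apply: cvgB; [exact: cvg_cst|exact: cvg_id]|exact: cvg_cst].
- have h : mu.-integrable I (fun psi => (Num.sqrt 4)%:E * (EFin \o dom c) psi)%E.
    by apply: integrableZl => //; exact: integrable_dom.
  by apply: eq_integrable h.
- move=> x; rewrite /= in_itv /= => hx; apply: aeW => psi _.
  by rewrite ger0_norm ?hfar_ge0// hfar_le//; lra.
- by rewrite inE /= in_itv /=; lra.
Qed.

Lemma hfar_mono (al al' psi : R) : al <= al' -> hfar al psi <= hfar al' psi.
Proof.
move=> h; rewrite /hfar; case: ltP => [l|]; last by rewrite !mulr0.
rewrite !mulr1 ler_wsqrtr// /ratio ler_wnM2r ?invr_le0 ?subr_le0 ?(ltW l)//.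
by rewrite lerD2l lerN2.
Qed.

(** The integrands are ordered, so equal integrals would force them to agree almost everywhere; they
    differ on an interval of positive length. *)
Lemma far_mass_lt (al al' : R) : -1 <= al -> al < al' -> al' <= 1 ->
  far_mass al < far_mass al'.
Proof.
move=> a1 a2 a3; have p := @pi_gt0 R.
have i1 : mu.-integrable I (EFin \o hfar al) by apply: integrable_hfar; lra.
have i2 : mu.-integrable I (EFin \o hfar al') by apply: integrable_hfar; lra.
rewrite ltr_pM2r ?invr_gt0 ?mulr_gt0//.
rewrite lt_neqAle andbC le_Rintegral//=; last by move=> psi _; apply: hfar_mono; exact: ltW.
apply/eqP => e.
pose df psi := hfar al' psi - hfar al psi.
have df0 psi : 0 <= df psi by rewrite subr_ge0 hfar_mono// ltW.
have e0 : (\int[mu]_(psi in I) `|(EFin \o df) psi| = 0)%E.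
  have h : \int[mu]_(psi in I) df psi = 0 by rewrite RintegralB//= e subrr.
  have -> : (\int[mu]_(psi in I) `|(EFin \o df) psi| = \int[mu]_(psi in I) (df psi)%:E)%E.
    by apply: eq_integral => psi _ /=; rewrite ger0_norm.
  rewrite -[LHS]fineK; first by congr EFin; exact: h.
  apply: integrable_fin_num => //.
  have : mu.-integrable I ((EFin \o hfar al') \- (EFin \o hfar al))%E by apply: integrableB.
  exact: eq_integrable.
have m0 : measurable_fun I (EFin \o df).
  apply: (measurableT_comp (@EFin_measurable R setT)).
  by apply: measurable_funB; exact: measurable_hfar.
have := (ae_eq_integral_abs mu (measurable_itv _) m0).1 e0.
(* Below b a point is in the far arc and [hre al' c] is positive there, so the comparison of the
   square roots is strict. *)
pose b := Num.min al' c.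
have hb : -1 < b < 1.
  case/andP: hc => c1 c2; rewrite /b lt_min gt_min c1 c2 orbT andbT /=.
  by rewrite (le_lt_trans a1 a2).
have hb' : -1 <= b <= 1 by lra.
have g0 := acos_ge0 hb'.
have gp : acos b < pi by rewrite acos_ltpi; lra.
case=> N [mN N0 sub].
have : (mu `]acos b, pi[ <= mu N)%E.
  apply: le_measure; rewrite ?inE//.
  move=> psi; rewrite /= in_itv /= => hp; apply: sub => /=; apply/not_implyP; split.
    by rewrite /= in_itv /=; lra.
  have cb : cos psi < b.
    by rewrite -(acosK (_ : b \in `[-1, 1])) ?in_itv// ltr_cos ?in_itv/=; lra.
  move: cb; rewrite /b lt_min => /andP[cb1 cb2].
  move=> [] /eqP; rewrite /df subr_eq0 /hfar cb2 !mulr1 => /eqP; apply/eqP.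
  rewrite gt_eqF// /hre ltr_sqrt /ratio.
    by rewrite ltr_nM2r ?invr_lt0 ?subr_lt0// ltrD2l ltrN2.
  by rewrite -mulrNN -invrN divr_gt0// oppr_gt0 subr_lt0.
rewrite N0 lebesgue_measure_itv /= lte_fin gp -EFinB lee_fin; lra.
Qed.

Lemma far_mass_inj (al al' : R) : -1 <= al <= 1 -> -1 <= al' <= 1 ->
  far_mass al = far_mass al' -> al = al'.
Proof.
move=> /andP[a1 a2] /andP[b1 b2] e.
have [l|l|//] := ltrgtP al al'.
- by have := far_mass_lt a1 l b2; rewrite e ltxx.
- by have := far_mass_lt b1 l a2; rewrite e ltxx.
Qed.

Lemma far_mass_surj (v : R) : 0 <= v <= 1 -> exists2 al, -1 <= al <= 1 & far_mass al = v.
Proof.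
move=> hv.
have h1 : -1 <= (1 : R) by lra.
have [|al] := IVT h1 continuous_far_mass (_ : Num.min _ _ <= v <= Num.max _ _).
  by rewrite far_mass_N1 far_mass_1 minEle maxEle ler01.
by rewrite in_itv /= => hal e; exists al.
Qed.

End far_mass.

(** * The two integral equations for alpha as one mass condition *)

Section mass_integral.
Context {R : realType}.
Local Notation mu := (@lebesgue_measure R).
Variables (theta al : R).
Hypotheses (htheta : 0 < theta < 2 * pi) (hal : -1 <= al <= 1).
Local Notation c := (cos (theta / 2)).

Lemma half_itv : 0 < theta / 2 < pi.
Proof. by case/andP: htheta => a b; apply/andP; split; lra. Qed.

Lemma cos_half_itv : -1 < c < 1.
Proof.
have := half_itv; have p := @pi_gt0 R => h.
have a1 : cos pi < c by rewrite ltr_cos ?in_itv/=; lra.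
have a2 : c < cos 0 by rewrite ltr_cos ?in_itv/=; lra.
by rewrite cospi in a1; rewrite cos0 in a2; rewrite a1.
Qed.

Lemma acos_cos_half : acos c = theta / 2.
Proof. by have := half_itv => h; rewrite cosK// in_itv /=; lra. Qed.

Lemma sqrt_norm_ratio (psi : R) : 0 <= ratio al c psi ->
  hre al c psi = Num.sqrt `|cos psi - al| / Num.sqrt `|cos psi - c|.
Proof.
move=> h; rewrite /hre -(ger0_norm h) /ratio normrM normfV sqrtrM// sqrtrV//.
Qed.

Lemma density_hre (psi : R) : 0 <= ratio al c psi ->
  density theta al psi = hre al c psi / (2 * pi).
Proof.
by move=> h; rewrite /density sqrt_norm_ratio// invfM mulrCA mulrC.
Qed.

(** The upper limit is [alpha] in case (i) and [cos (theta / 2)] in case (ii), in both cases the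
    minimum. Under x = cos psi the factor sqrt |(x + 1)(x - 1)| becomes sin psi and cancels the
    Jacobian, leaving [hre / pi]. *)
Lemma mass_integralE :
  mass_integral theta al (Num.min al c) = (far_mass c al)%:E.
Proof.
have hc := cos_half_itv; have p := @pi_gt0 R.
set b := Num.min al c.
have hb : -1 <= b < 1.
  case/andP: hc => c1 c2; rewrite /b le_min gt_min c2 orbT andbT (ltW c1) andbT.
  by case/andP: hal.
(* For b = -1 the interval is a point and the substitution has no room; then al = -1 and both sides
   are 0. *)
have [b1|b1] := eqVneq b (-1).
  have -> : al = -1.
    by move: b1; rewrite /b minEle; case: ifP => // _ e; move: hc; rewrite e ltxx.
  by rewrite b1 /mass_integral set_itv1 integral_set1 far_mass_N1.
have hb' : -1 <= b <= 1 by lra.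
have hg : 0 <= acos b < pi.
  by rewrite acos_ge0//= acos_ltpi//; rewrite lt_neqAle eq_sym b1; lra.
pose G x := Num.sqrt `|x - al| / (pi * Num.sqrt `|(x + 1) * (x - c) * (x - 1)|).
have mG : measurable_fun `](-1), b[ (EFin \o G).
  apply: (measurableT_comp (@EFin_measurable R setT)).
  have m1 (y : R) : measurable_fun `](-1), b[ (fun x => x - y) by apply: measurable_funB.
  apply: measurable_funM.
    by apply: measurable_funsqrt; apply: measurableT_comp => //; exact: m1.
  apply: measurable_funV; apply: measurable_funM => //.
  apply: measurable_funsqrt; apply: measurableT_comp => //.
  apply: measurable_funM; last exact: m1.
  by apply: measurable_funM; [apply: measurable_funD|exact: m1].
have eb : cos (acos b) = b by rewrite acosK// in_itv.
rewrite /mass_integral integral_itv_bndoo//.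
transitivity (\int[mu]_(x in `](-1)%R, (cos (acos b))%R[) (G x)%:E)%E; first by rewrite eb.
rewrite (@integral_cos_substitution _ G)//; first last.
- by move=> x _; rewrite divr_ge0 ?sqrtr_ge0// mulr_ge0 ?sqrtr_ge0// ltW.
- move=> x; rewrite eb => hx.
  have xb : x < c by move: hx; rewrite /b lt_min; lra.
  have cn (y : R) : {for x, continuous (fun x => x - y)}.
    by apply: cvgB; [exact: cvg_id|exact: cvg_cst].
  have cs (f : R -> R) : {for x, continuous f} ->
      {for x, continuous (fun x => Num.sqrt `|f x|)}.
    move=> cf; apply: (@continuous_comp _ _ _ (fun x => `|f x|) Num.sqrt).
      by apply: continuous_comp; [exact: cf|exact: norm_continuous].
    exact: sqrt_continuous.
  apply: cvgM; first exact: (cs _ (cn al)).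
  apply: cvgV.
    rewrite mulf_neq0 ?gt_eqF// sqrtr_gt0 normr_gt0 !mulf_neq0//; lra.
  apply: cvgM; first exact: cvg_cst.
  apply: (cs (fun x => (x + 1) * (x - c) * (x - 1))).
  apply: cvgM; last exact: cn.
  apply: cvgM; last exact: cn.
  by apply: cvgD; [exact: cvg_id|exact: cvg_cst].
have e1 : (\int[mu]_(psi in `]acos b, pi[) (G (cos psi) * sin psi)%R%:E =
    \int[mu]_(psi in `]acos b, pi[) ((pi^-1)%:E * (hre al c psi)%:E))%E.
  apply: eq_integral => psi; rewrite inE /= in_itv /= => hp.
  have cb : cos psi < b.
    by rewrite -(acosK (_ : b \in `[-1, 1])) ?in_itv// ltr_cos ?in_itv/=; lra.
  move: cb; rewrite /b lt_min => /andP[cb1 cb2].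
  have r0 : 0 <= ratio al c psi.
    by rewrite /ratio -mulrNN -invrN divr_ge0// oppr_ge0 subr_le0 ltW.
  rewrite -EFinM sqrt_norm_ratio//; congr EFin; rewrite /G.
  have s0 : 0 < sin psi by rewrite sin_gt0_pi//; lra.
  have -> : (cos psi + 1) * (cos psi - c) * (cos psi - 1) =
      - (sin psi ^+ 2) * (cos psi - c) by rewrite sin2cos2; ring.
  rewrite normrM sqrtrM// normrN normrX (gtr0_norm s0) sqrtr_sqr (gtr0_norm s0).
  have q0 : Num.sqrt `|cos psi - c| != 0.
    by rewrite gt_eqF// sqrtr_gt0 normr_gt0 subr_eq0 lt_eqF.
  have p0 : (pi : R) != 0 by rewrite gt_eqF.
  move: (pi : R) (sin psi) p0 s0 => P s P0 s0.
  by field; rewrite P0 q0 gt_eqF.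
rewrite e1 ge0_integralZl//; last 3 first.
- by apply: (measurableT_comp (@EFin_measurable R setT)); exact: measurable_hre.
- by move=> psi _; rewrite lee_fin sqrtr_ge0.
- by rewrite lee_fin invr_ge0 ltW.
(* If al < c the far arc also contains the gap between al and c, where the ratio is nonpositive and
   [hre] is 0; adding it changes nothing. *)
have -> : (\int[mu]_(psi in `]acos b, pi[) (hre al c psi)%:E =
    \int[mu]_(psi in `]acos c, pi[) (hre al c psi)%:E)%E.
  have hc' : -1 <= c <= 1 by lra.
  rewrite integral_mkcond [RHS]integral_mkcond; apply: eq_integral => psi _.
  rewrite patchE [RHS]patchE; have [h|h] := boolP (psi \in `]acos c, pi[%classic).
    case: ifPn => // /negP nb; congr EFin; apply/esym.
    move: h => /set_mem; rewrite /= in_itv /= => h.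
    have g0 := acos_ge0 hc'.
    have cc : cos psi < c.
      by rewrite -[X in _ < X](acosK (_ : c \in `[-1, 1])) ?in_itv// ltr_cos ?in_itv/=; lra.
    rewrite /hre ler0_sqrtr// /ratio mulr_ge0_le0 ?invr_le0 ?subr_le0 ?(ltW cc)// subr_ge0.
    rewrite leNgt; apply/negP => ca; apply: nb; apply/mem_set; rewrite /= in_itv /=.
    have cpb : cos psi < b by rewrite /b lt_min ca cc.
    have : acos b < psi.
      by rewrite -ltr_cos ?in_itv/= ?eb//; have := acos_ge0 hb'; have := acos_lepi hb'; lra.
    lra.
  rewrite memNset// => /=; rewrite in_itv /= => hp.
  move: h => /negP; apply; apply/mem_set; rewrite /= in_itv /=.
  have g0 := acos_ge0 hb'; have k0 := acos_ge0 hc'; have k1 := acos_lepi hc'.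
  have : cos psi < b by rewrite -eb ltr_cos ?in_itv/=; lra.
  rewrite /b lt_min => /andP[_ cc].
  have : acos c < psi.
    by rewrite -ltr_cos ?in_itv/= ?acosK ?in_itv//; lra.
  lra.
rewrite (far_massE hc hal) -EFinM mulrA mulVf ?mul1r// gt_eqF//.
Qed.

End mass_integral.

(** * Push-forward of a measure with density *)

Section image_of_density.
Context d1 d2 (X : measurableType d1) (T : measurableType d2) (R : realType).
Variables (la : {measure set X -> \bar R}) (e : X -> T) (J : set X) (w : X -> R).
Hypotheses (me : measurable_fun setT e) (mJ : measurable J)
  (mw : measurable_fun setT w) (w0 : forall x, 0 <= w x).

Definition image_density (B : set T) : \bar R :=
  (\int[la]_(x in J `&` e @^-1` B) (w x)%:E)%E.

Let mpre B : measurable B -> measurable (J `&` e @^-1` B).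
Proof. by move=> mB; apply: measurableI => //; rewrite -[X in measurable X]setTI; exact: me. Qed.

Let id0 : image_density set0 = 0%E.
Proof. by rewrite /image_density preimage_set0 setI0 integral_set0. Qed.

Let id_ge0 B : (0 <= image_density B)%E.
Proof. by apply: integral_ge0 => x _; rewrite lee_fin. Qed.

Let id_sigma_additive : semi_sigma_additive image_density.
Proof.
move=> /= A mA tA mUA.
have e1 : image_density (\bigcup_n A n) = (\sum_(i <oo) image_density (A i))%E.
  rewrite /image_density preimage_bigcup setI_bigcupr ge0_integral_bigcup//.
  - by move=> k; exact: mpre.
  - by apply: measurable_funTS; exact/measurable_EFinP.
  - by move=> x _; rewrite lee_fin.
  - apply/trivIsetP => i j _ _ ij; apply/seteqP; split => x //= [[_ Ai] [_ Aj]].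
    by have /trivIsetP/(_ i j I I ij) := tA; move/seteqP => [/(_ (e x)) h _]; apply: h.
rewrite e1; apply: is_cvg_ereal_nneg_natsum_cond => n _ _.
by apply: integral_ge0 => /= x ?; rewrite lee_fin.
Qed.

Lemma image_density_measure : exists m : {measure set T -> \bar R},
  forall B, m B = image_density B.
Proof.
pose mx := isMeasure.Build _ _ _ image_density id0 id_ge0 id_sigma_additive.
pose m : {measure set T -> \bar R} := HB.pack image_density mx.
by exists m.
Qed.

Import HBNNSimple.

(** For indicators this is the definition of the image; simple functions follow by additivity and
    nonnegative f by monotone convergence on both sides. *)
Lemma integral_image_density (m : {measure set T -> \bar R}) (f : T -> \bar R) :
  (forall B, measurable B -> m B = image_density B) ->
  measurable_fun setT f -> (forall y, 0 <= f y)%E ->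
  (\int[m]_y f y = \int[la]_(x in J) (f (e x) * (w x)%:E))%E.
Proof.
move=> hm mf f0; pose h := nnsfun_approx measurableT mf.
have fE y : f y = lim ((EFin \o h n) y @[n --> \oo]).
  by apply/esym/cvg_lim => //; apply: cvg_nnsfun_approx.
have mhe n : measurable_fun J (fun x => h n (e x)).
  apply: measurable_funTS; apply: measurableT_comp => //.
have -> : (\int[m]_y f y = lim (\int[m]_y (EFin \o h n) y @[n --> \oo]))%E.
  under eq_integral do rewrite fE.
  apply: monotone_convergence => //.
  - by move=> n; apply/measurable_EFinP; exact/measurable_funP.
  - by move=> n y _ /=; rewrite lee_fin.
  - by move=> y _ a b ab; rewrite lee_fin; exact/lefP/nd_nnsfun_approx.
have -> : (\int[la]_(x in J) (f (e x) * (w x)%:E) =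
    lim (\int[la]_(x in J) (h n (e x) * w x)%:E @[n --> \oo]))%E.
  have fg x : (f (e x) * (w x)%:E = lim ((h n (e x) * w x)%:E @[n --> \oo]))%E.
    apply/esym/cvg_lim => //.
    under eq_fun do rewrite EFinM.
    by apply: cvgeZr => //; apply: cvg_nnsfun_approx.
  under eq_integral do rewrite fg.
  apply: monotone_convergence => //.
  - by move=> n; apply/measurable_EFinP; apply: measurable_funM => //; exact: measurable_funTS.
  - by move=> n x _; rewrite lee_fin mulr_ge0.
  - move=> x _ a b ab; rewrite lee_fin ler_wpM2r//; exact/lefP/nd_nnsfun_approx.
congr (lim (_ @ \oo)); apply/funext => n.
rewrite integralT_nnsfun sintegralE.
transitivity (\int[la]_(x in J) (\sum_(k \in range (h n))
    ((k * \1_(h n @^-1` [set k]) (e x))%:E * (w x)%:E)))%E; last first.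
  apply: eq_integral => x _; rewrite -ge0_mule_fsuml; last first.
    by move=> k; exact: nnfun_muleindic_ge0.
  by rewrite fsumEFin// -(fimfunE _ (e x)) EFinM.
have m1 k : measurable_fun J (fun x => \1_(h n @^-1` [set k]) (e x) : R).
  apply: measurable_funTS; apply: (measurableT_comp _ me).
  exact: measurable_indic.
have mi k : measurable_fun J (fun x => \1_(h n @^-1` [set k]) (e x) * w x : R).
  by apply: measurable_funM => //; exact: measurable_funTS.
rewrite ge0_integral_fsum//; first last.
- by move=> k x _; rewrite mule_ge0 ?lee_fin//; exact: nnfun_muleindic_ge0.
- move=> k; apply: emeasurable_funM; apply/measurable_EFinP.
    by apply: measurable_funM.
  exact: measurable_funTS.
apply: eq_fsbigr => k kh.
have k0 : 0 <= k by move: kh => /set_mem[y _ <-].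
under [RHS]eq_integral do rewrite -EFinM -mulrA EFinM.
rewrite ge0_integralZl//; first congr (_ * _)%E.
- rewrite hm// /image_density integral_mkcondr; apply: eq_integral => x _.
  rewrite patchE indicE /=.
  have -> : (x \in e @^-1` (h n @^-1` [set k])) = (e x \in h n @^-1` [set k]).
    by apply/idP/idP => /set_mem hx; exact/mem_set.
  by case: (_ \in _); rewrite ?mul1r ?mul0r.
- exact/measurable_EFinP.
- by move=> x _; rewrite lee_fin mulr_ge0.
Qed.

End image_of_density.

Lemma cvg_ge_lim {R : realType} (u : nat -> R) (a l : R) :
  u @ \oo --> l -> (forall n, a <= u n) -> a <= l.
Proof.
move=> h H; rewrite -(cvg_lim (@Rhausdorff R) h).
by apply: limr_ge; [exact: cvgP h|exact: nearW].
Qed.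

Lemma cvg_le_lim {R : realType} (u : nat -> R) (a l : R) :
  u @ \oo --> l -> (forall n, u n <= a) -> l <= a.
Proof.
move=> h H; rewrite -(cvg_lim (@Rhausdorff R) h).
by apply: limr_le; [exact: cvgP h|exact: nearW].
Qed.

(** * Means of bounded measurable functions *)

Section bounded_functions.
Context d (T : measurableType d) (R : realType).
Implicit Types (f g : T -> R) (P : probability T R).

(** Such functions are integrable for every probability, so their means can be computed as real
    numbers. *)
Definition bnd f := measurable_fun setT f /\ exists K, forall z, `|f z| <= K.

Lemma bnd_cst (k : R) : bnd (fun=> k).
Proof. by split => //; exists `|k|. Qed.

Lemma bndD f g : bnd f -> bnd g -> bnd (fun z => f z + g z).
Proof.
move=> [mf [K hK]] [mg [J hJ]]; split; first exact: measurable_funD.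
by exists (K + J) => z; rewrite (le_trans (ler_normD _ _))// lerD.
Qed.

Lemma bndM f g : bnd f -> bnd g -> bnd (fun z => f z * g z).
Proof.
move=> [mf [K hK]] [mg [J hJ]]; split; first exact: measurable_funM.
by exists (K * J) => z; rewrite normrM ler_pM.
Qed.

Lemma bndX f n : bnd f -> bnd (fun z => f z ^+ n).
Proof.
move=> bf; elim: n => [|n IH]; first by under eq_fun do rewrite expr0; exact: bnd_cst.
by under eq_fun do rewrite exprS; exact: bndM.
Qed.

Lemma bnd_sum n (F : 'I_n -> T -> R) : (forall i, bnd (F i)) ->
  bnd (fun z => \sum_(i < n) F i z).
Proof.
elim: n F => [|n IH] F hF.
  by under eq_fun do rewrite big_ord0; exact: bnd_cst.
under eq_fun do rewrite big_ord_recr /=.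
by apply: bndD => //; apply: IH => i.
Qed.

Lemma bnd_integrable P f : bnd f -> P.-integrable setT (EFin \o f).
Proof.
move=> [mf [K hK]]; apply: (@le_integrable _ _ _ P setT measurableT _ (cst K%:E)).
- exact/measurable_EFinP.
- by move=> z _ /=; rewrite lee_fin (le_trans (hK z))// ler_norm.
- exact: finite_measure_integrable_cst.
Qed.

Definition mean P f : R := \int[P]_z f z.

Lemma mean_cst P (k : R) : mean P (fun=> k) = k.
Proof.
rewrite /mean Rintegral_cst//.
by have := probability_setT P => /= h; rewrite -[RHS]mulr1; congr (_ * _); rewrite [X in fine X]h.
Qed.

Lemma meanD P f g : bnd f -> bnd g -> mean P (fun z => f z + g z) = mean P f + mean P g.
Proof. by move=> bf bg; apply: RintegralD => //; exact: bnd_integrable. Qed.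

Lemma meanZ P (k : R) f : bnd f -> mean P (fun z => k * f z) = k * mean P f.
Proof. by move=> bf; apply: RintegralZl => //; exact: bnd_integrable. Qed.

Lemma mean_sum P n (F : 'I_n -> T -> R) : (forall i, bnd (F i)) ->
  mean P (fun z => \sum_(i < n) F i z) = \sum_(i < n) mean P (F i).
Proof.
elim: n F => [|n IH] F hF.
  by under eq_fun do rewrite big_ord0; rewrite big_ord0 mean_cst.
under eq_fun do rewrite big_ord_recr /=.
rewrite big_ord_recr /= meanD//; last by apply: bnd_sum.
by congr (_ + _); apply: IH => i.
Qed.

Lemma mean_le P f g : bnd f -> bnd g -> (forall z, f z <= g z) -> mean P f <= mean P g.
Proof.
move=> bf bg h; apply: le_Rintegral => //; exact: bnd_integrable.
Qed.

Lemma mean_cvg P (f : nat -> T -> R) g (K : R) : (forall n, bnd (f n)) ->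
  measurable_fun setT g -> (forall n z, `|f n z| <= K) ->
  (forall z, f n z @[n --> \oo] --> g z) -> mean P (f n) @[n --> \oo] --> mean P g.
Proof.
move=> bf mg hK fg; apply: (@cvg_Rintegral _ _ R P setT f g (cst K)) => //.
- by move=> n; case: (bf n).
- exact: finite_measure_integrable_cst.
Qed.

Lemma bnd_lim (f : nat -> T -> R) g (K : R) : (forall n, bnd (f n)) ->
  (forall n z, `|f n z| <= K) ->
  (forall z, f n z @[n --> \oo] --> g z) -> bnd g.
Proof.
move=> bf hK fg; split.
  apply: (measurable_fun_cvg (h := f)) => [n|z _]; last exact: fg.
  by case: (bf n).
exists K => z; rewrite ler_norml; apply/andP; split.
- by apply: (cvg_ge_lim (fg z)) => n; have := hK n z; rewrite ler_norml => /andP[].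
- by apply: (cvg_le_lim (fg z)) => n; have := hK n z; rewrite ler_norml => /andP[].
Qed.

Lemma mean_norm_le P f (K : R) : bnd f -> (forall z, `|f z| <= K) -> `|mean P f| <= K.
Proof.
move=> bf hK; rewrite ler_norml; apply/andP; split.
- rewrite -[X in X <= _](mean_cst P); apply: mean_le => //; first exact: bnd_cst.
  by move=> z; have := hK z; rewrite ler_norml => /andP[].
- rewrite -[X in _ <= X](mean_cst P); apply: mean_le => //; first exact: bnd_cst.
  by move=> z; have := hK z; rewrite ler_norml => /andP[].
Qed.

End bounded_functions.

(** * The power series of - ln (1 - x) with a uniform error bound *)

Section log_series.
Context {R : realType}.

Definition logsum (N : nat) (x : R) : R := \sum_(m < N) x ^+ m.+1 / m.+1%:R.

Lemma derXn n (x : R) : is_derive x 1 (fun y : R => y ^+ n.+1) (n.+1%:R * x ^+ n).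
Proof.
elim: n => [|n IH].
  under eq_fun do rewrite expr1.
  by rewrite expr0 mulr1; exact: is_derive_id.
under eq_fun do rewrite exprS.
apply: is_derive_eq (derM (is_derive_id x 1) IH) _.
by rewrite mul1r -[in RHS]natr1 mulrDl mul1r exprS mulrCA.
Qed.

Lemma is_derive_logsum N (x : R) :
  is_derive x 1 (logsum N) (\sum_(m < N) x ^+ m).
Proof.
elim: N => [|N IH].
  rewrite (_ : logsum 0 = cst 0); last by apply/funext => y; rewrite /logsum big_ord0.
  by rewrite big_ord0; exact: is_derive_cst.
have -> : logsum N.+1 = (fun y => logsum N y + y ^+ N.+1 * N.+1%:R^-1).
  by apply/funext => y; rewrite /logsum big_ord_recr.
rewrite big_ord_recr /=; apply: (derD IH).
apply: is_derive_eq (derM (derXn N x) (is_derive_cst (N.+1%:R^-1 : R) x 1)) _.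
by rewrite /cst /= mulr0 add0r mulrAC divff ?mul1r// pnatr_eq0.
Qed.

(** The error vanishes at 0 and, by the geometric sum, has derivative y^N / (1 - y), which is at
    most p^N / (1 - p) in absolute value. The mean value theorem concludes. *)
Lemma logsum_err N (x p : R) : `|x| <= p -> p < 1 ->
  `|- ln (1 - x) - logsum N x| <= p ^+ N / (1 - p).
Proof.
move=> xp p1.
have p0 : 0 <= p by rewrite (le_trans _ xp).
pose F (y : R) := - ln (1 - y) - logsum N y.
pose f (y : R) := (1 - y)^-1 - \sum_(m < N) y ^+ m.
have dF (y : R) : `|y| <= p -> is_derive y 1 F (f y).
  move=> yp; have y1 : 0 < 1 - y by have := ler_norm y; lra.
  have d1 := derD (is_derive_cst (1 : R) y 1) (derN (is_derive_id y 1)).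
  have d2 := derN (der_comp d1 (is_derive1_ln y1)).
  apply: is_derive_eq (derD d2 (derN (is_derive_logsum N y))) _.
  by rewrite /f /cst /=; ring.
have fE (y : R) : `|y| <= p -> f y = y ^+ N / (1 - y).
  move=> yp; have y1 : 1 - y != 0 by rewrite gt_eqF//; have := ler_norm y; lra.
  have : (1 - y) * \sum_(m < N) y ^+ m = 1 - y ^+ N.
    by rewrite -[in RHS](expr1n _ N) subrXX; congr (_ * _); apply: eq_bigr => m _; rewrite expr1n mul1r.
  rewrite /f => e; apply: (mulfI y1); rewrite mulrBr divff// e mulrCA divff// mulr1.
  by ring.
have fb (y : R) : `|y| <= p -> `|f y| <= p ^+ N / (1 - p).
  move=> yp; rewrite fE// normrM normrX normfV.
  have y1 : 0 < 1 - p by rewrite subr_gt0.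
  have : 1 - p <= `|1 - y| by rewrite ger0_norm; have := ler_norm y; lra.
  move=> h; rewrite ler_pM ?exprn_ge0 ?invr_ge0//; first by rewrite lerXn2r ?nnegrE.
  by rewrite lef_pV2 ?posrE// (lt_le_trans y1).
have F0 : F 0 = 0.
  rewrite /F subr0 ln1 oppr0 sub0r /logsum big1 ?oppr0// => m _.
  by rewrite expr0n mul0r.
have key (y : R) : `|y| <= p -> exists2 z, `|z| <= p & `|F y| = `|f z| * `|y|.
  move=> yp; have [l|l|e] := ltrgtP y 0.
  - have [||z hz e] := @MVT _ F f y 0 l.
    + by move=> z; rewrite in_itv /= => hz; apply: dF; move: yp; rewrite !ler_norml; lra.
    + apply: derivable_within_continuous => z; rewrite in_itv /= => hz.
      have zp : `|z| <= p by move: yp; rewrite !ler_norml; lra.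
      by case: (dF z zp).
    exists z; first by move: hz yp; rewrite in_itv /= !ler_norml; lra.
    move: e; rewrite F0 !sub0r => /(congr1 (fun u => `|u|)); rewrite normrN normrM normrN => ->.
    by [].
  - have [||z hz e] := @MVT _ F f 0 y l.
    + by move=> z; rewrite in_itv /= => hz; apply: dF; move: yp; rewrite !ler_norml; lra.
    + apply: derivable_within_continuous => z; rewrite in_itv /= => hz.
      have zp : `|z| <= p by move: yp; rewrite !ler_norml; lra.
      by case: (dF z zp).
    exists z; first by move: hz yp; rewrite in_itv /= !ler_norml; lra.
    by move: e; rewrite F0 !subr0 => ->; rewrite normrM.
  - by exists 0; rewrite ?normr0// e F0 normr0 mulr0.
have [z zp ->] := key _ xp.
have b0 : 0 <= p ^+ N / (1 - p) by rewrite divr_ge0 ?exprn_ge0// subr_ge0 ltW.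
by rewrite (le_trans (ler_pM _ _ (fb _ zp) (le_trans xp (ltW p1))))// mulr1.
Qed.

Lemma cvg_logsum (x : R) : `|x| < 1 -> logsum N x @[N --> \oo] --> - ln (1 - x).
Proof.
move=> x1; apply/cvgrPdist_le => e e0.
have h : (fun N => `|x| ^+ N / (1 - `|x|)) @ \oo --> (0 : R).
  rewrite -[X in _ --> X](mul0r (1 - `|x|)^-1); apply: cvgM; last exact: cvg_cst.
  by apply: cvg_expr; rewrite normr_id.
move/cvgrPdist_le : h => /(_ _ e0)[M _ hM]; exists M => // N MN /=.
rewrite (le_trans (logsum_err N (lexx _) x1))//.
by have := hM N MN; rewrite /= sub0r normrN; exact: le_trans (ler_norm _).
Qed.

End log_series.

(** * Positive definite kernels and moments *)

Section positive_definite.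
Context d (T : measurableType d) (R : realType).
Variables (x y : T -> R).
Hypotheses (mx : measurable_fun setT x) (my : measurable_fun setT y)
  (xy : forall z, x z ^+ 2 + y z ^+ 2 = 1).
Implicit Types (P Q : probability T R).

Definition dot z w := x z * x w + y z * y w.

Lemma dot_le z w : `|dot z w| <= 1.
Proof.
have a := xy z; have b := xy w; rewrite ler_norml /dot.
have h1 := sqr_ge0 (x z - x w); have h2 := sqr_ge0 (y z - y w).
have h3 := sqr_ge0 (x z + x w); have h4 := sqr_ge0 (y z + y w).
by rewrite !expr2 in a b h1 h2 h3 h4; apply/andP; split; lra.
Qed.

Lemma bnd_x : bnd x.
Proof.
split => //; exists 1 => z; have := xy z; rewrite ler_norml.
by have := sqr_ge0 (y z); move=> a b; apply/andP; split; nra.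
Qed.

Lemma bnd_y : bnd y.
Proof.
split => //; exists 1 => z; have := xy z; rewrite ler_norml.
by have := sqr_ge0 (x z); move=> a b; apply/andP; split; nra.
Qed.

Definition mono (m k : nat) (z : T) : R := x z ^+ (m - k) * y z ^+ k.

Definition mom P (m k : nat) : R := mean P (mono m k).

Lemma bnd_mono m k : bnd (mono m k).
Proof. by apply: bndM; apply: bndX; [exact: bnd_x|exact: bnd_y]. Qed.

Definition mean2 P Q (f : T -> T -> R) : R := mean P (fun w => mean Q (fun z => f z w)).

Lemma dotX m z w : dot z w ^+ m = \sum_(k < m.+1) 'C(m, k)%:R * (mono m k w * mono m k z).
Proof.
rewrite /dot exprDn; apply: eq_bigr => k _.
by rewrite -mulr_natl !exprMn /mono; ring.
Qed.

Lemma mean_dotX Q m w : mean Q (fun z => dot z w ^+ m) =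
  \sum_(k < m.+1) 'C(m, k)%:R * mom Q m k * mono m k w.
Proof.
under eq_fun do rewrite dotX.
have b (k : 'I_m.+1) : bnd (fun z => 'C(m, k)%:R * (mono m k w * mono m k z)).
  by apply: bndM; [exact: bnd_cst|apply: bndM; [exact: bnd_cst|exact: bnd_mono]].
rewrite mean_sum//; apply: eq_bigr => k _.
rewrite meanZ; last by apply: bndM; [exact: bnd_cst|exact: bnd_mono].
by rewrite meanZ; [rewrite -/(mom Q m k); ring|exact: bnd_mono].
Qed.

Lemma bnd_mean_dotX Q m : bnd (fun w => mean Q (fun z => dot z w ^+ m)).
Proof.
under eq_fun do rewrite mean_dotX.
by apply: bnd_sum => k; apply: bndM; [exact: bnd_cst|exact: bnd_mono].
Qed.

Lemma mean2_dotX P Q m : mean2 P Q (fun z w => dot z w ^+ m) =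
  \sum_(k < m.+1) 'C(m, k)%:R * mom Q m k * mom P m k.
Proof.
rewrite /mean2; under eq_fun do rewrite mean_dotX.
rewrite mean_sum; last by move=> k; apply: bndM; [exact: bnd_cst|exact: bnd_mono].
by apply: eq_bigr => k _; rewrite meanZ//; exact: bnd_mono.
Qed.

Variable s : R.
Hypothesis s2 : 2 < s.

Let s0 : 0 < s. Proof. by rewrite (lt_trans _ s2). Qed.

(** On the circle |z - w|^2 = 2 - 2 t with t the inner product, so s = 2 would be the logarithmic
    kernel; s > 2 keeps it bounded. *)
Definition ks (t : R) : R := - (ln (s - 2 * t) / 2).

(** The Taylor coefficient of [ks] in degree m + 1, from ks t = - ln s / 2 - ln (1 - (2 / s) t) /
    2. *)
Definition cf (m : nat) : R := (2 / s) ^+ m.+1 / m.+1%:R / 2.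

Definition kN (N : nat) (t : R) : R := - (ln s / 2) + \sum_(m < N) cf m * t ^+ m.+1.

Lemma cf_gt0 m : 0 < cf m.
Proof. by rewrite !divr_gt0 ?exprn_gt0 ?divr_gt0 ?ltr0n. Qed.

Lemma kN_logsum N t : kN N t = - (ln s / 2) + logsum N (2 / s * t) / 2.
Proof.
rewrite /kN /logsum mulr_suml; congr (_ + _); apply: eq_bigr => m _.
rewrite /cf (exprMn _ (2 / s) t); set A := (2 / s) ^+ _; set B := _%:R^-1.
by rewrite -!mulrA [t ^+ _ * _]mulrC -!mulrA.
Qed.

Lemma ks_log t : `|t| <= 1 -> ks t = - (ln s / 2) + (- ln (1 - 2 / s * t)) / 2.
Proof.
rewrite ler_norml => ht; have s2' := s2.
have h : 0 < 1 - 2 / s * t.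
  by rewrite subr_gt0 mulrAC ltr_pdivrMr// mul1r; lra.
have -> : ks t = - (ln (s * (1 - 2 / s * t)) / 2).
  by rewrite /ks; congr (- (ln _ / 2)); field; rewrite gt_eqF.
by rewrite lnM ?posrE//; ring.
Qed.

Let p := 2 / s.
Let p1 : p < 1. Proof. by rewrite ltr_pdivrMr ?mul1r. Qed.
Let p0 : 0 <= p. Proof. by rewrite divr_ge0// ltW. Qed.

Let norm_le t : `|t| <= 1 -> `|p * t| <= p.
Proof. by move=> ht; rewrite normrM (ger0_norm p0) ler_piMr. Qed.

Lemma logsum_le N t : `|t| <= 1 -> `|logsum N (p * t)| <= 2 / (1 - p).
Proof.
move=> ht; have h := norm_le ht.
(* The error estimate for the empty sum bounds the logarithm itself; each of the two estimates
   contributes at most (1 - p)^-1. *)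
have h1 := logsum_err N h p1; have h2 := logsum_err 0 h p1.
have e : logsum 0 (p * t) = 0 by rewrite /logsum big_ord0.
rewrite e subr0 expr0 mul1r in h2.
have h3 : p ^+ N / (1 - p) <= (1 - p)^-1.
  by rewrite ler_piMl ?invr_ge0 ?subr_ge0 ?(ltW p1)// exprn_ile1 ?(ltW p1).
have := ler_normB (- ln (1 - p * t)) (- ln (1 - p * t) - logsum N (p * t)).
rewrite opprB addrC subrK; lra.
Qed.

Lemma cvg_kN t : `|t| <= 1 -> kN N t @[N --> \oo] --> ks t.
Proof.
move=> ht; rewrite ks_log//; under eq_fun do rewrite kN_logsum.
apply: cvgD; first exact: cvg_cst.
apply: cvgM; last exact: cvg_cst.
by apply: cvg_logsum; rewrite (le_lt_trans (norm_le ht)).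
Qed.

Definition kbound : R := `|ln s / 2| + 1 / (1 - p).

Lemma kN_le N t : `|t| <= 1 -> `|kN N t| <= kbound.
Proof.
move=> ht; rewrite kN_logsum /kbound (le_trans (ler_normD _ _))// normrN lerD2l.
have h20 : 0 <= 2^-1 :> R by rewrite invr_ge0.
have := logsum_le N ht; rewrite -/p normrM (ger0_norm h20) => h.
by rewrite ler_pdivrMr// [X in _ <= X]mulrC div1r.
Qed.

Lemma ks_le t : `|t| <= 1 -> `|ks t| <= kbound.
Proof.
move=> ht; have h := cvg_kN ht; rewrite ler_norml; apply/andP; split.
- by apply: (cvg_ge_lim h) => N; have := kN_le N ht; rewrite ler_norml => /andP[].
- by apply: (cvg_le_lim h) => N; have := kN_le N ht; rewrite ler_norml => /andP[].
Qed.

Lemma bnd_dot w : bnd (dot ^~ w).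
Proof.
by apply: bndD; apply: bndM; (exact: bnd_x || exact: bnd_y || exact: bnd_cst).
Qed.

Lemma bnd_kN N w : bnd (fun z => kN N (dot z w)).
Proof.
apply: bndD; first exact: bnd_cst.
by apply: bnd_sum => m; apply: bndM; [exact: bnd_cst|apply: bndX; exact: bnd_dot].
Qed.

Lemma bnd_ks w : bnd (fun z => ks (dot z w)).
Proof.
apply: (bnd_lim (fun N => bnd_kN N w)) => [N z|z]; first exact: (kN_le _ (dot_le _ _)).
exact: (cvg_kN (dot_le _ _)).
Qed.

Lemma mean_kN Q N w : mean Q (fun z => kN N (dot z w)) =
  - (ln s / 2) + \sum_(m < N) cf m * mean Q (fun z => dot z w ^+ m.+1).
Proof.
have b (m : 'I_N) : bnd (fun z => cf m * dot z w ^+ m.+1).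
  by apply: bndM; [exact: bnd_cst|apply: bndX; exact: bnd_dot].
rewrite /kN meanD ?mean_cst; [|exact: bnd_cst|exact: bnd_sum].
rewrite mean_sum//; congr (_ + _); apply: eq_bigr => m _.
by rewrite meanZ//; apply: bndX; exact: bnd_dot.
Qed.

Lemma bnd_mean_kN Q N : bnd (fun w => mean Q (fun z => kN N (dot z w))).
Proof.
under eq_fun do rewrite mean_kN.
apply: bndD; first exact: bnd_cst.
by apply: bnd_sum => m; apply: bndM; [exact: bnd_cst|exact: bnd_mean_dotX].
Qed.

Lemma mean_ks_cvg Q w : mean Q (fun z => kN N (dot z w)) @[N --> \oo] -->
  mean Q (fun z => ks (dot z w)).
Proof.
apply: (@mean_cvg _ _ _ Q (fun N z => kN N (dot z w)) (fun z => ks (dot z w)) kbound).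
- by move=> N; exact: bnd_kN.
- by case: (bnd_ks w).
- by move=> N z; exact: (kN_le _ (dot_le z w)).
- by move=> z; exact: (cvg_kN (dot_le z w)).
Qed.

Lemma bnd_mean_ks Q : bnd (fun w => mean Q (fun z => ks (dot z w))).
Proof.
apply: (bnd_lim (bnd_mean_kN Q)) => [N w|w]; last exact: mean_ks_cvg.
by apply: mean_norm_le; [exact: bnd_kN|move=> z; exact: (kN_le _ (dot_le z w))].
Qed.

Lemma mean2_ks_cvg P Q : mean2 P Q (fun z w => kN N (dot z w)) @[N --> \oo] -->
  mean2 P Q (fun z w => ks (dot z w)).
Proof.
apply: (@mean_cvg _ _ _ P (fun N w => mean Q (fun z => kN N (dot z w)))
  (fun w => mean Q (fun z => ks (dot z w))) kbound).
- by move=> N; exact: bnd_mean_kN.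
- by case: (bnd_mean_ks Q).
- by move=> N w; apply: mean_norm_le; [exact: bnd_kN|move=> z; exact: (kN_le _ (dot_le z w))].
- by move=> w; exact: mean_ks_cvg.
Qed.

Lemma mean2_kN P Q N : mean2 P Q (fun z w => kN N (dot z w)) =
  - (ln s / 2) + \sum_(m < N) cf m *
    \sum_(k < m.+2) 'C(m.+1, k)%:R * mom Q m.+1 k * mom P m.+1 k.
Proof.
rewrite /mean2; under eq_fun do rewrite mean_kN.
have b (m : 'I_N) : bnd (fun w => cf m * mean Q (fun z => dot z w ^+ m.+1)).
  by apply: bndM; [exact: bnd_cst|exact: bnd_mean_dotX].
rewrite meanD ?mean_cst; [|exact: bnd_cst|exact: bnd_sum].
rewrite mean_sum//; congr (_ + _); apply: eq_bigr => m _.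
by rewrite meanZ; [rewrite -mean2_dotX|exact: bnd_mean_dotX].
Qed.

(* The Taylor coefficients of [ks] are positive, so [ks (dot z w)] is a
   positive-definite kernel controlling every moment. *)
Lemma mean2_ks_quad P Q m k : (k < m.+2)%N ->
  cf m * 'C(m.+1, k)%:R * (mom P m.+1 k - mom Q m.+1 k) ^+ 2 <=
  mean2 P P (fun z w => ks (dot z w)) - 2 * mean2 P Q (fun z w => ks (dot z w)) +
  mean2 Q Q (fun z w => ks (dot z w)).
Proof.
move=> km.
(* The truncation order is shifted by m + 1 so that the term of index m is present for every N. *)
have h : mean2 P P (fun z w => kN (N + m.+1) (dot z w)) -
    2 * mean2 P Q (fun z w => kN (N + m.+1) (dot z w)) +
    mean2 Q Q (fun z w => kN (N + m.+1) (dot z w)) @[N --> \oo] -->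
    mean2 P P (fun z w => ks (dot z w)) - 2 * mean2 P Q (fun z w => ks (dot z w)) +
    mean2 Q Q (fun z w => ks (dot z w)).
  have c P' Q' : mean2 P' Q' (fun z w => kN (N + m.+1) (dot z w)) @[N --> \oo] -->
      mean2 P' Q' (fun z w => ks (dot z w)).
    by rewrite (cvg_shiftn m.+1 (fun N => mean2 P' Q' (fun z w => kN N (dot z w)))); exact: mean2_ks_cvg.
  by apply: cvgD => //; apply: cvgB => //; apply: cvgM => //; exact: cvg_cst.
apply: (cvg_ge_lim h) => N; rewrite !mean2_kN.
set L := ln s / 2.
pose F (j : nat) := cf j * \sum_(i < j.+2) 'C(j.+1, i)%:R * (mom P j.+1 i - mom Q j.+1 i) ^+ 2.
(* The constants cancel because 1 - 2 + 1 = 0, and the products of moments complete to squares with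
   the same binomial weights. *)
have -> : - L + \sum_(j < N + m.+1) cf j * (\sum_(i < j.+2) 'C(j.+1, i)%:R * mom P j.+1 i * mom P j.+1 i) -
   2 * (- L + \sum_(j < N + m.+1) cf j * (\sum_(i < j.+2) 'C(j.+1, i)%:R * mom Q j.+1 i * mom P j.+1 i)) +
   (- L + \sum_(j < N + m.+1) cf j * (\sum_(i < j.+2) 'C(j.+1, i)%:R * mom Q j.+1 i * mom Q j.+1 i)) =
   \sum_(j < N + m.+1) F j.
  rewrite mulrDr opprD !addrA [X in X = _](_ : _ = \sum_(j < N + m.+1) cf j * (\sum_(i < j.+2) 'C(j.+1, i)%:R * mom P j.+1 i * mom P j.+1 i) -
    2 * (\sum_(j < N + m.+1) cf j * (\sum_(i < j.+2) 'C(j.+1, i)%:R * mom Q j.+1 i * mom P j.+1 i)) +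
    \sum_(j < N + m.+1) cf j * (\sum_(i < j.+2) 'C(j.+1, i)%:R * mom Q j.+1 i * mom Q j.+1 i)); last by ring.
  rewrite mulr_sumr -sumrB -big_split /=; apply: eq_bigr => j _.
  rewrite /F mulrCA -mulrBr -mulrDr; congr (_ * _).
  by rewrite mulr_sumr -sumrB -big_split /=; apply: eq_bigr => i _; ring.
have F0 j i : 0 <= 'C(j.+1, i)%:R * (mom P j.+1 i - mom Q j.+1 i) ^+ 2.
  by rewrite mulr_ge0 ?sqr_ge0.
have mN : (m < N + m.+1)%N by rewrite addnS ltnS leq_addl.
rewrite (bigD1 (Ordinal mN)) //= -[X in X <= _]addr0 lerD//; last first.
  by apply: sumr_ge0 => j _; rewrite mulr_ge0 ?(ltW (cf_gt0 _))// sumr_ge0.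
rewrite /F -mulrA ler_pM2l ?cf_gt0// (bigD1 (Ordinal km)) //= lerDl.
by rewrite sumr_ge0.
Qed.

End positive_definite.

(** * Polynomials tending to the indicator of u < 1/2 *)

Section threshold.
Context {R : realType}.
Implicit Types u : R.

Lemma bernoulli_le (t : R) n : -1 <= t -> 1 + n%:R * t <= (1 + t) ^+ n.
Proof.
move=> t1; elim: n => [|n IH]; first by rewrite mul0r addr0 expr0.
rewrite exprS; apply: (@le_trans _ _ ((1 + t) * (1 + n%:R * t))); last first.
  by rewrite ler_wpM2l//; lra.
rewrite -natr1; have : 0 <= n%:R * (t * t) :> R by rewrite mulr_ge0// -expr2 sqr_ge0.
by move=> h; nra.
Qed.

(** With r the square root of q, one factor r^n absorbs n: Bernoulli for 1 / r = 1 + t gives n r^n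
    <= 1 / t. The other factor r^n tends to 0. *)
Lemma cvg_nexpn (q : R) : 0 <= q < 1 -> (fun n => n%:R * q ^+ n) @ \oo --> (0 : R).
Proof.
move=> /andP[]; rewrite le_eqVlt => /predU1P[<- _|q0 q1].
  rewrite (_ : (fun n => _) = cst (0 : R)); first exact: cvg_cst.
  by apply/funext => -[|n]; rewrite /= ?mul0r// expr0n mulr0.
pose r := Num.sqrt q; have r0 : 0 < r by rewrite sqrtr_gt0.
have rq : r ^+ 2 = q by rewrite sqr_sqrtr// ltW.
have r1 : r < 1 by rewrite -(sqrtr1 R) ltr_sqrt.
pose t := r^-1 - 1; have t0 : 0 < t by rewrite subr_gt0 invf_gt1.
have h n : n%:R * q ^+ n <= t^-1 * r ^+ n.
  have := bernoulli_le n (_ : -1 <= t); rewrite (_ : 1 + t = r^-1); last by rewrite /t; ring.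
  have t1 : -1 <= t by lra.
  move=> /(_ t1) b.
  have p : 0 < r ^+ n by rewrite exprn_gt0.
  have : n%:R * t * r ^+ n <= 1.
    by rewrite -ler_pdivlMr// div1r -exprVn; lra.
  move=> k; rewrite -rq -exprM mulnC exprM expr2 mulrA ler_pM2r//.
  by rewrite -[t^-1]mul1r ler_pdivlMr// mulrAC.
apply: (@squeeze_cvgr _ _ _ _ (fun=> 0) (fun n => t^-1 * r ^+ n)).
- by apply: nearW => n; rewrite h andbT mulr_ge0// exprn_ge0// ltW.
- exact: cvg_cst.
- rewrite -[X in _ --> X](mulr0 t^-1); apply: cvgM; first exact: cvg_cst.
  by apply: cvg_expr; rewrite ger0_norm// ltW.
Qed.

(* The exponent [n 2^n], rather than [2^n], makes the limit vanish at the
   threshold [u = 1/2] itself. *)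
Definition thr (n : nat) u : R := (1 - u ^+ n) ^+ (n * 2 ^ n).

Lemma thr_itv n u : 0 <= u <= 1 -> 0 <= thr n u <= 1.
Proof.
move=> /andP[u0 u1]; have h0 : 0 <= u ^+ n by rewrite exprn_ge0.
have h1 : u ^+ n <= 1 by rewrite exprn_ile1.
by rewrite /thr exprn_ge0 ?exprn_ile1//; lra.
Qed.

(** Below 1/2, Bernoulli gives the lower bound 1 - n (2u)^n. From 1/2 on, (1 - x)^M (1 + x)^M <= 1
    with x = u^n and M = n 2^n, while Bernoulli gives (1 + x)^M >= n; hence the upper bound 1 /
    n. *)
Lemma cvg_thr u : 0 <= u <= 1 -> thr n u @[n --> \oo] --> ((u < 2^-1)%R%:R : R).
Proof.
move=> hu; have /andP[u0 u1] := hu.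
have e n : (n * 2 ^ n)%:R * u ^+ n = n%:R * (2 * u) ^+ n :> R.
  by rewrite natrM natrX -mulrA exprMn.
have un n : 0 <= u ^+ n <= 1 by rewrite exprn_ge0//= exprn_ile1.
have [l|l] := ltP u 2^-1.
  have h : (fun n => n%:R * (2 * u) ^+ n) @ \oo --> (0 : R) by apply: cvg_nexpn; lra.
  apply: (@squeeze_cvgr _ _ _ _ (fun n => 1 - n%:R * (2 * u) ^+ n) (fun=> 1)).
  - apply: nearW => n; have /andP[_ ->] := thr_itv n hu; rewrite andbT.
    have := un n => /andP[a b].
    by have := bernoulli_le (n * 2 ^ n) (_ : -1 <= - u ^+ n); rewrite mulrN e; apply; lra.
  - rewrite -[X in _ --> X]subr0; apply: cvgB => //; exact: cvg_cst.
  - exact: cvg_cst.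
apply: (@squeeze_cvgr _ _ _ _ (fun=> 0) (fun n => (n%:R)^-1)); last 2 first.
- exact: cvg_cst.
- by rewrite -(cvg_shiftS (fun n => (n%:R : R)^-1)); exact: cvg_harmonic.
near=> n; have /andP[-> _] /= := thr_itv n hu.
have n0 : (0 < n)%N by near: n; exact: nbhs_infty_gt.
have := un n => /andP[a b].
have h1 : n%:R <= (1 + u ^+ n) ^+ (n * 2 ^ n).
  apply: le_trans (bernoulli_le _ _); last by lra.
  rewrite e -[X in X <= _]add0r lerD// ler_peMr// exprn_ege1//; lra.
have n0' : 0 < n%:R :> R by rewrite ltr0n.
rewrite -(ler_pM2r n0') mulVf ?gt_eqF//.
have /andP[t0 t1] := thr_itv n hu.
apply: (@le_trans _ _ (thr n u * (1 + u ^+ n) ^+ (n * 2 ^ n))); first by rewrite ler_wpM2l.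
have c0 : 0 <= (1 - u ^+ n) * (1 + u ^+ n) by rewrite mulr_ge0//; lra.
have c1 : (1 - u ^+ n) * (1 + u ^+ n) <= 1.
  have : 0 <= u ^+ n * u ^+ n by rewrite mulr_ge0.
  lra.
by rewrite /thr -exprMn exprn_ile1.
Unshelve. all: by end_near. Qed.

End threshold.

(** * Equal moments imply equal measures *)

Section moments_determine.
Context {R : realType}.
Variables (mu nu : circle_prob R).
Local Notation T := (circle_borel R).
Hypothesis mom_eq : forall m k, (k <= m)%N -> mom cre cim mu m k = mom cre cim nu m k.
Implicit Types f g v : T -> R.

(** Equality is asked against all monomials and not just for the mean of f: this makes the class
    stable under multiplication by the coordinates, hence by polynomials, and by bounded limits of
    these. *)
Definition same f := bnd f /\ forall a b,
  mean mu (fun z => f z * (cre z ^+ a * cim z ^+ b)) =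
  mean nu (fun z => f z * (cre z ^+ a * cim z ^+ b)).

Let bx : bnd (@cre R). Proof. exact: (bnd_x measurable_cre cre2Dcim2). Qed.
Let bY : bnd (@cim R). Proof. exact: (bnd_y measurable_cim cre2Dcim2). Qed.

Let bm a b : bnd (fun z : T => cre z ^+ a * cim z ^+ b).
Proof. by apply: bndM; exact: bndX. Qed.

Lemma same1 : same (fun=> 1).
Proof.
split; first exact: bnd_cst.
move=> a b; have e : (fun z : T => 1 * (cre z ^+ a * cim z ^+ b)) = mono cre cim (a + b) b.
  by apply/funext => z; rewrite /mono addnK mul1r.
by rewrite e; apply: mom_eq; exact: leq_addl.
Qed.

Lemma sameD f g : same f -> same g -> same (fun z => f z + g z).
Proof.
move=> [bf hf] [bg hg]; split; first exact: bndD.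
move=> a b; under eq_fun do rewrite mulrDl;
by rewrite !meanD ?hf ?hg//; exact: bndM.
Qed.

Lemma sameZ (k : R) f : same f -> same (fun z => k * f z).
Proof.
move=> [bf hf]; split; first by apply: bndM => //; exact: bnd_cst.
move=> a b; under eq_fun do rewrite -mulrA;
by rewrite !meanZ ?hf//; exact: bndM.
Qed.

Lemma same_cre f : same f -> same (fun z => cre z * f z).
Proof.
move=> [bf hf]; split; first exact: bndM.
have e a b : (fun z => cre z * f z * (cre z ^+ a * cim z ^+ b)) =
    (fun z => f z * (cre z ^+ a.+1 * cim z ^+ b)).
  by apply/funext => z; rewrite exprS; ring.
by move=> a b; rewrite e hf.
Qed.

Lemma same_cim f : same f -> same (fun z => cim z * f z).
Proof.
move=> [bf hf]; split; first exact: bndM.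
have e a b : (fun z => cim z * f z * (cre z ^+ a * cim z ^+ b)) =
    (fun z => f z * (cre z ^+ a * cim z ^+ b.+1)).
  by apply/funext => z; rewrite exprS; ring.
by move=> a b; rewrite e hf.
Qed.

Lemma same_lim (F : nat -> T -> R) f (K : R) : (forall n, same (F n)) ->
  (forall n z, `|F n z| <= K) -> (forall z, F n z @[n --> \oo] --> f z) -> same f.
Proof.
move=> sF FK Ff.
have bf : bnd f by apply: (bnd_lim (f := F) (K := K)) => // n; case: (sF n).
split => // a b.
have [_ [J hJ]] := bm a b.
have lim (P : circle_prob R) : mean P (fun z => F n z * (cre z ^+ a * cim z ^+ b)) @[n --> \oo] -->
    mean P (fun z => f z * (cre z ^+ a * cim z ^+ b)).
  apply: (@mean_cvg _ _ _ P (fun n z => F n z * (cre z ^+ a * cim z ^+ b))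
    (fun z => f z * (cre z ^+ a * cim z ^+ b)) (K * J)).
  - by move=> n; apply: bndM => //; case: (sF n).
  - by have [] := bndM bf (bm a b).
  - by move=> n z; rewrite normrM ler_pM.
  - by move=> z; apply: cvgM => //; exact: cvg_cst.
apply: (cvg_unique _ (lim mu)) => //.
rewrite (_ : (fun n => _) = (fun n => mean nu (fun z => F n z * (cre z ^+ a * cim z ^+ b)))).
  exact: lim.
by apply/funext => n; case: (sF n).
Qed.

Definition multiplier v := forall f, same f -> same (fun z => v z * f z).

Lemma multiplierX v n : multiplier v -> multiplier (fun z => v z ^+ n).
Proof.
move=> mv; elim: n => [|n IH] f sf.
  by under eq_fun do rewrite expr0 mul1r.
by under eq_fun do rewrite exprS -mulrA; apply: mv; exact: IH.
Qed.

Lemma multiplier_affine v (a b : R) : multiplier v -> multiplier (fun z => a + b * v z).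
Proof.
move=> mv f sf; under eq_fun do rewrite mulrDl -mulrA.
by apply: sameD; apply: sameZ => //; exact: mv.
Qed.

(** An affine change maps v into [0, 1] and 0 to 1/2; the polynomials [thr n] in the new function
    are multipliers and converge boundedly to the indicator. *)
Lemma same_threshold v (L : R) f : multiplier v -> 0 < L ->
  (forall z, `|v z| <= L) -> same f -> same (fun z => (v z < 0)%R%:R * f z).
Proof.
move=> mv L0 vL sf; pose u z := 2^-1 + (2 * L)^-1 * v z.
have mu' : multiplier u by exact: multiplier_affine.
have hu z : 0 <= u z <= 1.
  have := vL z; rewrite ler_norml => h.
  have : `|(2 * L)^-1 * v z| <= 2^-1.
    have p2 : 0 < 2 * L by rewrite mulr_gt0.
    rewrite normrM ger0_norm ?invr_ge0 ?(ltW p2)// ler_pdivrMl//.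
    by rewrite mulrAC divff ?mul1r// pnatr_eq0.
  by rewrite ler_norml /u; lra.
have e z : (v z < 0) = (u z < 2^-1).
  rewrite /u gtrDl pmulr_rlt0// invr_gt0 mulr_gt0//.
have [_ [K hK]] : bnd f by case: sf.
apply: (@same_lim (fun n z => thr n (u z) * f z) _ K).
- move=> n; apply: multiplierX => //.
  move=> g sg; have := multiplier_affine 1 (-1) (multiplierX n mu') sg.
  by under eq_fun do rewrite mulN1r.
- move=> n z; rewrite normrM; have /andP[t0 t1] := thr_itv n (hu z).
  by rewrite ger0_norm// -[X in _ <= X]mul1r ler_pM.
- by move=> z; rewrite e; apply: cvgM; [exact: cvg_thr|exact: cvg_cst].
Qed.

Lemma mean_bool (P : circle_prob R) (p : T -> bool) : measurable [set z | p z] ->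
  (mean P (fun z => (p z)%:R))%:E = P [set z | p z].
Proof.
move=> mp; rewrite /mean (_ : (fun z => (p z)%:R) = \1_[set z | p z]); last first.
  apply/funext => z; rewrite indicE; congr ((nat_of_bool _)%:R).
  by apply/idP/idP => [h|/set_mem//]; exact/mem_set.
rewrite /Rintegral integral_indic// setIT fineK//.
exact: fin_num_measure.
Qed.

Lemma same_measure (p : T -> bool) : measurable [set z | p z] ->
  same (fun z => (p z)%:R) -> mu [set z | p z] = nu [set z | p z].
Proof.
move=> mp [_ /(_ 0%N 0%N)]; under eq_fun do rewrite !expr0 !mulr1.
by rewrite -!mean_bool// => ->.
Qed.

Lemma moments_determine B : measurable B -> mu B = nu B.
Proof.
have cx z := cre_itv (z : T).
(* The sign e covers the conditions [cre z < a] and [a < cre z] with one argument. *)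
have s0 (a e : R) : e = 1 \/ e = -1 ->
    forall f, same f -> same (fun z => (e * cre z - a < 0)%R%:R * f z).
  move=> he f sf; apply: (@same_threshold (fun z => e * cre z - a) (1 + `|a|)) => //.
  - move=> g sg.
    have := multiplier_affine (- a) e same_cre sg.
    by under eq_fun do rewrite addrC.
  - move=> z; rewrite (le_trans (ler_normB _ _))// lerD2r normrM.
    have -> : `|e| = 1 by case: he => ->; rewrite ?normrN normr1.
    by rewrite mul1r ler_norml cx.
have s1 f : same f -> same (fun z => (cim z < 0)%R%:R * f z).
  move=> sf; apply: (@same_threshold cim 1) => //; first exact: same_cim.
  by move=> z; rewrite ler_norml cim_itv.
have e1 (a : R) z : (1 * cre (z : T) - a < 0) = (cre z < a) by rewrite mul1r subr_lt0.
have e2 (a : R) z : (-1 * cre (z : T) - - a < 0) = (a < cre z).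
  by rewrite mulN1r opprK addrC subr_lt0.
have setb (p p' : T -> bool) : [set z | p z] `&` [set z | p' z] = [set z | p z && p' z].
  by apply/seteqP; split => z /=; [move=> [-> ->]|move=> /andP].
have mulb (p p' : T -> bool) : (fun z => (p z && p' z)%:R) = (fun z => (p z)%:R * (p' z)%:R : R).
  by apply/funext => z; rewrite -natrM mulnb.
apply: circle_prob_eq => a.
- apply: same_measure; first exact: measurable_cre_lt.
  have := s0 a 1 (or_introl erefl) _ same1.
  by under eq_fun do rewrite mulr1 e1.
- rewrite setb; apply: same_measure.
    by rewrite -setb; apply: measurableI; [exact: measurable_cre_lt|exact: measurable_cim_lt].
  rewrite mulb; have := s0 a 1 (or_introl erefl) _ (s1 _ same1).
  by under eq_fun do rewrite mulr1 e1.
- rewrite setb; apply: same_measure.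
    by rewrite -setb; apply: measurableI; [exact: measurable_cre_gt|exact: measurable_cim_lt].
  rewrite mulb; have := s0 (- a) (-1) (or_intror erefl) _ (s1 _ same1).
  by under eq_fun do rewrite mulr1 e2.
Qed.

End moments_determine.

(** * The equilibrium measure *)

Section equilibrium.
Context {R : realType}.
Local Notation la := (@lebesgue_measure R).
Local Notation T := (circle_borel R).
Local Notation I := (`[(- pi)%R, pi%R]%classic).
Local Notation J := (`](- pi)%R, pi%R]%classic).
Variables (al c : R).
Hypotheses (hal : -1 <= al <= 1) (hc : -1 < c < 1).

Definition weight (psi : R) : R := hre al c psi / (2 * pi).

Lemma weight_ge0 psi : 0 <= weight psi.
Proof. by rewrite divr_ge0 ?sqrtr_ge0// mulr_ge0// pi_ge0. Qed.

Lemma measurable_weight D : measurable_fun D weight.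
Proof. by apply: measurable_funM => //; exact: measurable_hre. Qed.

Lemma integrable_weight : la.-integrable I (EFin \o weight).
Proof.
have h : la.-integrable I (fun psi => ((2 * pi)^-1)%:E * (EFin \o hre al c) psi)%E.
  by apply: integrableZl => //; exact: integrable_hre.
by apply: eq_integrable h => // psi _; rewrite /= -EFinM mulrC.
Qed.

Lemma integral_weight : \int[la]_(psi in I) weight psi = 1.
Proof.
have p := @pi_gt0 R.
have h : \int[la]_(psi in I) weight psi = (2 * pi)^-1 * \int[la]_(psi in I) hre al c psi.
  rewrite -RintegralZl//; last exact: integrable_hre.
  by apply: eq_Rintegral => psi _; rewrite mulrC.
by rewrite h integral_hre// mulVf// mulf_neq0 ?pnatr_eq0 ?gt_eqF.
Qed.

Definition equilibrium_density := image_density la (@expi R : R -> T) J weight.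

Lemma equilibrium_measure : exists nu : circle_prob R, forall B, nu B = equilibrium_density B.
Proof.
have mJ : measurable (J : set R) by [].
have [m hm] := image_density_measure la (@measurable_expi R) mJ (measurable_weight (D:=setT)) weight_ge0.
have m1 : m setT = 1%E.
  rewrite hm /image_density preimage_setT setIT.
  rewrite (@integral_itv_obnd_cbnd _ (- pi) (BRight pi) (EFin \o weight)).
    rewrite -integral_weight /Rintegral fineK//; apply: integrable_fin_num => //.
    exact: integrable_weight.
  by apply: (measurableT_comp (@EFin_measurable R setT)); exact: measurable_weight.
(* The total mass is already 1, so normalisation keeps all values and only turns [m] into a
   probability. *)
exists (mnormalize m (dirac (point : T))) => B.
have e : mnormalize m (dirac (point : T)) = m.
  apply/funext => A; rewrite /mnormalize m1; case: ifPn => [/orP[]/eqP//[]/eqP|_].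
    by rewrite oner_eq0.
  by rewrite /= invr1 mule1.
by rewrite [LHS](congr1 (@^~ B) e) hm.
Qed.

Variable nu : circle_prob R.
Hypothesis nuE : forall B, nu B = equilibrium_density B.

Lemma mean_equilibrium f : bnd f -> mean nu f = \int[la]_(psi in I) (f (expi psi) * weight psi).
Proof.
move=> bf; have [mf [K hK]] := bf.
(* The change of variables is for nonnegative functions; adding K achieves this, and both sides then
   gain the same K because the weight has integral 1. *)
have g0 z : (0 <= (f z + K)%:E)%E.
  by rewrite lee_fin; have := hK z; rewrite ler_norml; lra.
have bg : bnd (fun z : T => f z + K) by apply: bndD => //; exact: bnd_cst.
have mg : measurable_fun setT (fun z : T => (f z + K)%:E) by apply/measurable_EFinP; case: bg.
have mJ : measurable (J : set R) by [].
have mfe D : measurable_fun D (fun psi : R => f (expi psi)).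
  by apply: measurable_funTS; exact: (measurableT_comp mf (@measurable_expi R)).
have hm B : measurable B -> (nu : {measure set T -> \bar R}) B = equilibrium_density B.
  by move=> _; exact: nuE.
have := integral_image_density (la := la) (@measurable_expi R) mJ (measurable_weight (D:=setT)) weight_ge0 hm mg g0.
under [RHS]eq_integral do rewrite -EFinM.
rewrite (@integral_itv_obnd_cbnd _ (- pi) (BRight pi) (fun psi => ((f (expi psi) + K) * weight psi)%:E)); last first.
  apply: (measurableT_comp (@EFin_measurable R setT)); apply: measurable_funM; last exact: measurable_weight.
  by apply: measurable_funD.
move=> /(congr1 fine); rewrite -/(Rintegral _ _ _) -/(Rintegral _ _ _) -/(mean nu _).
have := @meanD _ _ R nu f (fun=> K) bf (bnd_cst T K); rewrite mean_cst => ->.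
have i1 : la.-integrable I (EFin \o (fun psi => f (expi psi) * weight psi)).
  have h : la.-integrable I (fun psi => K%:E * (EFin \o weight) psi)%E.
    by apply: integrableZl => //; exact: integrable_weight.
  apply: le_integrable h => //.
    by apply: (measurableT_comp (@EFin_measurable R setT)); apply: measurable_funM; [exact: mfe|exact: measurable_weight].
  move=> psi _ /=; rewrite lee_fin (normrM (f _)) (normrM K) ler_wpM2r//.
  by rewrite (le_trans (hK _))// ler_norm.
have i2 : la.-integrable I (EFin \o (fun psi => K * weight psi)).
  have h : la.-integrable I (fun psi => K%:E * (EFin \o weight) psi)%E.
    by apply: integrableZl => //; exact: integrable_weight.
  exact: eq_integrable h.
under eq_Rintegral do rewrite mulrDl.
rewrite RintegralD// RintegralZl//; last exact: integrable_weight.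
by rewrite integral_weight mulr1 => /addIr.
Qed.

End equilibrium.

(* No measurability: the integral of a nonnegative function is a supremum over
   the simple functions below it. *)
Lemma le_integralT d (T : measurableType d) (R : realType)
    (mu : {measure set T -> \bar R}) (f g : T -> \bar R) :
  (forall x, f x <= g x)%E -> (\int[mu]_x f x <= \int[mu]_x g x)%E.
Proof.
move=> fg; rewrite /integral !patch_setT; apply: leeB.
- apply: ereal_sup_le => _ [h /= hf <-]; exists h => //= x; apply: le_trans (hf x) _; by apply: (funepos_le (D := setT)) => [y _|]; rewrite ?inE.
- apply: ereal_sup_le => _ [h /= hf <-]; exists h => //= x; apply: le_trans (hf x) _; by apply: (funeneg_le (D := setT)) => [y _|]; rewrite ?inE.
Qed.

Lemma ln_sqrt {R : realType} (x : R) : 0 < x -> ln (Num.sqrt x) = ln x / 2.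
Proof.
move=> x0; rewrite -[in RHS](sqr_sqrtr (ltW x0)) lnXn ?sqrtr_gt0//.
by rewrite mulr2n; field.
Qed.

(** * The logarithmic kernel as an increasing limit of bounded kernels *)

Section log_kernel.
Context {R : realType}.
Local Notation T := (circle_borel R).

Definition inner (z w : T) : R := dot cre cim z w.

Lemma inner_le z w : `|inner z w| <= 1.
Proof. exact: (dot_le cre2Dcim2). Qed.

Lemma log_kernelE z w : log_kernel z w = (- lne (Num.sqrt (2 - 2 * inner z w))%:E)%E.
Proof.
rewrite /log_kernel; congr (- lne _%:E)%E.
have := cre2Dcim2 z; have := cre2Dcim2 w; rewrite /inner /dot /cre /cim.
case: (set_val z) => a b; case: (set_val w) => a' b' /= hw hz.
congr (Num.sqrt _).
have e1 : (2 : R) = (a' ^+ 2 + b' ^+ 2) + (a ^+ 2 + b ^+ 2) by rewrite hw hz.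
by rewrite {1}e1; ring.
Qed.

(* With [r = rad n], [r (srad n - 2 cos x) = |1 - r e^(ix)|^2], so that [ks (srad n)]
   is the kernel [- log |1 - r e^(ix)|] up to a constant. *)
Definition srad (n : nat) : R := rad n + (rad n)^-1.

Lemma srad_gt2 n : 2 < srad n.
Proof.
have /andP[r0 r1] := @rad_itv R n; rewrite /srad -subr_gt0.
have -> : rad n + (rad n)^-1 - 2 = (1 - rad n) ^+ 2 / rad n :> R.
  by move: (@rad R n) r0 {r1} => r r0; field; rewrite gt_eqF.
by rewrite divr_gt0// exprn_gt0// subr_gt0.
Qed.

Lemma srad_decr n m : (n <= m)%N -> srad m <= srad n.
Proof.
move=> nm; have /andP[a0 a1] := @rad_itv R n; have /andP[b0 b1] := @rad_itv R m.
have ab : rad n <= rad m :> R.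
  by rewrite /rad lerD2l lerN2 lef_pV2 ?posrE ?ltr0n// ler_nat.
rewrite /srad -subr_ge0; move: (@rad R n) (@rad R m) a0 a1 b0 b1 ab => r r' a0 a1 b0 b1 ab.
have -> : r + r^-1 - (r' + r'^-1) = (r' - r) * (1 - r * r') / (r * r').
  by field; rewrite !gt_eqF.
rewrite divr_ge0//; last by rewrite mulr_ge0 ?ltW.
rewrite mulr_ge0 ?subr_ge0//; nra.
Qed.

Lemma cvg_srad : srad @ \oo --> (2 : R).
Proof.
rewrite /srad (_ : 2 = 1 + 1^-1); last by rewrite invr1.
apply: cvgD; first exact: cvg_rad.
by apply: cvgV; [rewrite oner_eq0|exact: cvg_rad].
Qed.

Lemma srad_sub_gt0 n (t : R) : `|t| <= 1 -> 0 < srad n - 2 * t.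
Proof. by rewrite ler_norml => ht; have := srad_gt2 n; lra. Qed.

Lemma ks_srad_le n m (t : R) : `|t| <= 1 -> (n <= m)%N -> ks (srad n) t <= ks (srad m) t.
Proof.
move=> ht nm; rewrite /ks lerN2 ler_wpM2r ?invr_ge0// ler_ln ?posrE ?srad_sub_gt0//.
by rewrite lerD2r srad_decr.
Qed.

Lemma ks_le_log_kernel n z w : ((ks (srad n) (inner z w))%:E <= log_kernel z w)%E.
Proof.
rewrite log_kernelE; have := inner_le z w; move: (inner z w) => t ht.
rewrite /lne; case: ifPn => [_|]; first by rewrite leey.
rewrite -ltNge sqrtr_gt0 => p; rewrite -EFinN lee_fin /ks lerN2 ln_sqrt//.
rewrite ler_wpM2r ?invr_ge0// ler_ln ?posrE ?srad_sub_gt0// lerD2r ltW//.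
exact: srad_gt2.
Qed.

Lemma cvg_log_kernel z w :
  (ks (srad n) (inner z w))%:E @[n --> \oo] --> log_kernel z w.
Proof.
rewrite log_kernelE; have := inner_le z w; move: (inner z w) => t ht.
have h : srad n - 2 * t @[n --> \oo] --> (2 - 2 * t : R).
  by apply: cvgB; [exact: cvg_srad|exact: cvg_cst].
rewrite /lne; case: ifPn => [p|].
  have e : 2 - 2 * t = 0.
    by move: p ht; rewrite leNgt sqrtr_gt0 -leNgt ler_norml; lra.
  rewrite e in h; apply/cvgeryP/cvgryPge => A.
  (* The two points coincide and the limit is +oo: [ks] reaches A once [srad n - 2 * t] is below exp
     (-2A). *)
  have e0 : 0 < expR (- (2 * A)) by exact: expR_gt0.
  near=> n; rewrite /ks lerNr ler_pdivrMr// (_ : - A * 2 = - (2 * A)); last by ring.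
  rewrite -ler_expR lnK ?posrE ?srad_sub_gt0//.
  rewrite ltW//; near: n; exact: (cvgr_lt _ h).
rewrite -ltNge sqrtr_gt0 => p; rewrite -EFinN; apply: cvg_EFin; first exact: nearW.
rewrite ln_sqrt//; apply: cvgN; apply: cvgM; last exact: cvg_cst.
by apply: (cvg_cont (h := @ln R)) h; exact: continuous_ln.
Unshelve. all: by end_near. Qed.

End log_kernel.

(** * Potential and energy of the candidate measure *)

Section equilibrium_potential.
Context {R : realType}.
Local Notation la := (@lebesgue_measure R).
Local Notation T := (circle_borel R).
Local Notation I := (`[(- pi)%R, pi%R]%classic).
Variables (al c : R).
Hypotheses (hal : -1 <= al <= 1) (hc : -1 < c < 1).

Lemma ks_expi n (phi psi : R) : ks (srad n) (inner (expi psi) (expi phi)) =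
  ln (rad n) / 2 - kap (rad n) (psi - phi).
Proof.
have /andP[r0 r1] := @rad_itv R n.
have -> : inner (expi psi) (expi phi) = cos (psi - phi) by rewrite cosB.
have h : 0 < srad n - 2 * cos (psi - phi).
  by apply: srad_sub_gt0; rewrite ler_norml cos_geN1 cos_le1.
have -> : kap (rad n) (psi - phi) = ln (rad n * (srad n - 2 * cos (psi - phi))) / 2.
  rewrite /kap /srad; congr (ln _ / 2); move: (@rad R n) r0 {r1 h} => r r0.
  by field; rewrite gt_eqF.
by rewrite lnM ?posrE// /ks; ring.
Qed.

Lemma bnd_ks_inner n w : bnd (fun z : T => ks (srad n) (inner z w)).
Proof. exact: (bnd_ks measurable_cre measurable_cim cre2Dcim2 (srad_gt2 n)). Qed.

Lemma pot_norm_le : exists K, forall phi, `|pot al c phi| <= K.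
Proof.
have ih := integrable_him hal hc.
have iG : la.-integrable I (EFin \o (fun psi => pi / 2 * `|him al c psi|)).
  have h : la.-integrable I (fun psi => (pi / 2)%:E * (abse \o (EFin \o him al c)) psi)%E.
    by apply: integrableZl => //; exact: integrable_abse.
  by apply: eq_integrable h.
exists ((\int[la]_(psi in I) (pi / 2 * `|him al c psi|)) / (2 * pi)) => phi.
have p : 0 < 2 * pi :> R by rewrite mulr_gt0// pi_gt0.
rewrite /pot normrM (gtr0_norm (_ : 0 < (2 * pi)^-1)) ?invr_gt0// ler_wpM2r ?invr_ge0 ?(ltW p)//.
apply: le_trans (le_normr_Rintegral _ (integrable_saw_him hal hc 1 phi)) _ => //.
apply: le_Rintegral => //.
- have h : la.-integrable I (abse \o (EFin \o (fun psi => saw 1 (psi - phi) * him al c psi))).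
    by apply: integrable_abse => //; exact: integrable_saw_him.
  exact: eq_integrable h.
- by move=> psi _; rewrite normrM ler_wpM2r//; exact: saw_le.
Qed.

Variable nu : circle_prob R.
Hypothesis nuE : forall B, nu B = equilibrium_density al c B.

Definition smooth_pot (n : nat) (w : T) : R := mean nu (fun z => ks (srad n) (inner z w)).

Definition cpot (w : T) : R := pot al c (carg w).

Lemma smooth_pot_expi n (phi : R) : smooth_pot n (expi phi) = ln (rad n) / 2 +
  - (\int[la]_(psi in I) (kap (rad n) (psi - phi) * hre al c psi)) / (2 * pi).
Proof.
have p : 0 < 2 * pi :> R by rewrite mulr_gt0// pi_gt0.
rewrite /smooth_pot (mean_equilibrium hal hc nuE); last exact: bnd_ks_inner.
under eq_Rintegral do rewrite ks_expi mulrBl.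
have h1 : la.-integrable I (EFin \o (fun psi => ln (rad n) / 2 * weight al c psi)).
  have h : la.-integrable I (fun psi => (ln (rad n) / 2)%:E * (EFin \o weight al c) psi)%E.
    by apply: integrableZl => //; exact: integrable_weight.
  exact: eq_integrable h.
have ik := integrable_kap_hre hal hc phi (@rad_ge0 R n).
have h2 : la.-integrable I (EFin \o (fun psi => kap (rad n) (psi - phi) * weight al c psi)).
  have h : la.-integrable I (fun psi => ((2 * pi)^-1)%:E *
      (EFin \o (fun psi => kap (rad n) (psi - phi) * hre al c psi)%R) psi)%E.
    by apply: integrableZl.
  apply: eq_integrable h => // psi _; rewrite /= -EFinM; congr EFin.
  by rewrite /weight mulrC mulrA.
rewrite RintegralB//; congr (_ + _).
  rewrite RintegralZl//; last exact: integrable_weight.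
  by rewrite integral_weight// mulr1.
rewrite mulNr; congr (- _).
rewrite [RHS]mulrC -RintegralZl//.
by apply: eq_Rintegral => psi _; rewrite /weight [RHS]mulrC mulrA.
Qed.

Lemma cvg_smooth_pot w : smooth_pot n w @[n --> \oo] --> cpot w.
Proof.
have l0 : ln (rad n) / 2 @[n --> \oo] --> (0 : R).
  rewrite -(mul0r (2^-1 : R)) -(@ln1 R); apply: cvgM; last exact: cvg_cst.
  by apply: (cvg_cont (h := @ln R)); [exact: continuous_ln|exact: cvg_rad].
rewrite (_ : (fun n => _) = (fun n => ln (rad n) / 2 +
  - (\int[la]_(psi in I) (kap (rad n) (psi - carg w) * hre al c psi)) / (2 * pi))).
  rewrite -[X in _ --> X]add0r; apply: cvgD; [exact: l0|exact: cvg_pot].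
by apply/funext => n; rewrite -smooth_pot_expi cargK.
Qed.

Lemma bnd_smooth_pot n : bnd (smooth_pot n).
Proof. exact: (bnd_mean_ks measurable_cre measurable_cim cre2Dcim2 (srad_gt2 n)). Qed.

Lemma smooth_pot_le n m w : (n <= m)%N -> smooth_pot n w <= smooth_pot m w.
Proof.
move=> nm; apply: mean_le => [||z]; [exact: bnd_ks_inner|exact: bnd_ks_inner|].
exact: ks_srad_le (inner_le z w) nm.
Qed.

Lemma ks_ge n z w : - kbound (srad 0) <= ks (@srad R n) (inner z w).
Proof.
apply: le_trans (ks_srad_le (inner_le z w) (leq0n n)).
by have := ks_le (srad_gt2 0) (inner_le z w); rewrite ler_norml => /andP[].
Qed.

(** The sequence increases to [cpot], which is bounded above because [saw] is bounded, and from
    below the kernels dominate the bounded kernel for n = 0. *)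
Lemma smooth_pot_norm_le : exists K, forall n w, `|smooth_pot n w| <= K.
Proof.
have [K hK] := pot_norm_le; exists (K + kbound (srad 0)) => n w.
have b : smooth_pot n w <= K.
  apply: (@le_trans _ _ (cpot w)); last by rewrite (le_trans (ler_norm _))//; exact: hK.
  apply: (cvg_ge_lim (u := fun m => smooth_pot (m + n) w)).
    by rewrite (cvg_shiftn n (fun m => smooth_pot m w)); exact: cvg_smooth_pot.
  by move=> m; apply: smooth_pot_le; exact: leq_addl.
have K0 : 0 <= K by apply: le_trans (hK 0).
have k0 : 0 <= kbound (@srad R 0).
  by apply: le_trans (ks_le (srad_gt2 0) (inner_le w w)).
have a : - kbound (srad 0) <= smooth_pot n w.
  rewrite -[X in X <= _](mean_cst nu); apply: mean_le => [||z]; [exact: bnd_cst|exact: bnd_ks_inner|].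
  exact: ks_ge.
by rewrite ler_norml; apply/andP; split; lra.
Qed.

Lemma bnd_cpot : bnd cpot.
Proof.
have [K hK] := smooth_pot_norm_le.
by apply: (bnd_lim bnd_smooth_pot hK) => w; exact: cvg_smooth_pot.
Qed.

Lemma cvg_mean_smooth_pot (P : circle_prob R) : mean P (smooth_pot n) @[n --> \oo] --> mean P cpot.
Proof.
have [K hK] := smooth_pot_norm_le; apply: mean_cvg hK _ => [n||w].
- exact: bnd_smooth_pot.
- by case: bnd_cpot.
- exact: cvg_smooth_pot.
Qed.

Lemma EFin_mean (P : circle_prob R) f : bnd f -> (\int[P]_z (f z)%:E = (mean P f)%:E)%E.
Proof.
move=> bf; rewrite /mean /Rintegral fineK//; apply: integrable_fin_num => //.
exact: bnd_integrable.
Qed.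

(** Monotone convergence along the bounded kernels; adding K, a lower bound common to all of them up
    to sign, makes them nonnegative. The finite value shows that the candidate has finite energy. *)
Lemma integral_log_kernel w : (\int[nu]_z log_kernel z w = (cpot w)%:E)%E.
Proof.
pose K := kbound (@srad R 0).
have bf n : bnd (fun z => ks (srad n) (inner z w) + K).
  by apply: bndD; [exact: bnd_ks_inner|exact: bnd_cst].
have mf n : measurable_fun setT (fun z => (ks (srad n) (inner z w) + K)%:E).
  by apply/measurable_EFinP; case: (bf n).
have lim z : log_kernel z w + K%:E = limn (fun n => (ks (srad n) (inner z w) + K)%:E) :> \bar R.
  apply/esym/cvg_lim => //; under eq_fun do rewrite EFinD.
  by apply: cvgeD => //; [exact: fin_num_adde_defl|exact: cvg_log_kernel|exact: cvg_cst].
have f0 n z : (0 <= (ks (srad n) (inner z w) + K)%:E)%E.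
  by rewrite lee_fin -lerBlDr sub0r ks_ge.
have e1 : (\int[nu]_z (log_kernel z w + K%:E) = (cpot w + K)%:E)%E.
  under eq_integral do rewrite lim.
  rewrite monotone_convergence//; last first.
    by move=> z _ n m nm; rewrite lee_fin lerD2r; exact: ks_srad_le (inner_le z w) nm.
  apply/cvg_lim => //.
  have e n : (\int[nu]_z (ks (srad n) (inner z w) + K)%:E = (smooth_pot n w + K)%:E)%E.
    by rewrite EFin_mean// meanD ?mean_cst//; [exact: bnd_ks_inner|exact: bnd_cst].
  under eq_fun do rewrite e.
  apply: cvg_EFin; first exact: nearW.
  by apply: cvgD; [exact: cvg_smooth_pot|exact: cvg_cst].
have mk : measurable_fun setT (fun z => log_kernel z w + K%:E)%E.
  apply: (emeasurable_fun_cvg (fun n z => (ks (srad n) (inner z w) + K)%:E)) => // z _.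
  under eq_fun do rewrite EFinD.
  by apply: cvgeD => //; [exact: fin_num_adde_defl|exact: cvg_log_kernel|exact: cvg_cst].
have k0 z : (0 <= log_kernel z w + K%:E)%E.
  apply: le_trans (f0 0%N z) _; rewrite EFinD leeD2r//; exact: ks_le_log_kernel.
have ik : nu.-integrable setT (fun z => log_kernel z w + K%:E)%E.
  apply/integrableP; split => //.
  under eq_integral do rewrite gee0_abs//.
  by rewrite e1 ltry.
transitivity (\int[nu]_z (((fun z => log_kernel z w + K%:E) \- cst K%:E) z))%E.
  by apply: eq_integral => z _; rewrite /= addeK.
rewrite integralB//; last exact: finite_measure_integrable_cst.
rewrite e1 integral_cst//.
have h := probability_setT nu; rewrite [X in (_ - _ * X)%E]h.
by rewrite mule1 -EFinB addrK.
Qed.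

Lemma log_energy_equilibrium : log_energy nu = (mean nu cpot)%:E.
Proof.
rewrite /log_energy; under eq_integral do rewrite integral_log_kernel.
by rewrite EFin_mean//; exact: bnd_cpot.
Qed.

(** The bounded kernel lies below the logarithmic one. For any P this gives a finite lower bound,
    even when the energy is infinite. *)
Lemma log_energy_ge (P : circle_prob R) n :
  ((mean2 P P (fun z w => ks (srad n) (inner z w)))%:E <= log_energy P)%E.
Proof.
rewrite /log_energy /mean2 -EFin_mean; last first.
  exact: (bnd_mean_ks measurable_cre measurable_cim cre2Dcim2 (srad_gt2 n)).
apply: le_integralT => w; rewrite -EFin_mean; last exact: bnd_ks_inner.
by apply: le_integralT => z; exact: ks_le_log_kernel.
Qed.

End equilibrium_potential.

(** * Minimality, uniqueness and the explicit density *)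

Section minimization.
Context {R : realType}.
Local Notation la := (@lebesgue_measure R).
Local Notation T := (circle_borel R).
Local Notation I := (`[(- pi)%R, pi%R]%classic).
Variables (theta al : R).
Hypotheses (htheta : 0 < theta < 2 * pi) (hal : -1 <= al <= 1).
Local Notation c := (cos (theta / 2)).

Let hc : -1 < c < 1. Proof. exact: cos_half_itv. Qed.

Lemma arcAE : arcA theta = [set z : T | c <= cre z].
Proof. by rewrite /arcA circle_arcE//; have := half_itv htheta; lra. Qed.

Lemma arcAcE : arcAc theta = [set z : T | cre z <= c].
Proof. by rewrite /arcAc circle_arcCE//; have := half_itv htheta; lra. Qed.

Definition far (z : T) : R := (cre z < c)%R%:R.

Lemma bnd_far : bnd far.
Proof.
split; last by exists 1 => z; rewrite /far; case: (_ < _); rewrite ?normr1 ?normr0.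
rewrite (_ : far = \1_[set z : T | (cre z < c)%R]).
  by apply: measurable_indic; exact: measurable_cre_lt.
apply/funext => z; rewrite indicE /far; congr ((nat_of_bool _)%:R).
by apply/idP/idP => [h|/set_mem//]; exact/mem_set.
Qed.

Lemma arcA_far (P : circle_prob R) : P (arcA theta) = (1 - mean P far)%:E.
Proof.
rewrite EFinB mean_bool; last exact: measurable_cre_lt.
rewrite -probability_setC; last exact: measurable_cre_lt.
by congr (P _); rewrite arcAE; apply/seteqP; split => z /=; rewrite leNgt => /negP.
Qed.

Variable nu : circle_prob R.
Hypothesis nuE : forall B, nu B = equilibrium_density al c B.

Lemma mean_far_equilibrium : mean nu far = far_mass c al.
Proof.
rewrite (mean_equilibrium hal hc nuE bnd_far) /far_mass [RHS]mulrC.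
rewrite -RintegralZl//; last by apply: (integrable_hfar hc); have := hal; lra.
by apply: eq_Rintegral => psi _; rewrite /hfar /weight /far cre_expi; ring.
Qed.

(** The step function equal to the support value of the potential on each arc. Its mean under P
    depends on P only through the far mass, so it is the same for all competitors. *)
Definition level (z : T) : R := pot al c 0 + (pot al c pi - pot al c 0) * far z.

Lemma bnd_level : bnd level.
Proof.
by apply: bndD; [exact: bnd_cst|apply: bndM; [exact: bnd_cst|exact: bnd_far]].
Qed.

Lemma I_carg (z : T) : I (carg z).
Proof. by rewrite /= in_itv /=; have /andP[a b] := carg_itv z; rewrite b (ltW a). Qed.

Lemma level_le z : level z <= cpot al c z.
Proof.
rewrite /level /far /cpot; have Iz := I_carg z; case: ltP => h.
  by rewrite mulr1 addrC subrK; apply: pot_gepi => //; rewrite cos_carg ltW.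
by rewrite mulr0 addr0; apply: pot_ge0 => //; rewrite cos_carg.
Qed.

Lemma mean_level (P : circle_prob R) :
  mean P level = pot al c 0 + (pot al c pi - pot al c 0) * mean P far.
Proof.
rewrite /level meanD ?mean_cst ?meanZ//; [exact: bnd_far|exact: bnd_cst|].
by apply: bndM; [exact: bnd_cst|exact: bnd_far].
Qed.

Lemma mean_cpot_ge (P : circle_prob R) : mean P level <= mean P (cpot al c).
Proof.
by apply: mean_le => [||z]; [exact: bnd_level|exact: bnd_cpot nuE|exact: level_le].
Qed.

(** The potential equals [level] wherever [ratio] is positive, and the weight vanishes elsewhere. *)
Lemma mean_cpot_equilibrium : mean nu (cpot al c) = mean nu level.
Proof.
rewrite !(mean_equilibrium hal hc nuE); [|exact: bnd_level|exact: bnd_cpot nuE].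
apply: eq_Rintegral => psi _.
have [h|h] := leP (ratio al c psi) 0.
  by rewrite /weight /hre ler0_sqrtr// mul0r !mulr0.
congr (_ * _); rewrite /level /far /cpot.
have := I_carg (expi psi); have := cos_carg (expi psi); rewrite cre_expi => e Iz.
move: h; rewrite /ratio; case: (ltP (cos psi) c) => l.
  rewrite nmulr_lgt0 ?invr_lt0 ?subr_lt0// => h.
  by rewrite mulr1 addrC subrK; apply: pot_nearpi; rewrite // e ltW.
move=> h; rewrite mulr0 addr0; apply: (pot_near0 hal hc Iz); rewrite e//.
(* At [cos psi = c] the ratio is 0, the inverse of 0 being 0, so this angle contradicts the
   positivity of the ratio. *)
have [e0|ne] := eqVneq (cos psi) c; first by move: h; rewrite e0 subrr invr0 mulr0 ltxx.
have l' : c < cos psi by rewrite lt_neqAle eq_sym ne.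
by move: h; rewrite pmulr_lgt0 ?invr_gt0 ?subr_gt0// => /ltW.
Qed.

(** In the quadratic form of P minus nu, the PP term is at most E and the other two converge to
    means of [cpot]; then [level] bounds [cpot] from below under P and has the same mean under nu.
    The coefficients [cf] grow as s decreases to 2, so the one at [srad 0] works for all n. *)
Lemma moment_gap (P : circle_prob R) (E : R) m k : (k < m.+2)%N ->
  mean P far = mean nu far -> (log_energy P <= E%:E)%E ->
  cf (srad 0) m * 'C(m.+1, k)%:R *
    (mom cre cim P m.+1 k - mom cre cim nu m.+1 k) ^+ 2 <= E - mean nu level.
Proof.
move=> km eP hE; set X := _ * _.
have lim : E - 2 * mean P (smooth_pot nu n) + mean nu (smooth_pot nu n) @[n --> \oo] -->
    E - 2 * mean P (cpot al c) + mean nu (cpot al c).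
  apply: cvgD; last exact: cvg_mean_smooth_pot.
  apply: cvgB; first exact: cvg_cst.
  by apply: cvgM; [exact: cvg_cst|exact: cvg_mean_smooth_pot].
have h : X <= E - 2 * mean P (cpot al c) + mean nu (cpot al c).
  apply: (cvg_ge_lim lim) => n.
  have := mean2_ks_quad measurable_cre measurable_cim cre2Dcim2 (srad_gt2 n) P nu km.
  have := le_trans (log_energy_ge P n) hE; rewrite lee_fin.
  rewrite -/(mean2 P P _) => e1 e2.
  have e3 : X <= cf (srad n) m * 'C(m.+1, k)%:R *
      (mom cre cim P m.+1 k - mom cre cim nu m.+1 k) ^+ 2.
    rewrite /X ler_wpM2r ?sqr_ge0// ler_wpM2r// /cf ler_wpM2r ?invr_ge0// ler_wpM2r ?invr_ge0//.
    have p0 := lt_trans (ltr0n R 2) (srad_gt2 n); have p1 := lt_trans (ltr0n R 2) (srad_gt2 0).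
    have q0 : 0 <= 2 / srad 0 :> R by rewrite divr_ge0// ltW.
    have q1 : 0 <= 2 / srad n :> R by rewrite divr_ge0// ltW.
    by rewrite lerXn2r// ler_wpM2l// lef_pV2 ?posrE//; exact: srad_decr.
  move: e1 e2 e3; rewrite /smooth_pot /mean2 /inner; lra.
apply: le_trans h _; rewrite mean_cpot_equilibrium.
have := mean_cpot_ge P; rewrite !mean_level eP; lra.
Qed.

Lemma log_energy_equilibrium_level : log_energy nu = (mean nu level)%:E.
Proof. by rewrite (log_energy_equilibrium hal hc nuE) mean_cpot_equilibrium. Qed.

Lemma equilibrium_min (P : circle_prob R) : mean P far = mean nu far ->
  (log_energy nu <= log_energy P)%E.
Proof.
move=> eP; rewrite log_energy_equilibrium_level.
have h0 := log_energy_ge P 0.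
case E : (log_energy P) => [r||]; [|by rewrite leey|by move: h0; rewrite E leeNy_eq].
(* Any moment would do: the gap dominates a nonnegative multiple of a square. *)
have := @moment_gap P r 0 0 erefl eP; rewrite E lexx lee_fin -subr_ge0 => h.
apply: le_trans (h isT); rewrite mulr_ge0 ?sqr_ge0// mulr_ge0// ltW//.
exact: (cf_gt0 (srad_gt2 0)).
Qed.

Lemma equilibrium_unique (P : circle_prob R) : mean P far = mean nu far ->
  log_energy P = log_energy nu -> forall B, measurable B -> P B = nu B.
Proof.
move=> eP eE; apply: moments_determine => -[|m] k.
  rewrite leqn0 => /eqP ->; rewrite /mom /mono.
  by under eq_fun do rewrite !expr0 mulr1; rewrite !mean_cst.
move=> km; have := @moment_gap P (mean nu level) m k km eP.
rewrite eE log_energy_equilibrium_level lexx subrr => /(_ isT).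
have p : 0 < cf (srad 0 : R) m * 'C(m.+1, k)%:R.
  by rewrite mulr_gt0 ?(cf_gt0 (srad_gt2 0))// ltr0n bin_gt0.
rewrite pmulr_rle0// => h.
have : (mom cre cim P m.+1 k - mom cre cim nu m.+1 k) ^+ 2 == 0 by rewrite eq_le h sqr_ge0.
by rewrite sqrf_eq0 subr_eq0 => /eqP.
Qed.

(** Where the ratio is nonnegative the absolute values in [density] change nothing, and where it is
    nonpositive the weight is 0. Angles of ratio 0 may be on either side, which is why both
    hypotheses are weak inequalities. *)
Lemma equilibrium_angular_density (E : set T) :
  (forall psi, E (expi psi) -> 0 <= ratio al c psi) ->
  (forall psi, ~ E (expi psi) -> ratio al c psi <= 0) ->
  has_angular_density nu E (density theta al).
Proof.
move=> h1 h2 B mB; rewrite nuE /equilibrium_density /image_density.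
rewrite integral_mkcond [RHS]integral_mkcond; apply: eq_integral => psi _.
rewrite !patchE; case: ifPn => [/set_mem[Jpsi Bpsi]|/negP nJ]; last first.
  by rewrite memNset// => -[? []] ? ?; apply: nJ; exact/mem_set.
case: ifPn => [/set_mem[_ [_ Epsi]]|/negP nE].
  by rewrite (density_hre (h1 _ Epsi)).
have nEpsi : ~ E (expi psi) by move=> Epsi; apply: nE; exact/mem_set.
by rewrite /weight /hre ler0_sqrtr ?mul0r// h2.
Qed.

Lemma carrier_iE : carrier_i theta al = [set z : T | c <= cre z] `|` [set z | cre z <= al].
Proof.
rewrite /carrier_i arcAE circle_arcCE ?acos_ge0 ?acos_lepi//.
by rewrite acosK// in_itv.
Qed.

Lemma carrier_iiE : carrier_ii theta al = [set z : T | cre z <= c] `|` [set z | al <= cre z].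
Proof.
rewrite /carrier_ii arcAcE circle_arcE ?acos_ge0 ?acos_lepi//.
by rewrite acosK// in_itv.
Qed.

Lemma angular_density_i : al <= c -> has_angular_density nu (carrier_i theta al) (density theta al).
Proof.
move=> alc; rewrite carrier_iE; apply: equilibrium_angular_density => psi /=; rewrite cre_expi.
- move=> [h|h]; first by rewrite divr_ge0 ?subr_ge0// (le_trans alc).
  by rewrite mulr_le0 ?invr_le0 ?subr_le0// (le_trans h).
- move=> /not_orP[/negP h1 /negP h2]; rewrite -ltNge in h1; rewrite -ltNge in h2.
  by rewrite mulr_ge0_le0 ?invr_le0 ?subr_ge0 ?subr_le0// ltW.
Qed.

Lemma angular_density_ii : c <= al -> has_angular_density nu (carrier_ii theta al) (density theta al).
Proof.
move=> cal; rewrite carrier_iiE; apply: equilibrium_angular_density => psi /=; rewrite cre_expi.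
- move=> [h|h]; last by rewrite divr_ge0 ?subr_ge0// (le_trans cal).
  by rewrite mulr_le0 ?invr_le0 ?subr_le0// (le_trans h).
- move=> /not_orP[/negP h1 /negP h2]; rewrite -ltNge in h1; rewrite -ltNge in h2.
  by rewrite mulr_le0_ge0 ?invr_ge0 ?subr_ge0 ?subr_le0// ltW.
Qed.

End minimization.

(** For al = c the density is uniform and the far mass is a proportion of length. By monotonicity of
    [far_mass], this value decides between the two cases. *)
Lemma far_mass_diag (R : realType) (theta : R) : 0 < theta < 2 * pi ->
  far_mass (cos (theta / 2)) (cos (theta / 2)) = 1 - theta / (2 * pi).
Proof.
move=> ht; have hc := cos_half_itv ht; have p := @pi_gt0 R; have hh := half_itv ht.
have hc' : -1 <= cos (theta / 2) <= 1 by case/andP: hc => a b; rewrite !ltW.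
have := far_massE hc hc'; rewrite acos_cos_half//.
have -> : (\int[lebesgue_measure]_(psi in `](theta / 2)%R, pi%R[)
    (hre (cos (theta / 2)) (cos (theta / 2)) psi)%:E = (pi - theta / 2)%:E)%E.
  rewrite (eq_integral (cst 1%E)).
    rewrite integral_cst//= mul1e lebesgue_measure_itv /= lte_fin.
    by case/andP: hh => _ ->.
  move=> psi /set_mem; rewrite /= in_itv /= => h; rewrite /hre /ratio divff ?sqrtr1//.
  by rewrite subr_eq0 lt_eqF// ltr_cos ?in_itv/=; lra.
move=> [h]; move: p h; move: (@pi R) (far_mass _ _) => P F p h.
have -> : F = (P - theta / 2) / P by rewrite h; field; rewrite gt_eqF.
by field; rewrite gt_eqF.
Qed.

Theorem theorem1p4 (R : realType) (theta q : R)
    (htheta : 0 < theta < 2 * pi) (hq : 0 < q < 1) :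
  exists nu : circle_prob R,
    [/\ constrained_minimizer theta q nu,
        forall mu : circle_prob R, constrained_minimizer theta q mu ->
          forall B, measurable B -> mu B = nu B,
        theta / (2 * pi) <= q ->
          (exists! alpha : R, alpha_i theta q alpha) /\
          (forall alpha : R, alpha_i theta q alpha ->
             has_angular_density nu (carrier_i theta alpha)
               (density theta alpha)) &
        q <= theta / (2 * pi) ->
          (exists alpha : R, alpha_ii theta q alpha) /\
          (forall alpha : R, alpha_ii theta q alpha ->
             has_angular_density nu (carrier_ii theta alpha)
               (density theta alpha))].
Proof.
have hc := cos_half_itv htheta; have p := @pi_gt0 R.
set c := cos (theta / 2) in hc *.
have hcc : -1 <= c <= 1 by case/andP: hc => a b; rewrite !ltW.
have hv : 0 <= 1 - q <= 1 by lra.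
(* The far arc is the complement of [arcA theta], so it has to carry mass 1 - q; this choice of al
   serves both cases. *)
have [al hal fal] := far_mass_surj hc hv.
have diag : far_mass c c = 1 - theta / (2 * pi) := far_mass_diag htheta.
have [nu nuE] := equilibrium_measure hal hc.
have ef : mean nu (far theta) = 1 - q by rewrite (mean_far_equilibrium htheta hal nuE).
have nuq (P : circle_prob R) : P (arcA theta) = q%:E <-> mean P (far theta) = mean nu (far theta).
  rewrite arcA_far// ef; split => [[e]|->]; first by lra.
  by congr EFin; lra.
have emin : constrained_minimizer theta q nu.
  split; first exact/nuq.
  apply/eqP; rewrite eq_le; apply/andP; split.
    apply: le_ereal_inf_tmp => _ [mu /= /nuq h <-].
    exact: (equilibrium_min htheta hal nuE h).
  apply: ereal_inf_lbound; exists nu => //=; exact/nuq.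
have lt_far (a b : R) : -1 <= a <= 1 -> -1 <= b <= 1 -> far_mass c a <= far_mass c b -> a <= b.
  move=> /andP[a0 a1] /andP[b0 b1] h; rewrite leNgt; apply/negP => ba.
  by have := far_mass_lt hc b0 ba a1; rewrite ltNge h.
(* Both integral equations state that the far mass is 1 - q, so injectivity of [far_mass] identifies
   every solution with al; existence, uniqueness and the density formulas all follow from this. *)
have massE a : -1 <= a <= 1 -> mass_integral theta a (Num.min a c) = (1 - q)%:E <-> a = al.
  move=> ha; rewrite (mass_integralE htheta ha) -/c -fal; split => [[e]|->//].
  exact: (far_mass_inj hc ha hal e).
exists nu; split => //.
- move=> mu [/nuq h1 h2] B mB; apply: (equilibrium_unique htheta hal nuE h1) => //.
  by rewrite h2; case: emin.
- move=> hq'; have alc : al <= c by apply: lt_far => //; rewrite fal diag; lra.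
  have uniq a : alpha_i theta q a -> a = al.
    by case=> ha ac e; apply/massE => //; rewrite min_l.
  split; last by move=> a /uniq ->; exact: (angular_density_i htheta hal nuE).
  exists al; split; last by move=> a /uniq.
  by split => //; have /(massE _ hal) : al = al by []; rewrite min_l.
- move=> hq'; have alc : c <= al by apply: lt_far => //; rewrite fal diag; lra.
  have uniq a : alpha_ii theta q a -> a = al.
    by case=> ha ac e; apply/massE => //; rewrite min_r.
  split; last by move=> a /uniq ->; exact: (angular_density_ii htheta hal nuE).
  exists al; split => //.
  by have /(massE _ hal) : al = al by []; rewrite min_r.
Qed.
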